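(* Let the random vector $X=(X_v)_{v\in V}$ on $[0,\infty)^V$ be a Markov tree on the undirected tree $\mathcal{T}=(V,E)$, with joint probability density function $f$ with respect to Lebesgue measure; let $f_v$ denote the marginal density of $X_v$ and $f_{a,b}$ the marginal density of $(X_a,X_b)$. Assume there exists a positive function $g$, regularly varying at infinity with index $-\alpha-1<-1$, such that $f_v(t)/g(t)\to c_v\in(0,\infty)$ as $t\to\infty$ for every $v\in V$. Assume further that for every $e=(a,b)\in E$ there exists a probability density function $q_{a,b}$ on $(0,\infty)$ such that $$\forall y\in(0,\infty),\qquad\lim_{t\to\infty}\frac{t\,f_{a,b}(t,ty)}{f_a(t)}=q_{a,b}(y).$$ Then the following hold. (1) The function $b(t)=\alpha/\{t\,g(t)\}$ is regularly varying at infinity with index $\alpha$ and $b(t)\,\mathbb{P}(X_u>t)\to c_u$ as $t\to\infty$ for every $u\in V$. For every $e=(a,b)\in E$ there is a version of the conditional distribution of $X_b$ given $X_a$ such that the law of $X_b/x_a$ conditionally on $X_a=x_a$ converges weakly, as $x_a\to\infty$, to a probability measure $\mu_e$ on $[0,\infty)$; and for every edge $e=(a,b)\in E$ for which there exist $u\in V$ with $e\in E_u$ and $\bar e\in[u\rightsquigarrow a]$ with $\mu_{\bar e}(\{0\})>0$ we have $\lim_{\delta\downarrow0}\limsup_{x\to\infty}\sup_{\varepsilon\in[0,\delta]}\mathbb{P}(X_b/x>\eta\mid X_a=\varepsilon x)=0$ for all $\eta>0$. (2) For all pairs of neighbours $a,b\in V$, the measure $\mu_{(a,b)}$, i.e.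 the law of the increment $M_{a,b}$, has density $q_{a,b}$, and for almost every $y\in(0,\infty)$, $$c_b\,y^\alpha\,q_{b,a}(y)=c_a\,y^{-2}\,q_{a,b}(y^{-1}).$$ (3) Let $(M_e)_{e\in E}$ be independent random variables with $M_e\sim\mu_e$, and for $u\in V$ let $\Theta_u=(\Theta_{u,v})_{v\in V}$ with $\Theta_{u,u}=1$ and $\Theta_{u,v}=\prod_{e\in[u\rightsquigarrow v]}M_e$ for $v\ne u$. Then $\mathbb{E}[\Theta_{u,v}^\alpha]=c_v/c_u$ for all $u,v\in V$, and $b(t)\,\mathbb{P}(X/t\in\cdot)\to\nu$ in $\mathcal{M}_0$ as $t\to\infty$, where $\nu\in\mathcal{M}_0$ satisfies $$\int h\,\mathrm d\nu=c_u\,\mathbb{E}\left[\int_0^\infty h(z\Theta_u)\,\alpha z^{-\alpha-1}\,\mathrm dz\right]$$ for every $u\in V$ and every Borel measurable $h:[0,\infty)^V\setminus\{0\}\to[0,\infty]$. (4) For all $u,\bar u\in V$ and all Borel measurable $h:[0,\infty)^V\setminus\{0\}\to[0,\infty)$, $$\mathbb{E}[h(\Theta_{\bar u})]=\mathbb{E}\big[h(\Theta_u/\Theta_{u,\bar u})\,\Theta_{u,\bar u}^\alpha\big]\big/\mathbb{E}[\Theta_{u,\bar u}^\alpha].$$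
   Context: Graphs are finite, without self-loops; $V$ has at least two elements and $E\subset V\times V$. A graph is undirected if $(a,b)\in E$ implies $(b,a)\in E$; two nodes are neighbours if joined by an edge. A path from $u$ to $v$ is a set of edges $\{e_1,\dots,e_n\}\subset E$ with $e_k=(u_{k-1},u_k)$ for distinct nodes $u_0=u,u_1,\dots,u_n=v$. An undirected tree is an undirected graph such that for any two distinct nodes $u,v$ there is a unique path from $u$ to $v$, denoted $[u\rightsquigarrow v]$ (a set of directed edges; $[u\rightsquigarrow u]=\emptyset$). For $u\in V$, $E_u\subset E$ denotes the set of edges directed away from $u$: for each pair of edges $(a,b),(b,a)\in E$, $E_u$ contains the one whose first node separates the second node from $u$ (or equals $u$). $X$ is a Markov tree on $\mathcal{T}$ if it has the global Markov property: whenever $A,B,S\subset V$ are disjoint and non-empty and every path between a node of $A$ and a node of $B$ passes through $S$, the vectors $X_A$ and $X_B$ are conditionally independent given $X_S$, where $X_W=(X_v)_{v\in W}$. A fixed version of $f$ is used and $f_v$, $f_{a,b}$ are obtained from it by integrating out the other coordinates (so $f_{a,b}(x,y)=f_{b,a}(y,x)$ and $f_a(x)=\int_0^\infty f_{a,b}(x,y)\,\mathrm dy$). A positive, measurable function $g$ on a neighbourhood of infinity is regularly varying with index $\tau\in\mathbb{R}$ if $g(\lambda t)/g(t)\to\lambda^\tau$ as $t\to\infty$ for all $\lambda>0$. $\mathcal{M}_0$ is the set of Borel measures $\nu$ on $[0,\infty)^V\setminus\{0\}$ such that $\nu(B)<\infty$ for every Borel set $B$ contained in $\{x:\max_{v\in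 V}x_v\ge\varepsilon\}$ for some $\varepsilon>0$, equipped with the smallest topology making $\nu\mapsto\int h\,\mathrm d\nu$ continuous for all bounded continuous $h:[0,\infty)^V\setminus\{0\}\to\mathbb{R}$ for which there is $\varepsilon>0$ with $h(x)=0$ whenever $\max_{v\in V}x_v\le\varepsilon$. The measures $b(t)\mathbb{P}(X/t\in\cdot)$ are understood as restricted to $[0,\infty)^V\setminus\{0\}$. *)

(* Defs.v *)
From HB Require Import structures.
From mathcomp Require Import all_boot all_order all_algebra.
From mathcomp Require Import all_classical all_reals all_analysis.
From mathcomp Require Import measurable_realfun.

Set Implicit Arguments.
Unset Strict Implicit.
Unset Printing Implicit Defensive.

Import Order.TTheory GRing.Theory Num.Theory.
Import numFieldNormedType.Exports.

Local Open Scope classical_set_scope.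
Local Open Scope ring_scope.

Section Graphs.
Variables (V : finType) (E : {set V * V}).

(* The nodes u, s_1, ..., s_n = v of a path from u to v, u itself being kept
   apart as in [path.path]. *)
Definition node_path (u v : V) (s : seq V) : bool :=
  [&& path.path [rel a b | (a, b) \in E] u s, uniq (u :: s) & last u s == v].

Definition is_path (u v : V) (p : {set V * V}) : Prop :=
  exists2 s, node_path u v s & p = [set:: zip (u :: s) s]%SET.

Definition undirected_tree : Prop :=
  [/\ forall a, (a, a) \notin E,
      forall a b, (a, b) \in E -> (b, a) \in E
    & forall u v, u != v -> exists! p, is_path u v p].

(* In an undirected tree, the unique path from u to v, and the empty set when
   u = v. *)
Definition tree_path (u v : V) : {set V * V} :=
  xget (finset.set0 : {set V * V}) (is_path u v).

Definition separates (S A B : {set V}) : Prop :=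
  forall a b s, a \in A -> b \in B -> node_path a b s ->
  exists2 v, v \in S & v \in a :: s.

Definition away_from (u : V) (e : V * V) : Prop :=
  e \in E /\
  (e.1 = u \/ separates [set e.1]%SET [set u]%SET [set e.2]%SET).

End Graphs.

(* R^V with its product topology and its Borel sigma-algebra. *)
Section Vectors.
Variables (R : realType) (V : finType).

Definition rvec : Type := V -> R.

HB.instance Definition _ := Pointed.copy rvec (V -> R).
HB.instance Definition _ := Topological.copy rvec {ptws V -> R}.

Definition rvec_display : measure_display := sigma_display (@open rvec).

HB.instance Definition _ := @isMeasurable.Build rvec_display rvec
  <<s @open rvec >> (@sigma_algebra0 _ setT (@open rvec))
  (@sigma_algebraC _ (@open rvec)) (@sigma_algebra_bigcup _ setT (@open rvec)).

Definition orthant : set rvec := [set x | forall v, 0 <= x v].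

Definition orthant0 : set rvec := orthant `\ (fun=> 0).

Definition maxcoord (x : rvec) : R := \big[Num.max/0]_(v : V) x v.

Definition set_coord (x : rvec) (v : V) (t : R) : rvec :=
  fun v' => if v' == v then t else x v'.

(* Integral of F over [0, +oo) in each of the coordinates listed in s, the
   other coordinates being those of x.  By Tonelli's theorem, for a
   nonnegative measurable F and for s an enumeration of V this is the integral
   of F over [0, +oo)^V with respect to Lebesgue measure. *)
Fixpoint iter_integral (s : seq V) (F : rvec -> \bar R) (x : rvec) : \bar R :=
  if s is v :: s' then
    (\int[lebesgue_measure]_(t in `[0%R, +oo[)
       iter_integral s' F (set_coord x v t))%E
  else F x.

(* The density of X_W at x, which depends on the coordinates of x in W only. *)
Definition marginal (f : rvec -> R) (W : seq V) (x : rvec) : \bar R :=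
  iter_integral [seq v <- enum V | v \notin W] (EFin \o f) x.

Definition marginal1 (f : rvec -> R) (v : V) (t : R) : \bar R :=
  marginal f [:: v] (fun=> t).

Definition marginal2 (f : rvec -> R) (a b : V) (s t : R) : \bar R :=
  marginal f [:: a; b] (fun v => if v == a then s else t).

(* Only the values of f on [0, +oo)^V matter. *)
Definition joint_density d (Omega : measurableType d) (P : probability Omega R)
    (X : V -> {RV P >-> R}) (f : rvec -> R) : Prop :=
  [/\ measurable_fun orthant f,
      forall x, orthant x -> 0 <= f x
    & forall B : set rvec, measurable B ->
        P [set w | B (fun v => X v w)] =
        iter_integral (enum V) (fun x => (\1_B x * f x)%:E) (fun=> 0)].

End Vectors.

Section Markov.
Variables (R : realType) (V : finType) (d : measure_display).
Variables (Omega : measurableType d) (P : probability Omega R).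

(* p is a version of the conditional probability of A given the
   sigma-algebra G. *)
Definition cond_prob (G : set (set Omega)) (A : set Omega) (p : Omega -> R) :
    Prop :=
  [/\ forall B : set R, measurable B -> G (p @^-1` B),
      P.-integrable setT (EFin \o p)
    & forall H, G H -> (\int[P]_(w in H) (p w)%:E)%E = P (A `&` H)].

Definition cond_independent (G1 G2 G : set (set Omega)) : Prop :=
  forall A1 A2 p1 p2, G1 A1 -> G2 A2 ->
    cond_prob G A1 p1 -> cond_prob G A2 p2 ->
    cond_prob G (A1 `&` A2) (fun w => p1 w * p2 w).

Variable X : V -> {RV P >-> R}.

Definition sigma_of (W : {set V}) : set (set Omega) :=
  <<s \bigcup_(v in [set` W]) preimage_set_system setT (X v) measurable >>.

Definition global_markov (E : {set V * V}) : Prop :=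
  forall A B S : {set V},
    A != finset.set0 -> B != finset.set0 -> S != finset.set0 ->
    A :&: B = finset.set0 -> A :&: S = finset.set0 ->
    B :&: S = finset.set0 ->
    separates E S A B ->
    cond_independent (sigma_of A) (sigma_of B) (sigma_of S).

End Markov.

Section Asymptotics.
Variable R : realType.

Definition regularly_varying (g : R -> R) (tau : R) : Prop :=
  (exists t0, (forall t, t0 < t -> 0 < g t) /\
     measurable_fun (`]t0, +oo[ : set R) g) /\
  forall lambda, 0 < lambda ->
    g (lambda * t) / g t @[t --> +oo] --> lambda `^ tau.

Definition pdf_pos (q : R -> R) : Prop :=
  [/\ measurable_fun (`]0, +oo[ : set R) q,
      forall y : R, 0 < y -> 0 <= q y
    & (\int[lebesgue_measure]_(y in `]0%R, +oo[) (q y)%:E)%E = 1%E].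

(* Weak convergence as t tends to infinity of laws on [0, +oo). *)
Definition weak_cvg (m : R -> set R -> \bar R) (mu : set R -> \bar R) : Prop :=
  forall phi : R -> R, {within `[0, +oo[, continuous phi} ->
    (exists C, forall y : R, 0 <= y -> `|phi y| <= C) ->
    (\int[m t]_(y in `[0%R, +oo[) (phi y)%:E)%E @[t --> +oo] -->
      (\int[mu]_(y in `[0%R, +oo[) (phi y)%:E)%E.

(* k is a version of the conditional distribution of Y given Z, where Y and Z
   take values in [0, +oo). *)
Definition cond_distribution d (Omega : measurableType d)
    (P : probability Omega R) (Y Z : {RV P >-> R}) (k : R.-pker R ~> R) : Prop :=
  (forall x : R, 0 <= x -> k x `[0, +oo[%classic = 1%E) /\
  forall A B : set R, measurable A -> measurable B ->
    P (Z @^-1` A `&` Y @^-1` B) = (\int[distribution P Z]_(x in A) k x B)%E.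

End Asymptotics.

Section M0.
Variables (R : realType) (V : finType).
Local Notation T := (rvec R V).

(* A Borel measure on [0, +oo)^V \ {0} is represented by a Borel measure on
   R^V that does not charge the complement of that set. *)
Record M0 := MkM0 {
  M0_measure :> {measure set T -> \bar R};
  M0_support : M0_measure (~` orthant0 (R := R) (V := V)) = 0%E;
  M0_finite : forall B : set T, measurable B ->
    (exists2 e, 0 < e & B `<=` orthant0 (R := R) (V := V) `&`
                                [set x | e <= maxcoord x]) ->
    (M0_measure B < +oo)%E }.

Definition M0_test (h : T -> R) : Prop :=
  [/\ {within orthant0 (R := R) (V := V), continuous h},
      exists C, forall x, orthant0 x -> `|h x| <= C
    & exists2 e, 0 < e & forall x, orthant0 x -> maxcoord x <= e -> h x = 0].

Definition M0_eval (h : {h : T -> R | M0_test h}) (nu : M0) : R :=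
  (\int[nu]_(x in orthant0 (R := R) (V := V)) sval h x)%R.

HB.instance Definition _ := gen_eqMixin M0.
HB.instance Definition _ := gen_choiceMixin M0.

(* The smallest topology making all the maps M0_eval h continuous. *)
HB.instance Definition _ := Topological.copy M0
  (sup_topology (fun h => Topological.class (initial_topology (M0_eval h)))).

End M0.

Section TreeLimit.
Variables (R : realType) (V : finType) (d : measure_display).
Variables (Omega : measurableType d) (P : probability Omega R).

Definition independent_on (E : {set V * V}) (M : V * V -> {RV P >-> R}) : Prop :=
  forall (J : {set V * V}) (B : V * V -> set R), J \subset E ->
    (forall e, measurable (B e)) ->
    P (\bigcap_(e in [set` J]) (M e @^-1` B e)) =
    (\prod_(e in J) P (M e @^-1` B e))%E.

(* For v = u the product is empty, so that the value is 1. *)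
Definition Theta (E : {set V * V}) (M : V * V -> {RV P >-> R}) (u : V)
    (w : Omega) : rvec R V :=
  fun v => \prod_(e in tree_path E u v) M e w.

End TreeLimit.

(* Main.v *)
Require Import Defs.
From HB Require Import structures.
From mathcomp Require Import all_boot all_order all_algebra.
From mathcomp Require Import all_classical all_reals all_analysis.
From mathcomp Require Import measurable_realfun.
From mathcomp Require Import ring lra.

(** Fix a root [u] and attach the other nodes one at a time along the tree.  By
the Markov property a new node [v] depends on the earlier ones only through its
parent [p], so [X] has density [f_u(x_u) * prod_v f_(p,v)(x_p, x_v) / f_p(x_p)].
Scaled by [t], its factors converge pointwise to
[c_u alpha x_u^(-alpha-1) * prod_v q_(p,v)(x_v / x_p) / x_p], which after the
substitution [x_v = x_p m_v] is the density of
[c_u E int 1(z Theta_u in .) alpha z^(-alpha-1) dz].  Karamata's theorem gives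
[b(t) P(X_u > t e) -> c_u e^-alpha], so the masses on [x_u > e] converge as well
and Scheffe's lemma turns pointwise convergence into convergence of integrals of
bounded functions there.  Two roots give the same limit because the prelimits
coincide where both coordinates exceed [e]; hence a single limit measure [nu],
and comparing its polar representations under two roots yields the moments of
[Theta] and the change-of-root formula.  The identity between [q_(a,b)] and
[q_(b,a)] is the symmetry of [f_(a,b)].  Finally [mu_e], having a density, does
not charge [0], so that the last claim of (1) is vacuous. *)

Set Implicit Arguments.
Unset Strict Implicit.
Unset Printing Implicit Defensive.

Import Order.TTheory GRing.Theory Num.Theory.
Import numFieldNormedType.Exports.

Local Open Scope classical_set_scope.
Local Open Scope ring_scope.

(** * Densities, dominated convergence and Scheffe's lemma *)

(** The hypotheses are pointwise statements about one version [f], whereas conditional distributions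
    are determined up to null sets. Hence explicit versions are carried throughout: [f] is extended
    by zero off the orthant, all marginals are iterated integrals of this one function, so that
    their symmetry and consistency hold everywhere, and the conditional density is repaired where
    the quotient does not integrate to 1. Near infinity no repair occurs, because [f_v / g] has a
    limit in (0, +oo). Scheffe's lemma needs no domination of the prelimit densities, but it needs
    their masses to converge to a finite limit. The limit measure is infinite near 0, and its mass
    is computable from one root u only on x_u > e. A function supported on max x > e is therefore
    split over all nodes, by dividing it by the number of coordinates that exceed e. A function of x
    / x_u' restricted to x_u' > 1 has, under any root u, the radial integral Theta_(u,u')^alpha.
    This is the source of both the moments and the change of root. *)

Lemma integral_setI_indic d (T : measurableType d) (R : realType)
    (mu : {measure set T -> \bar R}) (D A : set T) (F : T -> \bar R) :
  (\int[mu]_(x in D `&` A) F x = \int[mu]_(x in D) ((\1_A x)%:E * F x))%E.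
Proof.
rewrite integral_mkcondr; apply: eq_integral => x _.
by rewrite patchE indicE; case: ifP => _; rewrite ?mul1e ?mul0e.
Qed.

Section Density.
Local Open Scope ereal_scope.
Context d (T : measurableType d) (R : realType).
Variables (mu nu : {measure set T -> \bar R}) (phi : T -> R).
Hypotheses (mphi : measurable_fun setT phi) (phi0 : forall x, (0 <= phi x)%R).
Hypothesis nuE : forall A, measurable A -> nu A = \int[mu]_(x in A) (phi x)%:E.

Import HBNNSimple.

(** Monotone convergence along the same simple functions on both sides reduces the claim to
    indicators of level sets, where it is [nuE]. Neither measure is assumed sigma-finite, so [mu]
    may be the measure given by iterated integration. *)
Lemma ge0_integral_density D (F : T -> \bar R) : measurable D ->
  measurable_fun D F -> (forall x, D x -> 0 <= F x) ->
  \int[nu]_(x in D) F x = \int[mu]_(x in D) (F x * (phi x)%:E).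
Proof.
move=> mD mF F0.
have mphiD : measurable_fun D (EFin \o phi).
  by apply/measurable_EFinP; exact: measurable_funS mphi.
pose f_ := nnsfun_approx mD mF.
have mf_ n : measurable_fun D (EFin \o f_ n).
  exact/measurable_EFinP/measurable_funTS.
transitivity (limn (fun n => \int[nu]_(x in D) (f_ n x)%:E)).
  rewrite -monotone_convergence//.
  - apply: eq_integral => y /[!inE] yD; apply/esym/cvg_lim => //.
    exact: cvg_nnsfun_approx.
  - by move=> n y _; rewrite lee_fin.
  - by move=> y _ m n mn; rewrite lee_fin; exact/lefP/nd_nnsfun_approx.
transitivity (limn (fun n => \int[mu]_(x in D) ((f_ n x)%:E * (phi x)%:E))); last first.
  rewrite -monotone_convergence//.
  - apply: eq_integral => y /[!inE] yD; apply/cvg_lim => //.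
    apply: cvgeZr => //.
    exact: cvg_nnsfun_approx.
  - by move=> n; exact: emeasurable_funM (mf_ n) mphiD.
  - by move=> n y _; rewrite mule_ge0// lee_fin.
  - move=> y _ m n mn; apply: lee_wpmul2r; rewrite lee_fin//.
    exact/lefP/nd_nnsfun_approx.
congr (limn _); apply/funext => n.
transitivity (\sum_(k \in range (f_ n))
    \int[nu]_(x in D) (k * \1_(f_ n @^-1` [set k]) x)%:E).
  under eq_integral do rewrite fimfunE -fsumEFin//.
  rewrite ge0_integral_fsum//.
  - by move=> y; exact/measurable_EFinP/measurable_funM.
  - by move=> y x _; rewrite nnfun_muleindic_ge0.
transitivity (\sum_(k \in range (f_ n))
    \int[mu]_(x in D) ((k * \1_(f_ n @^-1` [set k]) x)%:E * (phi x)%:E)); last first.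
  rewrite -ge0_integral_fsum//; last 2 first.
  - move=> r; apply: emeasurable_funM => //.
    exact/measurable_EFinP/measurable_funM.
  - by move=> r x _; rewrite mule_ge0 ?lee_fin// -lee_fin nnfun_muleindic_ge0.
  apply: eq_integral => x _; rewrite (fimfunE (f_ n)) -fsumEFin//.
  rewrite ge0_mule_fsuml// => r; exact: nnfun_muleindic_ge0.
apply: eq_fsbigr => r rf; have {rf} r0 : (0 <= r)%R.
  by move: rf; rewrite inE => -[x _ <-].
rewrite integralZl_indic_nnsfun// integral_indic// nuE; last exact: measurableI.
under [RHS]eq_integral do rewrite EFinM -muleA.
rewrite ge0_integralZl//; last 2 first.
  - apply: emeasurable_funM => //; exact/measurable_EFinP.
  - by move=> x _; rewrite mule_ge0// lee_fin.
congr (_ * _).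
by rewrite setIC integral_setI_indic.
Qed.

Lemma integral_density D (F : T -> \bar R) : measurable D ->
  measurable_fun D F -> 
  \int[nu]_(x in D) F x = \int[mu]_(x in D) (F x * (phi x)%:E).
Proof.
move=> mD mF; rewrite integralE [RHS]integralE.
rewrite !ge0_integral_density//; [|exact: measurable_funeneg|exact: measurable_funepos].
congr (_ - _); apply: eq_integral => x _.
- by rewrite !funeposE maxe_pMl ?lee_fin ?mul0e.
- by rewrite !funenegE maxe_pMl ?lee_fin ?mul0e ?mulNe.
Qed.

End Density.

(** * Dominated convergence and Scheffe's lemma for a real parameter tending to infinity *)

Section Limits.
Local Open Scope ereal_scope.
Context d (T : measurableType d) (R : realType).
Variables (mu : {measure set T -> \bar R}) (D : set T) (mD : measurable D).

(** Convergence at +oo is tested along sequences; the domination being only eventual, the first N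
    terms of each sequence are dropped. *)
Lemma dominated_convergence_pinfty (f : R -> T -> \bar R) (g G : T -> \bar R) :
  (forall t, measurable_fun D (f t)) -> measurable_fun D g ->
  (forall x, D x -> f t x @[t --> +oo%R] --> g x) ->
  mu.-integrable D G ->
  (\forall t \near +oo%R, forall x, D x -> `|f t x| <= G x) ->
  \int[mu]_(x in D) f t x @[t --> +oo%R] --> \int[mu]_(x in D) g x.
Proof.
move=> mf mg fg iG fG; apply/cvge_pinftyP => u uoo.
have [N _ uG] : \forall n \near \oo, forall x, D x -> `|f (u n) x| <= G x.
  exact: uoo fG.
rewrite -(cvg_shiftn N).
have [] // := @dominated_convergence _ _ _ mu D mD (fun n => f (u (n + N)%N)) g G.
- apply: aeW => x Dx.
  apply: (@cvg_comp _ _ _ (fun n => u (n + N)%N) (fun t => f t x) _ (+oo%R)).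
    by rewrite (cvg_shiftn N).
  exact: fg.
- by apply: aeW => x n Dx; apply: uG => //=; rewrite leq_addl.
Qed.

(** Since |h - l| = h + l - 2 min(h, l) and min(h, l) is dominated by the integrable [l],
    convergence of the masses forces the integral of |h - l| to 0. The factor [phi] then costs at
    most C. *)
Lemma scheffe_pinfty (h : R -> T -> R) (l : T -> R) (phi : T -> R) (C : R) :
  (forall t, measurable_fun D (h t)) -> measurable_fun D l ->
  (forall t x, D x -> (0 <= h t x)%R) -> (forall x, D x -> (0 <= l x)%R) ->
  (forall x, D x -> h t x @[t --> +oo%R] --> l x) ->
  \int[mu]_(x in D) (l x)%:E < +oo ->
  \int[mu]_(x in D) (h t x)%:E @[t --> +oo%R] --> \int[mu]_(x in D) (l x)%:E ->
  measurable_fun D phi -> (0 <= C)%R -> (forall x, D x -> (`|phi x| <= C)%R) ->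
  \int[mu]_(x in D) (phi x * h t x)%:E @[t --> +oo%R] -->
    \int[mu]_(x in D) (phi x * l x)%:E.
Proof.
move=> mh ml h0 l0 hl loo hlcvg mphi C0 phiC.
have il : mu.-integrable D (EFin \o l).
  apply/integrableP; split; first exact/measurable_EFinP.
  by under eq_integral do [rewrite /=]; rewrite (eq_integral (EFin \o l))// => x;
    rewrite inE => Dx /=; rewrite ger0_norm ?l0.
have lfin : \int[mu]_(x in D) (l x)%:E \is a fin_num by exact: integrable_fin_num.
have mcvg : \int[mu]_(x in D) (Num.min (h t x) (l x))%:E @[t --> +oo%R] -->
    \int[mu]_(x in D) (l x)%:E.
  apply: (@dominated_convergence_pinfty (fun t x => (Num.min (h t x) (l x))%:E)
    _ (EFin \o l)) => //.
  - by move=> t; apply/measurable_EFinP; exact: measurable_minr.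
  - exact/measurable_EFinP.
  - move=> x Dx; apply: cvg_EFin; first exact: nearW.
    apply/cvgrPdist_lt => e e0; near=> t.
    have : (`|l x - h t x| < e)%R by near: t; move/cvgrPdist_lt : (hl x Dx); exact.
    by apply: le_lt_trans => /=; case: (leP (h t x) (l x)) => // _; rewrite subrr normr0.
  - apply: nearW => t x Dx /=; rewrite lee_fin ger0_norm ?ge_min ?lexx ?orbT//.
    by rewrite le_min h0//= l0.
suff : `|\int[mu]_(x in D) (phi x * h t x)%:E - \int[mu]_(x in D) (phi x * l x)%:E|
    @[t --> +oo%R] --> 0.
  move/cvg_abse0P/sube_cvg0; apply.
  apply: integrable_fin_num => //; apply: (le_integrable mD _ _ (integrableZl mD C il)).
    by apply/measurable_EFinP; exact: measurable_funM.
  move=> x Dx /=; rewrite lee_fin !normrM; apply: ler_wpM2r => //.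
  by rewrite (le_trans (phiC x Dx))// ler_norm.
(* The upper bound is C times the integral of |h - l|, written through the minimum so that its limit
   is C (L + L - 2 L) = 0, with L the mass of [l]. *)
apply: (@squeeze_cvge _ _ _ _ (cst 0) _ (fun t => C%:E * (\int[mu]_(x in D) (h t x)%:E
  + \int[mu]_(x in D) (l x)%:E
  - 2%:E * \int[mu]_(x in D) (Num.min (h t x) (l x))%:E))); last 2 first.
- exact: cvg_cst.
- rewrite -[X in _ --> X](mule0 C%:E); apply: cvgeZl => //.
  rewrite -(subee (x := \int[mu]_(x in D) (l x)%:E + \int[mu]_(x in D) (l x)%:E));
    last by rewrite fin_numD lfin.
  apply: cvgeB.
  + by rewrite fin_num_adde_defl// fin_numN fin_numD lfin.
  + apply: cvgeD => //; last exact: cvg_cst.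
    by rewrite fin_num_adde_defl.
  + rewrite -mule2n -mule_natl; exact: cvgeZl.
(* The limit mass is finite, so the masses of [h t] are finite for large t; integrability of [h t]
   is available only from there on. *)
have [hfin _] := (fine_cvgP _ _).1 (eq_ind_r (fun z => _ --> z) hlcvg (fineK lfin)).
apply: filterS hfin => t hfin.
have ih : mu.-integrable D (EFin \o h t).
  apply/integrableP; split; first exact/measurable_EFinP.
  rewrite (eq_integral (EFin \o h t)) ?ltey_eq ?hfin// => x.
  by rewrite inE => Dx /=; rewrite ger0_norm ?h0.
have bnd k : mu.-integrable D (EFin \o k) -> measurable_fun D k ->
    mu.-integrable D (fun x => (phi x * k x)%:E).
  move=> ik mk; apply: (le_integrable mD _ _ (integrableZl mD C ik)).
    by apply/measurable_EFinP; exact: measurable_funM.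
  move=> x Dx /=; rewrite lee_fin !normrM; apply: ler_wpM2r => //.
  by rewrite (le_trans (phiC x Dx))// ler_norm.
rewrite abse_ge0/= -integralB//; [|exact: bnd|exact: bnd].
have mN : measurable_fun D (fun x => `|h t x - l x|%:E).
  by apply/measurable_EFinP; apply: measurableT_comp => //; exact: measurable_funB.
have mM : measurable_fun D (fun x => (Num.min (h t x) (l x))%:E).
  by apply/measurable_EFinP; exact: measurable_minr.
have M0 x : D x -> (0 <= Num.min (h t x) (l x))%R by move=> Dx; rewrite le_min h0// l0.
have iN : \int[mu]_(x in D) (h t x)%:E + \int[mu]_(x in D) (l x)%:E
   - 2%:E * \int[mu]_(x in D) (Num.min (h t x) (l x))%:E
  = \int[mu]_(x in D) `|h t x - l x|%:E.
  have iM : mu.-integrable D (fun x => (Num.min (h t x) (l x))%:E).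
    apply: (le_integrable mD _ _ il) => //.
    by move=> x Dx; rewrite /= lee_fin !ger0_norm ?M0 ?l0// ge_min lexx orbT.
  rewrite -integralZl// -integralD// -integralB//; last 2 first.
    exact: integrableD.
    exact: integrableZl.
  apply: eq_integral => x; rewrite inE => Dx /=.
  rewrite -!EFinD; congr EFin.
  by case: (leP (h t x) (l x)) => hlx; [rewrite ler0_norm|rewrite gtr0_norm]; lra.
rewrite {}iN -ge0_integralZl//.
apply: (le_trans (le_abse_integral _ mD _)).
  by apply/measurable_EFinP; apply: measurable_funB; exact: measurable_funM.
apply: ge0_le_integral => //.
- by apply/measurable_EFinP/measurableT_comp => //; apply: measurable_funB;
    exact: measurable_funM.
- exact: measurable_funeM.
- move=> x Dx; rewrite -EFinB -EFinM /= lee_fin -mulrBr normrM; apply: ler_wpM2r => //.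
  exact: phiC.
Unshelve. all: by end_near. Qed.

End Limits.

Definition mpush d d' (T1 : measurableType d) (T2 : measurableType d')
    (R : realFieldType) (m : {measure set T1 -> \bar R}) (f : T1 -> T2)
    (mf : measurable_fun setT f) : {measure set T2 -> \bar R} :=
  measure_function_pushforward__canonical__measure_function_Measure m mf.

Lemma ge0_integral_mpush d d' (T1 : measurableType d) (T2 : measurableType d')
    (R : realType) (m : {measure set T1 -> \bar R}) (f : T1 -> T2)
    (mf : measurable_fun setT f) (F : T2 -> \bar R) :
  measurable_fun setT F -> (forall y, (0 <= F y)%E) ->
  (\int[mpush m mf]_y F y = \int[m]_x F (f x))%E.
Proof. by move=> mF F0; rewrite (ge0_integral_pushforward mf)// => y _. Qed.

(** * Kernels and measurability of vectors *)

(* Canonical structures are keyed on the head constant, so that the finite and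
   the s-finite instances have to be attached to different constants. *)
Section ConstantKernel.
Context d d' (X : measurableType d) (Y : measurableType d') (R : realType).

Section finite.
Variable m : {finite_measure set Y -> \bar R}.

Definition kcst_fin (_ : X) : {measure set Y -> \bar R} := m.

Let measurable_kcst_fin U : measurable U ->
  measurable_fun [set: X] (kcst_fin ^~ U).
Proof. by move=> _; exact: measurable_cst. Qed.

HB.instance Definition _ := isKernel.Build _ _ X Y R kcst_fin measurable_kcst_fin.

Let kcst_fin_uub : measure_fam_uub kcst_fin.
Proof.
exists (fine (m setT) + 1)%R => x.
by rewrite EFinD fineK ?fin_num_measure// lteDl ?fin_num_measure.
Qed.

HB.instance Definition _ :=
  @Kernel_isFinite.Build _ _ X Y R kcst_fin kcst_fin_uub.
End finite.

Variable m : {sfinite_measure set Y -> \bar R}.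

Definition kcst (_ : X) : {measure set Y -> \bar R} := m.

Let measurable_kcst U : measurable U -> measurable_fun [set: X] (kcst ^~ U).
Proof. by move=> _; exact: measurable_cst. Qed.

HB.instance Definition _ := isKernel.Build _ _ X Y R kcst measurable_kcst.

Let kcst_sfinite : exists s : (R.-fker X ~> Y)^nat,
  forall x U, measurable U -> kcst x U = kseries s x U.
Proof.
exists (fun n => kcst_fin (sfinite_measure_seq m n)) => x U mU.
exact: sfinite_measure_seqP.
Qed.

HB.instance Definition _ := @Kernel_isSFinite.Build _ _ X Y R kcst kcst_sfinite.
End ConstantKernel.

Section PulledBackKernel.
Context d1 d d' (Z : measurableType d1) (X : measurableType d)
  (Y : measurableType d') (R : realType).
Variables (f : Z -> X) (mf : measurable_fun setT f).

Section finite.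
Variable k : R.-fker X ~> Y.

Definition kpull_fin (_ : measurable_fun setT f) (z : Z) :
  {measure set Y -> \bar R} := k (f z).

Let measurable_kpull_fin U : measurable U ->
  measurable_fun [set: Z] (kpull_fin mf ^~ U).
Proof.
by move=> mU; exact: (measurableT_comp (measurable_kernel k U mU) mf).
Qed.

HB.instance Definition _ :=
  isKernel.Build _ _ Z Y R (kpull_fin mf) measurable_kpull_fin.

Let kpull_fin_uub : measure_fam_uub (kpull_fin mf).
Proof. by have [r kr] := measure_uub k; exists r => x; exact: kr. Qed.

HB.instance Definition _ :=
  @Kernel_isFinite.Build _ _ Z Y R (kpull_fin mf) kpull_fin_uub.
End finite.

Variable k : R.-sfker X ~> Y.

Definition kpull (_ : measurable_fun setT f) (z : Z) :
  {measure set Y -> \bar R} := k (f z).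

Let measurable_kpull U : measurable U -> measurable_fun [set: Z] (kpull mf ^~ U).
Proof.
by move=> mU; exact: (measurableT_comp (measurable_kernel k U mU) mf).
Qed.

HB.instance Definition _ := isKernel.Build _ _ Z Y R (kpull mf) measurable_kpull.

Let kpull_sfinite : exists s : (R.-fker Z ~> Y)^nat,
  forall x U, measurable U -> kpull mf x U = kseries s x U.
Proof.
have [s ks] := sfinite_kernel k.
by exists (fun n => kpull_fin (s n) mf) => x U mU; exact: ks.
Qed.

HB.instance Definition _ :=
  @Kernel_isSFinite.Build _ _ Z Y R (kpull mf) kpull_sfinite.
End PulledBackKernel.

(** * Borel sets of a finite product of lines *)

Section Rvec.
Context (R : realType) (V : finType).
Local Notation T := (rvec R V).

Lemma measurable_coord v : measurable_fun setT (fun x : T => x v).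
Proof.
have c : continuous (fun x : T => x v) by exact: proj_continuous.
apply: (measurability _ (RGenOpens.measurableE R)).
move=> _ [_ [a [b ->] <-]]; rewrite setTI; apply: sub_sigma_algebra.
by move/continuousP : c; apply; exact: interval_open.
Qed.

(** The sigma-algebra on [rvec] is generated by the open sets, not by the coordinates. An open set
    is the union of the countably many boxes with rational centre and radius 1/(n+1) that it
    contains, and the preimage of a box is a finite intersection of coordinate conditions. *)
Lemma measurable_to_rvec d (S : measurableType d) (D : set S) (h : S -> T) :
  (forall v, measurable_fun D (fun w => h w v)) -> measurable_fun D h.
Proof.
move=> mh mD; move: (mD); apply: (measurability (@open T)) => //.
move=> _ [U oU <-].
pose B (i : ({ffun V -> rat} * nat)%type) : set T :=
  [set y | forall v, `|y v - ratr (i.1 v)| < i.2.+1%:R^-1].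
pose C i : set T := if asbool (B i `<=` U) then B i else set0.
have -> : U = \bigcup_(i in [set: ({ffun V -> rat} * nat)%type]) C i.
  apply/seteqP; split=> [x Ux|x [i _]]; rewrite /C; last by case: asboolP => // + Bix; exact.
  (* The filter of uniform neighbourhoods of x converges to x in the product topology, so the open
     set [U] contains a uniform ball of some radius 1/(n+1). *)
  pose F : set_system T := filter_from setT (fun n : nat =>
    [set y : T | forall v, `|y v - x v| < n.+1%:R^-1]).
  have FF : Filter F.
    apply: filter_from_filter; first by exists 0%N.
    move=> i j _ _; exists (maxn i j) => // y yij.
    by split=> v; apply: lt_le_trans (yij v) _; rewrite lef_pV2 ?posrE// ler_nat ltnS
      ?leq_maxl ?leq_maxr.
  have Fx : F --> x.
    apply/cvg_sup => v W [_ [[Z oZ <-] Zx] ZW]; rewrite nbhs_filterE.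
    apply: (filterS ZW).
    suff /(_ Z) : (fun y : T => y v) @ F --> x v by apply; exact: open_nbhs_nbhs.
    apply/cvgrPdist_lt => e e0.
    have [n _ /(_ n (leqnn n)) /= ne] := near_infty_natSinv_lt (PosNum e0).
    by exists n => // y /= /(_ v); rewrite distrC => /lt_trans; apply.
  have [n _ nU] : F U by apply: Fx; exact: open_nbhs_nbhs.
  (* With half that radius, 1/(2n+2), a box around a rational point this close to x contains x and
     stays inside the ball. *)
  have cq v : exists q : rat, `|x v - ratr q| < (n.*2.+2)%:R^-1.
    have e0 : 0 < (n.*2.+2)%:R^-1 :> R by rewrite invr_gt0.
    have [|q] := @rat_in_itvoo R (x v - (n.*2.+2)%:R^-1) (x v + (n.*2.+2)%:R^-1).
      by rewrite ltrD2l (lt_trans _ e0)// oppr_lt0.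
    by rewrite in_itv/= => /andP[q1 q2]; exists q; rewrite distrC ltr_distl q1.
  pose c : {ffun V -> rat} := [ffun v => xchoose (cq v)].
  exists (c, n.*2.+1) => //; rewrite /C asboolT => [v|y By].
    by rewrite /= ffunE; exact: (xchooseP (cq v)).
  apply: nU => v; have := xchooseP (cq v); have := By v; rewrite /= ffunE => h1 h2.
  have -> : n.+1%:R^-1 = (n.*2.+2)%:R^-1 + (n.*2.+2)%:R^-1 :> R.
    by rewrite -doubleS -muln2 natrM invfM -splitr.
  rewrite -(subrKA (ratr (xchoose (cq v)))); apply: le_lt_trans (ler_normD _ _) _.
  by rewrite ltrD// distrC.
rewrite preimage_bigcup setI_bigcupr; apply: countable_bigcupT_measurable => //.
move=> i; rewrite /C; case: ifPn => _; last by rewrite preimage_set0 setI0.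
rewrite [X in _ `&` X](_ : _ = \bigcap_(v in [set: V])
    (fun w => h w v) @^-1` (ball (ratr (i.1 v) : R) i.2.+1%:R^-1)); last first.
  apply/seteqP; split=> [w Bw v _|w Bw v]; first by rewrite /= /ball/= distrC; exact: Bw.
  by have := Bw v I; rewrite /= /ball/= distrC.
(* Distributing the intersection with the domain over the coordinates requires a coordinate to
   exist; for empty V the box is everything. *)
have [[v0]|V0] := pselect (inhabited V); last first.
  rewrite [X in _ `&` X](_ : _ = setT) ?setIT//.
  by apply/seteqP; split=> // w _ v; case: V0.
rewrite -bigcapIr; last by exists v0.
apply: fin_bigcap_measurable; first exact: finite_finset.
by move=> v _; apply: mh => //; exact: measurable_ball.
Qed.

End Rvec.

(** * Iterated Lebesgue integrals *)

Section Scaling.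
Context (R : realType).
Local Notation mu := (@lebesgue_measure R).
Local Open Scope ereal_scope.

(** Both sides are measures that agree on half-open intervals, which determine Lebesgue measure. *)
Lemma lebesgue_measure_scale (r : R) (A : set R) : (0 < r)%R -> measurable A ->
  mu A = r%:E * mu [set x | A (r * x)%R].
Proof.
move=> r0 mA.
pose f : measurableTypeR R -> measurableTypeR R := fun x => (r * x)%R.
have mr : measurable_fun setT f by exact: measurable_funM.
pose r' := NngNum (ltW r0).
rewrite -[RHS]/(mscale r' (mpush mu mr) A).
apply: (@lebesgue_measure_unique R (mscale r' (mpush mu mr))) => // _ [[a b]] _ <-.
rewrite -[RHS]/(r%:E * mu (f @^-1` `]a, b]%classic)).
rewrite [f @^-1` _](_ : _ = `](a / r)%R, (b / r)%R]%classic); last first.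
  apply/seteqP; split=> x /=; rewrite !in_itv/=;
    by rewrite ltr_pdivrMr// ler_pdivlMr// (mulrC x).
rewrite !lebesgue_measure_itv/= !lte_fin ltr_pM2r ?invr_gt0//.
case: ifPn => _; last by rewrite mule0.
by rewrite -!EFinD -EFinM -mulrBl mulrC divfK ?gt_eqF.
Qed.

Lemma ge0_integral_scale (r : R) (F : R -> \bar R) : (0 < r)%R ->
  measurable_fun setT F -> (forall x, 0 <= F x) ->
  \int[mu]_x F x = \int[mu]_x (r%:E * F (r * x)%R).
Proof.
move=> r0 mF F0.
pose f : measurableTypeR R -> measurableTypeR R := fun x => (r * x)%R.
have mr : measurable_fun setT f by exact: measurable_funM.
rewrite ge0_integralZl//; last 2 first.
  exact: measurableT_comp.
  by rewrite lee_fin ltW.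
rewrite -(ge0_integral_mpush mu mr)//.
pose r' := NngNum (ltW r0).
transitivity (\int[mscale r' (mpush mu mr)]_x F x); last first.
  by rewrite ge0_integral_mscale.
apply: eq_measure_integral => A mA _ /=.
exact: lebesgue_measure_scale.
Qed.

End Scaling.

Section IteratedIntegral.
Context (R : realType) (V : finType).
Local Notation T := (rvec R V).
Local Notation mu := (@lebesgue_measure R).
Local Open Scope ereal_scope.

Lemma measurable_set_coord v :
  measurable_fun setT (fun z : T * measurableTypeR R => set_coord z.1 v z.2).
Proof.
apply: measurable_to_rvec => v'; rewrite /set_coord.
case: (v' == v); first exact: measurable_snd.
exact: (measurableT_comp (measurable_coord v') measurable_fst).
Qed.

(** From a point x, the coordinates listed in [s] are redrawn from Lebesgue measure and the others
    are kept. As an s-finite kernel this gives measurability of iterated integrals in the kept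
    coordinates, and Tonelli's theorem. *)
Fixpoint iterk (s : seq V) : R.-sfker T ~> T :=
  if s is v :: s' then
    mkcomp (kcst mu : R.-sfker T ~> measurableTypeR R)
           (kpull (iterk s') (measurable_set_coord v))
  else kdirac (@measurable_id _ T setT).

End IteratedIntegral.

HB.lock Definition iterint (R : realType) (V : finType) (s : seq V)
    (F : rvec R V -> \bar R) (x : rvec R V) : \bar R :=
  (\int[iterk R s x]_y F y)%E.

Section IteratedIntegral.
Context (R : realType) (V : finType).
Local Notation T := (rvec R V).
Local Notation mu := (@lebesgue_measure R).
Local Open Scope ereal_scope.

Lemma iterint_nil (F : T -> \bar R) x : measurable_fun setT F ->
  iterint [::] F x = F x.
Proof. by move=> mF; rewrite iterint.unlock/= integral_dirac// diracT mul1e. Qed.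

Lemma iterint_cons v s (F : T -> \bar R) x : measurable_fun setT F ->
  (forall y, 0 <= F y) ->
  iterint (v :: s) F x = \int[mu]_t iterint s F (set_coord x v t).
Proof. by move=> mF F0; rewrite iterint.unlock/= integral_kcomp. Qed.

Lemma measurable_iterint s (F : T -> \bar R) : measurable_fun setT F ->
  (forall y, 0 <= F y) -> measurable_fun setT (iterint s F).
Proof.
move=> mF F0; rewrite iterint.unlock.
apply: (measurable_fun_integral_sfinite_kernel (fun z => F z.2) (iterk R s)) => //.
exact: (measurableT_comp mF measurable_snd).
Qed.

Lemma iterint_ge0 s (F : T -> \bar R) x : (forall y, 0 <= F y) ->
  0 <= iterint s F x.
Proof. by move=> F0; rewrite iterint.unlock; exact: integral_ge0. Qed.

Lemma eq_iterint s (F G : T -> \bar R) x : F =1 G ->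
  iterint s F x = iterint s G x.
Proof. by move=> /funext ->. Qed.

End IteratedIntegral.

Section IteratedIntegralTheory.
Context (R : realType) (V : finType).
Local Notation T := (rvec R V).
Local Notation mu := (@lebesgue_measure R).
Local Open Scope ereal_scope.
Implicit Types (F : T -> \bar R) (x y : T).

Lemma measurable_set_coord1 x v :
  measurable_fun setT (fun t : measurableTypeR R => set_coord x v t).
Proof.
apply: measurable_to_rvec => v'; rewrite /set_coord.
by case: (v' == v); [exact: measurable_id|exact: measurable_cst].
Qed.

Lemma measurable_iterint1 s F x v : measurable_fun setT F ->
  (forall y, 0 <= F y) ->
  measurable_fun setT (fun t : measurableTypeR R => iterint s F (set_coord x v t)).
Proof.
move=> mF F0.
exact: (measurableT_comp (measurable_iterint s mF F0) (measurable_set_coord1 x v)).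
Qed.

(** The coordinates in [s] are overwritten before [F] is evaluated. *)
Lemma iterint_agree s F x y : measurable_fun setT F -> (forall y, 0 <= F y) ->
  (forall v, v \notin s -> x v = y v) -> iterint s F x = iterint s F y.
Proof.
move=> mF F0; elim: s x y => [|v s IH] x y xy.
  by rewrite !iterint_nil//; congr F; apply/funext => v; apply: xy.
rewrite !iterint_cons//; apply: eq_integral => t _; apply: IH => w ws.
rewrite /set_coord; case: eqP => // /eqP wv.
by apply: xy; rewrite inE negb_or wv.
Qed.

Lemma iterint_swap v w s F x : measurable_fun setT F -> (forall y, 0 <= F y) ->
  iterint (v :: w :: s) F x = iterint (w :: v :: s) F x.
Proof.
move=> mF F0; have [->//|vw] := eqVneq v w.
rewrite !iterint_cons//.
under eq_integral do rewrite iterint_cons//.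
under [RHS]eq_integral do rewrite iterint_cons//.
pose G (z : measurableTypeR R * measurableTypeR R) :=
  iterint s F (set_coord (set_coord x v z.1) w z.2).
have mG : measurable_fun setT G.
  apply: (measurableT_comp (measurable_iterint s mF F0)).
  apply: measurable_to_rvec => u; rewrite /set_coord.
  case: (u == w); first exact: measurable_snd.
  by case: (u == v); [exact: measurable_fst|exact: measurable_cst].
rewrite (@fubini_tonelli _ _ _ _ _ mu mu G mG) => [|z]; last exact: iterint_ge0.
apply: eq_integral => t _; apply: eq_integral => u _.
congr (iterint s F _); apply/funext => i; rewrite /set_coord /=.
by case: eqP => [->|//]; rewrite (negbTE (_ : w != v))// eq_sym.
Qed.

(** Adjacent transpositions, justified by Tonelli, bring the head of one list to the front of the
    other; the tails are handled by induction. *)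
Lemma iterint_perm s s' F x : measurable_fun setT F -> (forall y, 0 <= F y) ->
  perm_eq s s' -> iterint s F x = iterint s' F x.
Proof.
move=> mF F0.
have move_front v p q y : iterint (p ++ v :: q) F y = iterint (v :: p ++ q) F y.
  elim: p y => [//|w p IH] y.
  rewrite [_ ++ _]/= iterint_swap// iterint_cons// [RHS]iterint_cons//.
  by apply: eq_integral => t _; exact: IH.
elim: s s' x => [|v s IH] s' x ss'.
  by move/perm_size: ss'; case: s'.
have vs' : v \in s' by rewrite -(perm_mem ss') mem_head.
case/splitPr: vs' ss' => p q ss'.
rewrite move_front !iterint_cons//; apply: eq_integral => t _; apply: IH.
by rewrite -(perm_cons v) (perm_trans ss')// perm_catC/= perm_cons perm_catC.
Qed.

Lemma iterint_mull s (c : T -> R) F x : measurable_fun setT F ->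
  (forall y, 0 <= F y) -> measurable_fun setT c -> (forall y, (0 <= c y)%R) ->
  (forall y z, (forall v, v \notin s -> y v = z v) -> c y = c z) ->
  iterint s (fun y => (c y)%:E * F y) x = (c x)%:E * iterint s F x.
Proof.
move=> mF F0 mc c0.
have mcF : measurable_fun setT (fun y => (c y)%:E * F y).
  by apply: emeasurable_funM => //; exact/measurable_EFinP.
have cF0 y : 0 <= (c y)%:E * F y by rewrite mule_ge0 ?lee_fin.
elim: s x => [|v s IH] x cc; first by rewrite !iterint_nil.
rewrite !iterint_cons//.
rewrite -ge0_integralZl ?lee_fin//; last 2 first.
- exact: measurable_iterint1.
- by move=> t _; exact: iterint_ge0.
apply: eq_integral => t _; rewrite IH.
  congr (_%:E * _); apply: cc => w; rewrite inE negb_or => /andP[wv _].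
  by rewrite /set_coord (negbTE wv).
by move=> y z yz; apply: cc => w; rewrite inE negb_or => /andP[_ /yz].
Qed.

Lemma iterint_cat s s' F x : measurable_fun setT F -> (forall y, 0 <= F y) ->
  iterint (s ++ s') F x = iterint s (iterint s' F) x.
Proof.
move=> mF F0; have mJ := measurable_iterint s' mF F0.
have J0 y : 0 <= iterint s' F y by exact: iterint_ge0.
elim: s x => [|v s IH] x; first by rewrite iterint_nil.
by rewrite !iterint_cons//; apply: eq_integral => t _.
Qed.

Definition scalev (r : R) x : T := fun v => (r * x v)%R.

Lemma measurable_scalev r : measurable_fun setT (scalev r).
Proof.
by apply: measurable_to_rvec => v; apply: measurable_funM => //; exact: measurable_coord.
Qed.

Lemma iterint_scale r s F x : (0 < r)%R -> measurable_fun setT F ->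
  (forall y, 0 <= F y) ->
  iterint s F (scalev r x) = (r ^+ size s)%:E * iterint s (F \o scalev r) x.
Proof.
move=> r0 mF F0; have mFr := measurableT_comp mF (measurable_scalev r).
elim: s x => [|v s IH] x; first by rewrite !iterint_nil// mul1e.
rewrite !iterint_cons//; last by move=> y; exact: F0.
rewrite (ge0_integral_scale r0); last 2 first.
- exact: measurable_iterint1.
- by move=> t; exact: iterint_ge0.
rewrite -ge0_integralZl ?lee_fin ?exprn_ge0 ?ltW//; last 2 first.
- by apply: measurable_iterint1 => // y; exact: F0.
- by move=> t _; apply: iterint_ge0 => y; exact: F0.
apply: eq_integral => t _.
rewrite (_ : set_coord _ _ _ = scalev r (set_coord x v t)).
  by rewrite IH/= exprS EFinM muleA.
by apply/funext => w; rewrite /set_coord /scalev; case: (w == v).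
Qed.

Lemma measurable_orthant : measurable (@orthant R V).
Proof.
rewrite (_ : @orthant R V = \bigcap_(v in [set: V]) ((fun x : T => x v) @^-1` `[0%R, +oo[)).
  apply: fin_bigcap_measurable; first exact: finite_finset.
  move=> v _; rewrite -[X in measurable X]setTI.
  by apply: measurable_coord.
apply/seteqP; split=> x; first by move=> xo v _; rewrite /= in_itv/= andbT.
by move=> xo v; have := xo v I; rewrite /= in_itv/= andbT.
Qed.

(** Bridge from integrals over [0, +oo) to integrals over the line, with [F] extended by zero off
    the orthant. Once a coordinate is negative it stays so, because the list has no repetition, and
    the extended integrand vanishes. *)
Lemma iter_integralE s F x : uniq s -> orthant x ->
  measurable_fun (@orthant R V) F -> (forall y, orthant y -> 0 <= F y) ->
  iter_integral s F x = iterint s (F \_ (@orthant R V)) x.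
Proof.
move=> + + mF F0.
have mF' : measurable_fun setT (F \_ (@orthant R V)).
  exact/(measurable_restrictT _ measurable_orthant).
have F'0 y : 0 <= (F \_ (@orthant R V)) y by apply: erestrict_ge0.
elim: s x => [|v s IH] x /=; first by move=> _ xo; rewrite iterint_nil// patchE mem_set.
move=> /andP[vs us] xo; rewrite iterint_cons// integral_mkcond.
apply: eq_integral => t _; rewrite patchE.
case: ifPn => [|]; rewrite ?inE ?notin_setE/= in_itv/= andbT => t0.
  by apply: IH => // w; rewrite /set_coord; case: eqP.
(* For a negative value of coordinate v, the indicator of y_v >= 0 may be inserted in front of the
   integrand. It is constant in the remaining coordinates, hence factors out, and there it is 0. *)
pose c (y : T) : R := \1_[set y : T | (0 <= y v)%R] y.
have cE y : c y = (if 0 <= y v then 1 else 0)%R.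
  rewrite /c indicE; case: ifPn => h; first by rewrite mem_set.
  by rewrite memNset//; exact/negP.
rewrite (@eq_iterint _ _ _ _ (fun y => (c y)%:E * (F \_ (@orthant R V)) y)); last first.
  move=> y; rewrite /c indicE; case: (boolP (y \in _)) => [_|]; first by rewrite mul1e.
  by rewrite mul0e notin_setE/= => yv; rewrite patchE memNset.
rewrite iterint_mull//; first 1 last.
- apply: measurable_indic; rewrite -[X in measurable X]setTI.
  rewrite (_ : mkset _ = (fun x : T => x v) @^-1` `[0%R, +oo[); first exact: measurable_coord.
  by apply/seteqP; split=> y /=; rewrite in_itv/= andbT.
- by move=> y z yz; rewrite !cE yz.
by rewrite /c indicE memNset ?mul0e//= /set_coord eqxx.
Qed.

End IteratedIntegralTheory.

(** * Disintegration *)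

Section DensityMeasure.
Local Open Scope ereal_scope.
Context d (T : measurableType d) (R : realType).
Variables (mu : {measure set T -> \bar R}) (phi : T -> R).
Hypotheses (mphi : measurable_fun setT phi) (phi0 : forall x, (0 <= phi x)%R).

Definition dens (_ : measurable_fun setT phi) (_ : forall x, (0 <= phi x)%R)
  (A : set T) : \bar R := \int[mu]_(x in A) (phi x)%:E.

Local Notation m := (dens mphi phi0).

Let dens0 : m set0 = 0.
Proof. by rewrite /dens integral_set0. Qed.

Let dens_ge0 A : 0 <= m A.
Proof. by apply: integral_ge0 => x _; rewrite lee_fin. Qed.

Let dens_sigma_additive : semi_sigma_additive m.
Proof.
move=> F mF tF mUF; rewrite /dens ge0_integral_bigcup//.
- apply: is_cvg_ereal_nneg_natsum_cond => n _ _.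
  by apply: integral_ge0 => x _; rewrite lee_fin.
- by apply/measurable_EFinP; exact: measurable_funTS.
- by move=> x _; rewrite lee_fin.
Qed.

HB.instance Definition _ := isMeasure.Build _ _ _ m
  dens0 dens_ge0 dens_sigma_additive.

Definition mdens : {measure set T -> \bar R} := m.

Lemma mdensE A : mdens A = \int[mu]_(x in A) (phi x)%:E. Proof. by []. Qed.

Lemma ge0_integral_mdens D (F : T -> \bar R) : measurable D ->
  measurable_fun D F -> (forall x, D x -> 0 <= F x) ->
  \int[mdens]_(x in D) F x = \int[mu]_(x in D) (F x * (phi x)%:E).
Proof. exact: ge0_integral_density. Qed.

Lemma integral_mdens D (F : T -> \bar R) : measurable D ->
  measurable_fun D F ->
  \int[mdens]_(x in D) F x = \int[mu]_(x in D) (F x * (phi x)%:E).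
Proof. exact: integral_density. Qed.

End DensityMeasure.

(** * Finite measures determined by their values on boxes *)

Section Boxes.
Context (R : realType) (V : finType).
Local Notation T := (rvec R V).
Local Notation mu := (@lebesgue_measure R).
Local Open Scope ereal_scope.

Definition box (p : seq V) (B : V -> set R) : set T :=
  [set x | forall i, i \in p -> B i (x i)].

Lemma measurable_box p B : (forall i, measurable (B i)) -> measurable (box p B).
Proof.
move=> mB; rewrite (_ : box p B = \bigcap_(i in [set` p]) ((fun x : T => x i) @^-1` B i)).
  apply: fin_bigcap_measurable; first exact: finite_seq.
  move=> i _; rewrite -[X in measurable X]setTI.
  exact: measurable_coord.
by apply/seteqP; split=> x xB i; exact: xB.
Qed.

(** Boxes times measurable sets form a pi-system that contains the whole space and generates the
    product sigma-algebra. *)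
Lemma measure_unique_box (m1 m2 : {measure set (T * measurableTypeR R) -> \bar R}) :
  (forall B B', (forall i, measurable (B i)) -> measurable B' ->
    m1 (box (enum V) B `*` B') = m2 (box (enum V) B `*` B')) ->
  m1 setT < +oo -> forall A, measurable A -> m1 A = m2 A.
Proof.
move=> m12 m1oo.
pose G : set (set (T * measurableTypeR R)) := [set A | exists B B',
  [/\ forall i, measurable (B i), measurable B' & A = box (enum V) B `*` B']].
have GT : G setT.
  exists (fun=> setT), setT; split=> //.
  by apply/seteqP; split.
have mG : measurable = <<s G >>.
  apply/seteqP; split; last first.
    apply: smallest_sub; first exact: sigma_algebra_measurable.
    move=> _ [B [B' [mB mB' ->]]]; apply: measurableX => //.
    exact: measurable_box.
  (* Generation is expressed as measurability of the identity from the generated sigma-algebra,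
     which is checked one coordinate at a time. *)
  have mid : measurable_fun setT
      (idfun : g_sigma_algebraType G -> T * measurableTypeR R).
    apply/measurable_fun_pairP; split.
      apply: measurable_to_rvec => v _ B mB; rewrite setTI; apply: sub_sigma_algebra.
      exists (fun i => if i == v then B else setT), setT; split=> //.
        by move=> i; case: ifP.
      apply/seteqP; split=> [x xB|x [xB _]].
        by split=> // i _; case: eqP => [->|].
      by have := xB v; rewrite mem_enum eqxx; exact.
    move=> _ B mB; rewrite setTI; apply: sub_sigma_algebra.
    exists (fun=> setT), B; split=> //.
    by apply/seteqP; split=> [x xB|x [_ xB]].
  by move=> A mA; have := mid measurableT A mA; rewrite setTI.
apply: (measure_unique G (fun=> setT)) => //.
- move=> _ _ [B [B' [mB mB' ->]]] [C [C' [mC mC' ->]]].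
  exists (fun i => B i `&` C i), (B' `&` C'); split.
  + by move=> i; exact: measurableI.
  + exact: measurableI.
  + apply/seteqP; split=> [x [[xB xB'] [xC xC']]|x [xBC [xB' xC']]].
      by split=> // i iV; split; [exact: xB|exact: xC].
    by split; split=> // i iV; have [] := xBC i iV.
- exact: bigcup_const.
- by move=> _ [B [B' [mB mB' ->]]]; exact: m12.
Qed.

End Boxes.

Section Disintegration.
Context (R : realType) (V : finType) d (Omega : measurableType d)
  (P : probability Omega R).
Local Notation T := (rvec R V).
Local Notation mu := (@lebesgue_measure R).
Local Open Scope ereal_scope.

(** The joint law of (W, Z) and the image of P x Lebesgue, weighted by rho(W w, t), under (w, t) ->
    (W w, t) agree on boxes, hence everywhere. The conditional density of Z given W need therefore
    be verified on boxes only. *)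
Lemma disintegration (W : Omega -> T) (Z : Omega -> R) (rho : T -> R -> R) :
  measurable_fun setT W -> measurable_fun setT Z ->
  measurable_fun setT (fun z : T * measurableTypeR R => rho z.1 z.2) ->
  (forall x t, (0 <= rho x t)%R) ->
  (forall B B', (forall i, measurable (B i)) -> measurable B' ->
    P (W @^-1` box (enum V) B `&` Z @^-1` B') =
    \int[P]_(w in W @^-1` box (enum V) B) \int[mu]_(t in B') (rho (W w) t)%:E) ->
  forall G : T * measurableTypeR R -> \bar R, measurable_fun setT G ->
    (forall z, 0 <= G z) ->
  \int[P]_w G (W w, Z w) = \int[P]_w \int[mu]_t (G (W w, t) * (rho (W w) t)%:E).
Proof.
move=> mW mZ mrho rho0 PB G mG G0.
pose WZ w : T * measurableTypeR R := (W w, Z w).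
have mWZ : measurable_fun setT WZ by apply/measurable_fun_pairP; split.
pose Wt (z : Omega * measurableTypeR R) : T * measurableTypeR R := (W z.1, z.2).
have mWt : measurable_fun setT Wt.
  apply/measurable_fun_pairP; split; last exact: measurable_snd.
  exact: (measurableT_comp mW measurable_fst).
pose r (z : Omega * measurableTypeR R) := rho (W z.1) z.2.
have mr : measurable_fun setT r by exact: (measurableT_comp mrho mWt).
have r0 z : (0 <= r z)%R by exact: rho0.
pose m := mdens (P \x mu) mr r0.
have m12 A : measurable A -> mpush P mWZ A = mpush m mWt A.
  apply: measure_unique_box; last first.
    have : P (WZ @^-1` setT) < +oo by rewrite preimage_setT probability_setT ltry.
    exact.
  move=> B B' mB mB'; rewrite -[LHS]/(P (W @^-1` box (enum V) B `&` Z @^-1` B')).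
  rewrite PB// -[RHS]/(\int[_]_(z in Wt @^-1` _) (r z)%:E).
  have mWB : measurable (W @^-1` box (enum V) B).
    by rewrite -[X in measurable X]setTI; apply: mW => //; exact: measurable_box.
  have mWtB : measurable (Wt @^-1` (box (enum V) B `*` B')).
    rewrite -[X in measurable X]setTI; apply: mWt => //.
    by apply: measurableX => //; exact: measurable_box.
  rewrite [RHS]integral_mkcond fubini_tonelli1/=; last 2 first.
  - apply/(measurable_restrictT _ mWtB)/measurable_EFinP.
    exact: measurable_funTS.
  - by move=> z; apply: erestrict_ge0 => z' _; rewrite lee_fin.
  rewrite [LHS]integral_mkcond; apply: eq_integral => w _; rewrite patchE.
  case: ifPn => [wB|wB].
    rewrite /fubini_F [LHS]integral_mkcond; apply: eq_integral => t _.
    rewrite !patchE; congr (if _ then _ else _).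
    apply/idP/idP; rewrite !inE/=; first by split=> //; move: wB; rewrite inE.
    by case.
  rewrite /fubini_F integral0_eq// => t _; rewrite patchE memNset//= => -[wB' _].
  by move: wB; rewrite notin_setE.
transitivity (\int[mpush P mWZ]_z G z); first by rewrite ge0_integral_mpush.
transitivity (\int[mpush m mWt]_z G z).
  by apply: eq_measure_integral => A mA _; exact: m12.
rewrite ge0_integral_mpush// ge0_integral_mdens//; last exact: measurableT_comp.
rewrite fubini_tonelli1//.
- by apply: emeasurable_funM; [exact: measurableT_comp|exact/measurable_EFinP].
- by move=> z; rewrite mule_ge0// lee_fin.
Qed.

End Disintegration.

(** * Chaining conditional densities *)

Lemma integral_probability_cst d (T : measurableType d) (R : realType)
  (P : probability T R) (r : \bar R) : (\int[P]_w r = r)%E.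
Proof.
rewrite -[RHS]mule1 (@integral_cst _ _ _ P _ measurableT); congr (_ * _)%E.
exact: probability_setT.
Qed.

Section Chain.
Context (R : realType) (V : finType) d (Omega : measurableType d)
  (P : probability Omega R).
Local Notation T := (rvec R V).
Local Notation mu := (@lebesgue_measure R).
Local Open Scope ereal_scope.

(** Intermediate state of the chain: the nodes of [p] are random, the others frozen at [x0], waiting
    to be integrated. *)
Definition partvec (Y : V -> Omega -> R) (x0 : T) (p : seq V) (w : Omega) : T :=
  fun v => if v \in p then Y v w else x0 v.

Definition weight (rho : V -> T -> R -> R) (s : seq V) (x : T) : R :=
  (\prod_(v <- s) rho v x (x v))%R.

Variables (Y : V -> Omega -> R) (x0 : T) (rho : V -> T -> R -> R).
Hypothesis mY : forall v, measurable_fun setT (Y v).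
Hypothesis mrho : forall v,
  measurable_fun setT (fun z : T * measurableTypeR R => rho v z.1 z.2).
Hypothesis rho0 : forall v x t, (0 <= rho v x t)%R.

Lemma measurable_diag v : measurable_fun setT (fun x : T => rho v x (x v)).
Proof.
have mg : measurable_fun setT (fun x : T => (x, x v) : T * measurableTypeR R).
  apply/measurable_fun_pairP; split; first exact: measurable_id.
  exact: measurable_coord.
exact: (measurableT_comp (mrho v) mg).
Qed.

Lemma measurable_weight s : measurable_fun setT (weight rho s).
Proof.
by apply: measurable_prod => v _; exact: measurable_diag.
Qed.

Lemma weight_ge0 s x : (0 <= weight rho s x)%R.
Proof. by rewrite /weight prodr_ge0. Qed.

Lemma measurable_partvec p : measurable_fun setT (partvec Y x0 p).
Proof.
apply: measurable_to_rvec => v; rewrite /partvec.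
by case: (v \in p); [exact: mY|exact: measurable_cst].
Qed.

(** The nodes are converted from random to integrated one at a time, from the last to the first.
    Converting v disintegrates [Y v] with respect to the nodes before it. Its density must not read
    v or any later node, so that it moves through the integrals over later nodes that have already
    been created. *)
Lemma chain s (F : T -> \bar R) : uniq s -> measurable_fun setT F ->
  (forall x, 0 <= F x) ->
  (forall p v q, s = p ++ v :: q ->
    (forall x y, (forall u, u \notin v :: q -> x u = y u) -> rho v x = rho v y) /\
    forall B B', (forall i, measurable (B i)) -> measurable B' ->
      P ([set w | forall i, i \in p -> B i (Y i w)] `&` Y v @^-1` B') =
      \int[P]_(w in [set w | forall i, i \in p -> B i (Y i w)])
        \int[mu]_(t in B') (rho v (partvec Y x0 p w) t)%:E) ->
  \int[P]_w F (partvec Y x0 s w) =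
    iterint s (fun x => (weight rho s x)%:E * F x) x0.
Proof.
move=> us mF F0 H.
pose Fw q x := (weight rho q x)%:E * F x.
have mFw q : measurable_fun setT (Fw q).
  by apply: emeasurable_funM => //; apply/measurable_EFinP; exact: measurable_weight.
have Fw0 q x : 0 <= Fw q x by rewrite mule_ge0// lee_fin weight_ge0.
suff IH q p : s = p ++ q ->
    \int[P]_w F (partvec Y x0 s w) = \int[P]_w iterint q (Fw q) (partvec Y x0 p w).
  rewrite (IH s [::])// -[RHS](integral_probability_cst P).
  by apply: eq_integral => w _; congr (iterint s _ _).
elim: q p => [|v q IHq] p spq.
  rewrite {1}spq cats0; apply: eq_integral => w _.
  by rewrite iterint_nil// /Fw /weight big_nil mul1e.
rewrite (IHq (rcons p v)); last by rewrite cat_rcons.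
have [vpq uq] : (v \notin p) && (v \notin q) /\ uniq q.
  move: us; rewrite spq cat_uniq /= negb_or => /and3P[_ /andP[-> _] /andP[-> ->]].
  by [].
have [rho_dep boxE] := H p v q spq.
pose G (z : T * measurableTypeR R) := iterint q (Fw q) (set_coord z.1 v z.2).
have mG : measurable_fun setT G.
  apply: (measurableT_comp (measurable_iterint q (mFw q) (Fw0 q))).
  exact: measurable_set_coord.
have G0 z : 0 <= G z by exact: iterint_ge0.
transitivity (\int[P]_w G (partvec Y x0 p w, Y v w)).
  apply: eq_integral => w _; rewrite /G/=; congr (iterint q _ _).
  apply/funext => i; rewrite /partvec /set_coord mem_rcons inE.
  by case: eqP => [->|].
rewrite (@disintegration _ _ _ _ P _ _ (rho v))//; first last.
- move=> B B' mB mB'.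
  (* Coordinates outside [p] are frozen at [x0]: either they satisfy the box, which then constrains
     only the nodes of [p], or the event is empty. *)
  have [xB|xB] := pselect (forall i, i \notin p -> B i (x0 i)).
    rewrite (_ : partvec Y x0 p @^-1` box (enum V) B =
      [set w | forall i, i \in p -> B i (Y i w)]); first exact: boxE.
    apply/seteqP; split=> w wB i.
      by move=> ip; have := wB i; rewrite mem_enum /partvec ip; exact.
    by move=> _; rewrite /partvec; case: ifPn => ip; [exact: wB|exact: xB].
  rewrite (_ : partvec Y x0 p @^-1` box (enum V) B = set0).
    by rewrite set0I integral_set0 measure0.
  apply/seteqP; split=> // w wB; apply: xB => i ip.
  by have := wB i; rewrite mem_enum /partvec (negbTE ip); exact.
- exact: measurable_partvec.
apply: eq_integral => w _; rewrite iterint_cons//.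
apply: eq_integral => t _; rewrite /G/= muleC.
set x := partvec Y x0 p w.
rewrite (@eq_iterint _ _ _ (Fw (v :: q)) (fun y => (rho v y (y v))%:E * Fw q y)); last first.
  by move=> y; rewrite /Fw /weight big_cons EFinM muleA.
have [vp vq] := andP vpq.
have dep' y z : (forall u, u \notin q -> y u = z u) -> rho v y (y v) = rho v z (z v).
  move=> yz; rewrite yz// (rho_dep y z)// => u.
  by rewrite inE negb_or => /andP[_]; exact: yz.
rewrite iterint_mull//.
- rewrite {3}/set_coord eqxx (rho_dep _ x)// => u; rewrite inE negb_or => /andP[uv _].
  by rewrite /set_coord (negbTE uv).
- exact: measurable_diag.
Qed.

End Chain.

(** * Paths in a tree *)

Section Tree.
Variables (V : finType) (E : {set V * V}).
Hypothesis treeE : undirected_tree E.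
Implicit Types (u v w a : V) (s p q r : seq V).

Let edge : rel V := [rel a b | (a, b) \in E].

Lemma path_edge_sub u s e : path.path edge u s -> e \in zip (u :: s) s -> e \in E.
Proof.
elim: s u => [//|v s IH] u /= /andP[uv vs]; rewrite inE => /orP[/eqP -> //|].
exact: IH.
Qed.

Lemma zip_rcons_path u v s :
  zip (u :: rcons s v) (rcons s v) = rcons (zip (u :: s) s) (last u s, v).
Proof. by elim: s u => [//|w s IH] u /=; rewrite IH. Qed.

Lemma mem_zip_path u s x y : (x, y) \in zip (u :: s) s ->
  (x \in u :: s) && (y \in s).
Proof.
elim: s u => [//|w s IH] u /=; rewrite inE => /orP[/eqP[-> ->]|].
  by rewrite !mem_head.
by move=> /IH /andP[xs ys]; rewrite in_cons xs in_cons ys !orbT.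
Qed.

Lemma node_path_loop u s : node_path E u u s -> s = [::].
Proof.
case: s => [//|v s] /and3P[_ /andP[us _] /eqP l].
by move: us; rewrite -{1}l /= mem_last.
Qed.

(** The definition of a tree speaks of distinct endpoints; a loop with distinct nodes has no edge,
    which settles equal endpoints. *)
Lemma is_path_unique u v (p q : {set V * V}) : is_path E u v p -> is_path E u v q -> p = q.
Proof.
have [<-|uv] := eqVneq u v.
  by move=> [s /node_path_loop -> ->] [r /node_path_loop -> ->].
have [_ _ /(_ _ _ uv)[t [_ tu]]] := treeE.
by move=> /tu <- /tu <-.
Qed.

Lemma tree_path_node_path u v s : node_path E u v s ->
  tree_path E u v = [set:: zip (u :: s) s]%SET.
Proof.
move=> us; have up : is_path E u v [set:: zip (u :: s) s]%SET by exists s.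
apply: (is_path_unique (u := u) (v := v)) => //.
by rewrite /tree_path; apply: xgetPex; exists [set:: zip (u :: s) s]%SET.
Qed.

Lemma tree_path_refl u : tree_path E u u = finset.set0.
Proof.
rewrite (@tree_path_node_path u u [::]) ?/node_path/= ?eqxx//.
Qed.

Lemma tree_path_ex u v : exists s, node_path E u v s.
Proof.
have [<-|uv] := eqVneq u v; first by exists [::]; rewrite /node_path/= eqxx.
by have [_ _ /(_ _ _ uv)[t [[s us _] _]]] := treeE; exists s.
Qed.

Lemma tree_path_sub u v : tree_path E u v \subset E.
Proof.
have [s us] := tree_path_ex u v; rewrite (tree_path_node_path us).
by apply/fintype.subsetP => e; rewrite inE; case/and3P: us => up _ _; exact: path_edge_sub.
Qed.

Lemma path_exit (W : {pred V}) u s : path.path edge u s -> u \in W ->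
  last u s \notin W -> exists a v, [/\ a \in W, v \notin W & (a, v) \in E].
Proof.
elim: s u => [|v s IH] u /=; first by move=> _ ->.
move=> /andP[uv vs] uW lW; have [vW|vW] := boolP (v \in W); first exact: (IH v).
by exists u, v.
Qed.

Definition path_in (W : seq V) u v s := node_path E u v s && all (mem W) s.

Lemma path_in_rcons W u a v s : path_in W u a s -> u \in W -> v \notin W ->
  (a, v) \in E -> node_path E u v (rcons s v).
Proof.
move=> /andP[/and3P[ps us /eqP la] sW] uW vW av; apply/and3P; split.
- by rewrite rcons_path ps/= la.
- rewrite -rcons_cons rcons_uniq us andbT inE negb_or.
  have -> : v != u by apply: contraNneq vW => ->.
  by apply: contra vW => vs; exact: (allP sW).
- by rewrite last_rcons.
Qed.

(** What the rest of the proof asks of a node [v] hung below [a] once [u :: p] is present: the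
    separation that feeds the Markov property, and the recursion for the path from the root that
    makes Theta a product of increments. *)
Definition attached u p v a := [/\ a \in u :: p, (a, v) \in E,
  separates E [set a]%SET ([set x in u :: p] :\ a)%SET [set v]%SET,
  tree_path E u v = ((a, v) |: tree_path E u a)%SET
  & (a, v) \notin tree_path E u a].

(** A path inside [W] to [a], prolonged by the edge (a, v), is a path to v. By uniqueness every path
    from a node of [W] to v has the same edges, hence visits [a]. *)
Lemma attach W u v a : u \in W -> a \in W -> v \notin W -> (a, v) \in E ->
  (forall x y, x \in W -> y \in W -> exists s, path_in W x y s) ->
  [/\ separates E [set a]%SET ([set x in W] :\ a)%SET [set v]%SET,
    tree_path E u v = ((a, v) |: tree_path E u a)%SET
  & (a, v) \notin tree_path E u a].
Proof.
move=> uW aW vW av conn; split.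
- move=> x y r; rewrite !inE => /andP[xa xW] /eqP -> xr; exists a; first by rewrite inE.
  have [s xs] := conn x a xW aW; have xsv := path_in_rcons xs xW vW av.
  have : (a, v) \in [set:: zip (x :: r) r]%SET.
    rewrite -(tree_path_node_path xr) (tree_path_node_path xsv) inE zip_rcons_path.
    by rewrite mem_rcons; case/andP: xs => /and3P[_ _ /eqP ->] _; rewrite mem_head.
  by rewrite inE => /mem_zip_path/andP[].
- have [s us] := conn u a uW aW; have usv := path_in_rcons us uW vW av.
  rewrite (tree_path_node_path usv); case/andP: us => us _.
  rewrite (tree_path_node_path us); apply/setP => e.
  by rewrite !inE zip_rcons_path mem_rcons inE; case/and3P: us => _ _ /eqP ->.
- have [s /andP[us sW]] := conn u a uW aW; rewrite (tree_path_node_path us) inE.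
  by apply: contra vW => /mem_zip_path/andP[_]; move/allP : sW; exact.
Qed.

(** The visited set grows by one edge at a time. The invariant includes that any two visited nodes
    are joined by a path inside the visited set, which is what [attach] consumes; after #|V| - 1
    additions nothing is left. *)
Lemma tree_order u : exists (s : seq V) (parent : V -> V),
  perm_eq (u :: s) (enum V) /\
  forall p v q, s = p ++ v :: q -> attached u p v (parent v).
Proof.
have [noloop symE _] := treeE.
suff H n : (n < #|V|)%N -> exists (s : seq V) (parent : V -> V), [/\ size s = n,
    uniq (u :: s),
    forall p v q, s = p ++ v :: q -> attached u p v (parent v) &
    forall x y, x \in u :: s -> y \in u :: s -> exists r, path_in (u :: s) x y r].
  have V0 : (0 < #|V|)%N by apply/card_gt0P; exists u.
  have [|s [parent [ss us att _]]] := H #|V|.-1; first by rewrite prednK.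
  exists s, parent; split=> //; apply: uniq_perm => //; first exact: enum_uniq.
  have sub : {subset u :: s <= enum V} by move=> x _; rewrite mem_enum.
  by apply: (uniq_min_size us sub _).2; rewrite -cardE /= ss prednK.
elim: n => [_|n IH nV].
  exists [::], id; split=> //.
  - by move=> [].
  - move=> x y; rewrite !inE => /eqP -> /eqP ->; exists [::].
    by rewrite /path_in /node_path/= eqxx.
have [s [parent [ss us att conn]]] := IH (ltnW nV).
have [w wW] : exists w, w \notin u :: s.
  apply/existsP; rewrite -negb_forall; apply/negP => /forallP sV.
  have : (#|V| <= size (u :: s))%N.
    by rewrite cardE; apply: uniq_leq_size => [|x _]; [exact: enum_uniq|exact: sV].
  by rewrite /= ss leqNgt nV.
have [t /and3P[ut _ /eqP lt]] := tree_path_ex u w.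
(* A path from the root to a missing node must leave the visited set; the edge on which it leaves
   supplies the next parent and child. *)
have [a [v [aW vW av]]] : exists a v, [/\ a \in u :: s, v \notin u :: s & (a, v) \in E].
  by apply: (path_exit ut); rewrite ?mem_head// lt.
exists (rcons s v), (fun x => if x == v then a else parent x).
have memW x : x \in u :: s -> x \in u :: rcons s v.
  by rewrite -rcons_cons mem_rcons inE => ->; rewrite orbT.
split.
- by rewrite size_rcons ss.
- by rewrite -rcons_cons rcons_uniq vW.
- move=> p v' q; case/lastP: q => [|q x] /=.
    rewrite cats1 => /rcons_inj[<- <-]; rewrite eqxx.
    by have [? ? ?] := attach (mem_head u s) aW vW av conn; split.
  rewrite -rcons_cons -rcons_cat => /rcons_inj[spq _].
  case: eqP => [v'v|_]; last exact: att spq.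
  by move: vW; rewrite spq v'v !(in_cons, mem_cat) eqxx !orbT.
- have incl x y r : path_in (u :: s) x y r -> path_in (u :: rcons s v) x y r.
    move=> /andP[xy rs]; rewrite /path_in xy; apply/allP => z /(allP rs).
    exact: memW.
  move=> x y; rewrite -!rcons_cons !mem_rcons !(in_cons v).
  have va : (v, a) \in E by exact: symE.
  move=> /orP[/eqP ->|xs] /orP[/eqP ->|ys].
  + by exists [::]; rewrite /path_in /node_path/= eqxx.
  + have [r /andP[/and3P[ar ur lr] rs]] := conn a y aW ys.
    exists (a :: r); apply/andP; split.
      rewrite /node_path /= va ar lr andbT -/(uniq (a :: r)) ur !andbT/=.
      apply: contra vW; rewrite in_cons => /orP[/eqP -> //|vr].
      exact: (allP rs).
    by apply/allP => z; rewrite in_cons => /orP[/eqP ->|/(allP rs)]; exact: memW.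
  + have [r xr] := conn x a xs aW.
    exists (rcons r v); apply/andP; split; first exact: path_in_rcons xr xs vW av.
    rewrite all_rcons /= -rcons_cons mem_rcons mem_head/=.
    by case/andP: xr => _ rs; apply/allP => z /(allP rs); exact: memW.
  + by have [r xr] := conn x y xs ys; exists r; exact: incl.
Qed.

End Tree.

(** * Karamata's theorem *)

Section PowerTail.
Context (R : realType).
Local Notation mu := (@lebesgue_measure R).

Lemma powR_continuous_pos (p x : R) : 0 < x -> {for x, continuous (@powR R ^~ p)}.
Proof.
move=> x0; apply: differentiable_continuous; apply/derivable1_diffP.
by apply: derivable_powR; rewrite in_itv/= x0.
Qed.

Lemma powRN_cvg0_pinfty (p : R) : 0 < p -> t `^ (- p) @[t --> +oo] --> (0 : R).
Proof.
move=> p0; apply/cvgrPdist_lt => e e0; near=> t.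
have t1 : e^-1 `^ p^-1 < t by near: t; apply: nbhs_pinfty_gt; exact: num_real.
have tp0 : 0 < t by rewrite (le_lt_trans _ t1)// powR_ge0.
rewrite sub0r normrN ger0_norm ?powR_ge0// powRN.
rewrite -[ltRHS]invrK ltf_pV2 ?posrE ?powR_gt0 ?invr_gt0//.
rewrite -[ltLHS]powRr1 ?invr_ge0 ?ltW// -(mulVf (lt0r_neq0 p0)) powRrM.
by rewrite gt0_ltr_powR// ?nnegrE ?powR_ge0// ltW.
Unshelve. all: by end_near. Qed.

Lemma integral_power_tail (alpha e : R) : 0 < alpha -> 0 < e ->
  (\int[mu]_(z in `]e, +oo[) (alpha * z `^ (- alpha - 1))%:E = (e `^ (- alpha))%:E)%E.
Proof.
move=> a0 e0.
have mp D : measurable_fun D (fun z : R => alpha * z `^ (- alpha - 1)).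
  apply: measurable_funTS; apply: measurable_funM => //; exact: measurable_powR.
rewrite integral_itv_obnd_cbnd; last exact/measurable_EFinP.
rewrite (@ge0_continuous_FTC2y _ _ (fun z => - z `^ (- alpha)) _ 0).
- by rewrite sub0e EFinN oppeK.
- by move=> x _; rewrite mulr_ge0 ?powR_ge0// ltW.
- apply: continuous_in_subspaceT => x; rewrite inE/= in_itv/= andbT => ex.
  by apply: cvgM; [exact: cvg_cst|apply: powR_continuous_pos; exact: lt_le_trans ex].
- by rewrite -oppr0; apply: cvgN; exact: powRN_cvg0_pinfty.
- move=> x ex; apply: derivableN; apply: derivable_powR.
  by rewrite in_itv/= andbT (lt_trans e0).
- by apply: cvgN; apply: cvg_at_right_filter; exact: powR_continuous_pos.
- move=> x; rewrite in_itv/= andbT => ex; have x0 := lt_trans e0 ex.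
  rewrite derive1E deriveN; last by apply: derivable_powR; rewrite in_itv/= x0.
  by rewrite -derive1E powR_derive1 ?in_itv/= ?x0// mulNr opprK.
Qed.

End PowerTail.

Section Karamata.
Context (R : realType).
Local Notation mu := (@lebesgue_measure R).
Variables (F : R -> R) (alpha : R).
Hypotheses (alpha0 : 0 < alpha) (mF : measurable_fun setT F) (F0 : forall x, 0 <= F x).
Hypothesis iF : (\int[mu]_x (F x)%:E < +oo)%E.
Hypothesis Fgt0 : \forall t \near +oo, 0 < F t.
Hypothesis Frv : forall l, 0 < l -> F (l * t) / F t @[t --> +oo] --> l `^ (- alpha - 1).

Let D : set R := `]1, 2]%classic.
Let p (s : R) := s `^ (- alpha - 1).
Let I := fine (\int[mu]_(s in D) (p s)%:E)%E.
Let u t := fine (\int[mu]_(s in `]t, +oo[) (F s)%:E)%E.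
Let j t := fine (\int[mu]_(s in D) (F (t * s))%:E)%E.

Let mD : measurable D. Proof. exact: measurable_itv. Qed.
Let mEF : measurable_fun setT (EFin \o F). Proof. exact/measurable_EFinP. Qed.

Let mFt t : measurable_fun setT (fun s : R => F (t * s)).
Proof. by apply: (measurableT_comp mF); exact: measurable_funM. Qed.

Let mEFt A t : measurable_fun A (fun s : R => (F (t * s))%:E).
Proof. by apply/measurable_EFinP; apply: measurable_funTS; exact: mFt. Qed.

Let fin_sub A : measurable A -> (\int[mu]_(s in A) (F s)%:E)%E \is a fin_num.
Proof.
move=> mA; rewrite ge0_fin_numE ?integral_ge0// => [|x _]; last by rewrite lee_fin.
apply: le_lt_trans iF; apply: ge0_subset_integral => // x _; by rewrite lee_fin.
Qed.

Let uE t : (u t)%:E = (\int[mu]_(s in `]t, +oo[) (F s)%:E)%E.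
Proof. by rewrite /u fineK// fin_sub. Qed.

Let mp : measurable_fun setT p. Proof. exact: measurable_powR. Qed.
Let p0 s : 0 <= p s. Proof. exact: powR_ge0. Qed.

(** Cut at 2t and substitute s -> ts on (t, 2t]. The statement is for a general [G], because it
    serves both [F] and the limiting power function. *)
Let tail_split (G : R -> R) t : 0 < t -> measurable_fun setT G -> (forall x, 0 <= G x) ->
  (\int[mu]_(s in `]t, +oo[) (G s)%:E = t%:E * \int[mu]_(s in D) (G (t * s))%:E
   + \int[mu]_(s in `](2 * t)%R, +oo[) (G s)%:E)%E.
Proof.
move=> t0 mG G0; have mEG : measurable_fun setT (EFin \o G) by exact/measurable_EFinP.
rewrite (_ : `]t, +oo[%classic = `]t, (2 * t)]%classic `|` `](2 * t), +oo[%classic); last first.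
  apply/seteqP; split=> x /=; rewrite !in_itv/= ?andbT.
    by move=> tx; case: (lerP x (2 * t)) => h; [left; rewrite tx|right].
  by case=> [/andP[]//|]; apply: lt_trans; lra.
rewrite ge0_integral_setU//=; last 3 first.
- exact: measurable_funTS.
- by move=> x _; rewrite lee_fin.
- apply/disj_setPS => x [/=]; rewrite !in_itv/= andbT => /andP[_ h1] h2.
  by move: (le_lt_trans h1 h2); rewrite ltxx.
congr (_ + _)%E; rewrite integral_mkcond (ge0_integral_scale t0); last 2 first.
- by apply/(measurable_restrictT _ (measurable_itv _)); exact: measurable_funTS.
- by move=> x; apply: erestrict_ge0 => y _; rewrite lee_fin.
rewrite [in RHS]integral_mkcond -ge0_integralZl//; last 3 first.
- apply/(measurable_restrictT _ mD); apply/measurable_EFinP; apply: measurable_funTS.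
  by apply: (measurableT_comp mG); exact: measurable_funM.
- by move=> x _; apply: erestrict_ge0 => y _; rewrite lee_fin.
- by rewrite lee_fin ltW.
apply: eq_integral => s _; congr (_ * _)%E; rewrite !patchE.
congr (if _ then _ else _); apply/idP/idP; rewrite !inE/= !in_itv/=.
  by rewrite -[X in X < _]mulr1 ltr_pM2l// (mulrC 2) ler_pM2l.
by rewrite -[X in X < _ * _]mulr1 ltr_pM2l// (mulrC 2) ler_pM2l.
Qed.

Let jE t : 0 < t -> (j t)%:E = (\int[mu]_(s in D) (F (t * s))%:E)%E.
Proof.
move=> t0; rewrite /j fineK// ge0_fin_numE ?integral_ge0// => [|x _]; last by rewrite lee_fin.
have := fin_sub (measurable_itv `]t, +oo[); rewrite (tail_split t0 mF F0) fin_numD.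
case/andP => + _; rewrite ge0_fin_numE; last first.
  apply: mule_ge0; first by rewrite lee_fin ltW.
  by apply: integral_ge0 => x _; rewrite lee_fin.
by move=> h; rewrite ltNge leye_eq; apply/eqP => h'; move: h; rewrite h' gt0_muley ?lte_fin.
Qed.

Let u_split t : 0 < t -> u t = t * j t + u (2 * t).
Proof. by move=> t0; apply: EFin_inj; rewrite EFinD EFinM (uE t) (uE (2 * t)) (jE t0) (tail_split t0 mF F0). Qed.

(** Splitting the tail of alpha s^(-alpha-1) at t = 1 gives 1 = alpha I + 2^(-alpha). *)
Let IE : (\int[mu]_(s in D) (p s)%:E = I%:E)%E /\ alpha * I = 1 - 2 `^ (- alpha).
Proof.
have mq : measurable_fun setT (fun s : R => alpha * p s) by exact: measurable_funM.
have q0 s : 0 <= alpha * p s by rewrite mulr_ge0// ltW.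
have := tail_split ltr01 mq q0; rewrite mul1e !mulr1 !integral_power_tail//.
rewrite powR1; under eq_integral do rewrite mul1r EFinM.
have I0 : (0 <= \int[mu]_(s in D) (p s)%:E)%E by apply: integral_ge0 => x _; rewrite lee_fin.
rewrite ge0_integralZl//; last 3 first.
- by apply/measurable_EFinP; exact: measurable_funTS.
- by move=> x _; rewrite lee_fin.
- by rewrite lee_fin ltW.
rewrite /I; case: (integral _ _ _) I0 => [r| |]//= r0.
  by rewrite -EFinM -EFinD => -[h]; split=> //; apply/eqP; rewrite eq_sym subr_eq -h.
by rewrite gt0_muley ?lte_fin.
Qed.

Let I_gt0 : 0 < I.
Proof.
have [_ aI] := IE; rewrite -(pmulr_rgt0 _ alpha0) aI subr_gt0.
have : (1 : R) `^ alpha < 2 `^ alpha.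
  by apply: gt0_ltr_powR; rewrite ?nnegrE ?ltr1n.
by rewrite powR1 powRN invf_lt1 ?powR_gt0.
Qed.

Let u_ge0 t : 0 <= u t.
Proof. by apply: fine_ge0; apply: integral_ge0 => x _; rewrite lee_fin. Qed.

Let u_mono s t : s <= t -> u t <= u s.
Proof.
move=> st; rewrite -lee_fin !uE; apply: ge0_subset_integral => //.
- exact: measurable_funTS.
- by move=> x _; rewrite lee_fin.
- by move=> x /=; rewrite !in_itv/= !andbT; exact: le_lt_trans.
Qed.

(** The minimum of F(st)/F(t) and s^(-alpha-1) is dominated by the latter, so its integral over (1,
    2] tends to I and eventually exceeds I / 2. Truncating by the limit replaces any a priori bound
    on F(st)/F(t). *)
Let u_lower : \forall t \near +oo, I / 2 * (t * F t) <= u t.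
Proof.
have mcvg : (\int[mu]_(s in D) (Num.min (F (s * t) / F t) (p s))%:E)%E
    @[t --> +oo] --> (\int[mu]_(s in D) (p s)%:E)%E.
  apply: (@dominated_convergence_pinfty _ _ _ mu D mD
    (fun t s => (Num.min (F (s * t) / F t) (p s))%:E) _ (EFin \o p)).
  - move=> t; apply/measurable_EFinP; apply: measurable_funTS.
    apply: measurable_minr => //; apply: measurable_funM => //.
    by apply: (measurableT_comp mF); exact: measurable_funM.
  - by apply/measurable_EFinP; exact: measurable_funTS.
  - move=> s; rewrite /D/= in_itv/= => /andP[s1 _].
    apply: cvg_EFin; first exact: nearW.
    apply/cvgrPdist_lt => e e0; near=> t.
    have : `|p s - F (s * t) / F t| < e.
      by near: t; have /cvgrPdist_lt := Frv (lt_trans ltr01 s1); exact.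
    apply: le_lt_trans => /=; case: (leP (F (s * t) / F t) (p s)) => // _.
    by rewrite subrr normr0.
  - apply/integrableP; split; first by apply/measurable_EFinP; exact: measurable_funTS.
    under eq_integral do rewrite /= ger0_norm//.
    by rewrite (proj1 IE) ltry.
  - near=> t => s _; rewrite /= lee_fin ger0_norm ?ge_min ?lexx ?orbT//.
    have Ft : 0 < F t by near: t.
    by rewrite le_min p0 andbT divr_ge0// ltW.
have I2 : \forall t \near +oo,
    ((I / 2)%:E <= \int[mu]_(s in D) (Num.min (F (s * t) / F t) (p s))%:E)%E.
  have [IEq _] := IE; rewrite IEq in mcvg.
  have [mfin /cvgrPdist_lt mc] := (fine_cvgP _ _).1 mcvg.
  near=> t; rewrite -[leRHS]fineK; last by near: t.
  have h : `|I - fine (\int[mu]_(s in D) (Num.min (F (s * t) / F t) (p s))%:E)%E| < I / 2.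
    by near: t; apply: mc; rewrite divr_gt0.
  by rewrite lee_fin; move: h; rewrite ltr_norml => /andP[_]; lra.
near=> t.
have Ft : 0 < F t by near: t.
have t0 : 0 < t by near: t; apply: nbhs_pinfty_gt; exact: num_real.
have h : ((I / 2)%:E <= \int[mu]_(s in D) (Num.min (F (s * t) / F t) (p s))%:E)%E.
  by near: t.
have {}h : I / 2 <= j t / F t.
  rewrite -lee_fin; apply: (le_trans h).
  rewrite mulrC EFinM jE// -ge0_integralZl//; last 3 first.
  - exact: mEFt.
  - by move=> s _; rewrite lee_fin.
  - by rewrite lee_fin invr_ge0 ltW.
  apply: ge0_le_integral => //.
  - by move=> s _; rewrite lee_fin le_min p0 andbT divr_ge0// ltW.
  - apply/measurable_EFinP; apply: measurable_funTS.
    apply: measurable_minr => //; apply: measurable_funM => //.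
    by apply: (measurableT_comp mF); exact: measurable_funM.
  - by apply: measurable_funeM; exact: mEFt.
  - by move=> s _; rewrite -EFinM lee_fin ge_min mulrC (mulrC t) lexx.
rewrite u_split// mulrCA; apply: (@le_trans _ _ (t * j t)); last by rewrite lerDl.
by rewrite ler_pM2l// -ler_pdivlMr.
Unshelve. all: by end_near. Qed.

Let u_gt0 : \forall t \near +oo, 0 < u t.
Proof.
near=> t; apply: (@lt_le_trans _ _ (I / 2 * (t * F t))); last by near: t.
have Ft : 0 < F t by near: t.
have t0 : 0 < t by near: t; apply: nbhs_pinfty_gt; exact: num_real.
by rewrite !mulr_gt0// divr_gt0.
Unshelve. all: by end_near. Qed.

Let u2E t : (u (2 * t))%:E = (2%:E * \int[mu]_(s in `]t, +oo[) (F (2 * s))%:E)%E.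
Proof.
rewrite uE integral_mkcond (@ge0_integral_scale _ 2)//; last 2 first.
- by apply/(measurable_restrictT _ (measurable_itv _)); exact: measurable_funTS.
- by move=> x; apply: erestrict_ge0 => y _; rewrite lee_fin.
rewrite [in RHS]integral_mkcond -ge0_integralZl//; last 2 first.
- apply/(measurable_restrictT _ (measurable_itv _)); apply/measurable_EFinP.
  exact: measurable_funTS.
- by move=> x _; apply: erestrict_ge0 => y _; rewrite lee_fin.
apply: eq_integral => s _; congr (_ * _)%E; rewrite !patchE.
congr (if _ then _ else _); apply/idP/idP; rewrite !inE/= !in_itv/= !andbT.
  by rewrite ltr_pM2l.
by rewrite ltr_pM2l.
Qed.

(** F(2s)/F(s) is close to 2^(-alpha-1) for all s beyond a threshold at once; integrating over s > t
    compares u(2t) / 2 with u(t). *)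
Let u_ratio : u (2 * t) / u t @[t --> +oo] --> 2 `^ (- alpha).
Proof.
apply/cvgrPdist_le => e e0.
(* The tolerance is e / 2 because u(2t) is twice the integral of F(2s) over s > t, which doubles the
   error. *)
have [T [_ HT]] : \forall s \near +oo,
    0 < F s /\ `|2 `^ (- alpha - 1) - F (2 * s) / F s| <= e / 2.
  near=> s; split; near: s => //.
  have /cvgrPdist_le h := Frv (ltr0n R 2); apply: h.
  by rewrite divr_gt0.
near=> t; have ut : 0 < u t by near: t.
have tT : T < t by near: t; apply: nbhs_pinfty_gt; exact: num_real.
set k := 2 `^ (- alpha - 1) in HT.
have kE : 2 `^ (- alpha) = 2 * k.
  have -> : - alpha = 1 + (- alpha - 1) by lra.
  by rewrite powRD ?pnatr_eq0 ?implybT// powRr1.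
have HF s : t < s -> k * F s <= F (2 * s) + e / 2 * F s /\
    F (2 * s) <= (k + e / 2) * F s.
  move=> ts; have [Fs] := HT s (lt_trans tT ts).
  rewrite ler_norml => /andP[h1 h2]; split.
    have : k - e / 2 <= F (2 * s) / F s by lra.
    by rewrite ler_pdivlMr// mulrBl; lra.
  have : F (2 * s) / F s <= k + e / 2 by lra.
  by rewrite ler_pdivrMr.
have mI := measurable_itv `]t, +oo[.
have mF2 A : measurable_fun A (fun s : R => (F (2 * s))%:E).
  by apply/measurable_EFinP; exact: measurable_funTS.
have mF1 A : measurable_fun A (fun s : R => (F s)%:E).
  by apply/measurable_EFinP; exact: measurable_funTS.
have k0 : 0 <= k by exact: powR_ge0.
have aE : (u (2 * t) / 2)%:E = (\int[mu]_(s in `]t, +oo[) (F (2 * s))%:E)%E.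
  by rewrite mulrC EFinM u2E muleA -EFinM mulVf ?mul1e.
have e20 : 0 <= e / 2 by rewrite divr_ge0// ltW.
have H1 : k * u t <= u (2 * t) / 2 + e / 2 * u t.
  rewrite -lee_fin [leLHS]EFinM [leRHS]EFinD aE [(e / 2 * u t)%:E]EFinM uE.
  rewrite -!ge0_integralZl ?lee_fin//; try (by move=> s _; rewrite lee_fin); try exact: mF1.
  rewrite -ge0_integralD//; last 4 first.
  - by move=> s _; rewrite lee_fin.
  - exact: mF2.
  - by move=> s _; rewrite mule_ge0 ?lee_fin.
  - apply: measurable_funeM; exact: mF1.
  apply: ge0_le_integral => //.
  - by move=> s _; rewrite mule_ge0 ?lee_fin.
  - apply: measurable_funeM; exact: mF1.
  - by apply: emeasurable_funD; [exact: mF2|apply: measurable_funeM; exact: mF1].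
  - move=> s /=; rewrite in_itv/= andbT => /HF[h _].
    by rewrite -!EFinM -EFinD lee_fin.
have H2 : u (2 * t) / 2 <= (k + e / 2) * u t.
  have ke0 : 0 <= k + e / 2 by rewrite addr_ge0// ltW.
  rewrite -lee_fin [leRHS]EFinM aE uE.
  rewrite -!ge0_integralZl ?lee_fin//; try (by move=> s _; rewrite lee_fin); try exact: mF1.
  apply: ge0_le_integral => //.
  - by move=> s _; rewrite lee_fin.
  - exact: mF2.
  - apply: measurable_funeM; exact: mF1.
  - move=> s /=; rewrite in_itv/= andbT => /HF[_ h].
    by rewrite -!EFinM lee_fin.
have [h1 h2] : (2 * k - e) * u t <= u (2 * t) /\ u (2 * t) <= (2 * k + e) * u t.
  by split; lra.
rewrite -ler_pdivlMr// in h1; rewrite -ler_pdivrMr// in h2.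
by rewrite kE ler_norml; apply/andP; split; lra.
Unshelve. all: by end_near. Qed.

(* Since [u t = t * j t + u (2 t)] and [r t = t * F t / u t] is bounded by
   [u_lower], dominated convergence of [t * F (t s) / u t - r t * s^(-alpha-1)]
   for [1 < s <= 2] determines the limit of [r], without the uniform convergence
   theorem for regularly varying functions. *)
Lemma karamata : t * F t / u t @[t --> +oo] --> alpha.
Proof.
pose r t := t * F t / u t; pose K := (I / 2)^-1.
have K0 : 0 < K by rewrite invr_gt0 divr_gt0.
have [T [_ HT]] : \forall t \near +oo, [/\ 0 < t, 0 < u t & I / 2 * (t * F t) <= u t].
  near=> t; split; near: t => //; apply: nbhs_pinfty_gt; exact: num_real.
have rK t : T < t -> 0 <= r t <= K.
  move=> /HT[t0 ut h]; apply/andP; split; first by rewrite /r divr_ge0 ?mulr_ge0 ?F0 ?(ltW t0) ?(ltW ut).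
  rewrite /r ler_pdivrMr//.
  by rewrite /K ler_pdivlMl ?divr_gt0.
pose phi t s := t * F (t * s) / u t - r t * p s.
(* The factorisation divides by F t; the degenerate alternative is discarded later, F being
   eventually positive. *)
have phiE t s : T < t -> phi t s = r t * (F (s * t) / F t - p s) \/ F t = 0.
  move=> /HT[t0 ut _]; have [Ft|Ft] := eqVneq (F t) 0; [by right|left].
  by rewrite /phi /r (mulrC s); field; rewrite Ft gt_eqF.
have phiK t s : T < t -> D s -> `|phi t s| <= K.
  move=> Tt; have [t0 ut _] := HT t Tt.
  rewrite /D/= in_itv/= => /andP[s1 _]; have s0 := lt_trans ltr01 s1.
  have p1 : p s <= 1.
    have : p s <= s `^ 0 by apply: ler_powR; rewrite ?(ltW s1)// -opprD oppr_le0 addr_ge0// ltW.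
    by rewrite powRr0.
  have /andP[r0 rK1] := rK t Tt.
  have tts : t < t * s by rewrite -[ltLHS]mulr1 ltr_pM2l.
  have /andP[rs0 rsK] := rK _ (lt_trans Tt tts).
  have [ts0 uts _] := HT _ (lt_trans Tt tts).
  have a0 : 0 <= t * F (t * s) / u t by rewrite divr_ge0 ?mulr_ge0 ?F0 ?(ltW t0) ?(ltW ut).
  (* Here t < ts and u(ts) <= u(t), so the quotient is at most r(ts), which has the same bound K as
     r(t). *)
  have aK : t * F (t * s) / u t <= K.
    apply: le_trans rsK; rewrite /r ler_pdivrMr// mulrAC ler_pdivlMr//.
    apply: ler_pM; rewrite ?mulr_ge0 ?F0 ?(ltW t0) ?(ltW ts0) ?u_ge0//; last exact/u_mono/ltW.
    by rewrite ler_wpM2r// ltW.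
  have b0 : 0 <= r t * p s by rewrite mulr_ge0.
  have bK : r t * p s <= K by rewrite -[leRHS]mulr1 ler_pM.
  by rewrite ler_norml /phi; apply/andP; split; lra.
have mphi t : measurable_fun setT (phi t).
  apply: measurable_funB; apply: measurable_funM => //.
  by apply: measurable_funM => //; exact: mFt.
have phicvg : (\int[mu]_(s in D) (phi t s)%:E)%E @[t --> +oo] --> 0%E.
  rewrite -[X in _ --> X](@integral0 _ _ _ mu D).
  apply: (@dominated_convergence_pinfty _ _ _ mu D mD
    (fun t s => (phi t s)%:E) _ (cst K%:E)) => //.
  - by move=> t; apply/measurable_EFinP; apply: measurable_funTS; exact: mphi.
  - move=> s Ds; apply: cvg_EFin; first exact: nearW.
    have s0 : 0 < s by by move: Ds; rewrite /D/= in_itv/= => /andP[+ _]; exact: lt_trans.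
    apply/cvgrPdist_lt => e e0; near=> t; rewrite sub0r normrN/=.
    have Tt : T < t by near: t; apply: nbhs_pinfty_gt; exact: num_real.
    have Ft : 0 < F t by near: t.
    have [->|Ft0] := phiE t s Tt; last by rewrite Ft0 ltxx in Ft.
    have /andP[r0 rK1] := rK t Tt.
    rewrite normrM ger0_norm//.
    have h : `|p s - F (s * t) / F t| < e / K.
      by near: t; have /cvgrPdist_lt := Frv s0; apply; rewrite divr_gt0.
    rewrite distrC; apply: (@le_lt_trans _ _ (K * `|p s - F (s * t) / F t|)).
      by rewrite ler_wpM2r.
    by rewrite mulrC -ltr_pdivlMr.
  - apply/integrableP; split; first exact: measurable_cst.
    rewrite (eq_integral (cst K%:E)) => [|s _]; last by rewrite /= ger0_norm// ltW.
    apply: (@le_lt_trans _ _ (K%:E * mu D)%E); first by rewrite integral_cst.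
    rewrite /D lebesgue_measure_itv/= lte_fin ltr1n.
    by rewrite -EFinD -EFinM ltry.
  - by near=> t => s Ds; rewrite /= lee_fin; apply: phiK => //; near: t;
      apply: nbhs_pinfty_gt; exact: num_real.
(* By [u_split] this integral is 1 - u(2t)/u(t) - r(t) I. It tends to 0 and the ratio has a limit,
   so r(t) I tends to 1 - 2^(-alpha) = alpha I. *)
have int_phi : \forall t \near +oo, (\int[mu]_(s in D) (phi t s)%:E)%E =
    (1 - u (2 * t) / u t - r t * I)%:E.
  near=> t; have Tt : T < t by near: t; apply: nbhs_pinfty_gt; exact: num_real.
  have [t0 ut _] := HT t Tt; have /andP[r0 _] := rK t Tt.
  under eq_integral do rewrite EFinB.
  have E1 : (\int[mu]_(s in D) (t * F (t * s) / u t)%:E)%E = (t * j t / u t)%:E.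
    under eq_integral do rewrite mulrAC EFinM.
    rewrite ge0_integralZl//; last 3 first.
    - exact: mEFt.
    - by move=> s _; rewrite lee_fin.
    - by rewrite lee_fin divr_ge0 ?(ltW t0) ?(ltW ut).
    by rewrite -jE// -EFinM mulrAC.
  have E2 : (\int[mu]_(s in D) (r t * p s)%:E)%E = (r t * I)%:E.
    under eq_integral do rewrite EFinM.
    rewrite ge0_integralZl//; last 2 first.
    - by apply/measurable_EFinP; exact: measurable_funTS.
    - by move=> s _; rewrite lee_fin.
    by rewrite (proj1 IE).
  transitivity (\int[mu]_(s in D) (t * F (t * s) / u t)%:E - \int[mu]_(s in D) (r t * p s)%:E)%E.
  apply: integralB_EFin => //.
  - apply/integrableP; split.
      apply/measurable_EFinP; apply: measurable_funTS; apply: measurable_funM => //.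
      by apply: measurable_funM => //; exact: mFt.
    under eq_integral do rewrite /= ger0_norm ?divr_ge0 ?mulr_ge0 ?F0 ?(ltW t0) ?(ltW ut)//.
    by rewrite E1 ltry.
  - apply/integrableP; split.
      by apply/measurable_EFinP; apply: measurable_funTS; exact: measurable_funM.
    rewrite (eq_integral (fun s : measurableTypeR R => (r t * p s)%:E)) => [|s _]; first by rewrite E2 ltry.
    have rp0 : 0 <= r t * p s by exact: mulr_ge0.
    by rewrite /= ger0_norm.
  rewrite E1 E2 -EFinB; congr EFin; congr (_ - _).
  have -> : t * j t = u t - u (2 * t) by rewrite (u_split t0) addrK.
  by rewrite mulrBl divff// gt_eqF.
have rI : r t * I @[t --> +oo] --> alpha * I.
  rewrite (proj2 IE) -[X in _ --> X]subr0.
  have /fine_cvgP[_ c0] : (fun t => (1 - u (2 * t) / u t - r t * I)%:E) @ +oo --> 0%E.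
    by apply: cvg_trans phicvg; apply: near_eq_cvg; exact: int_phi.
  have c1 : 1 - u (2 * t) / u t @[t --> +oo] --> 1 - 2 `^ (- alpha).
    by apply: cvgB; [exact: cvg_cst|exact: u_ratio].
  rewrite (_ : (fun t => r t * I) = (fun t => 1 - u (2 * t) / u t) \-
    (fine \o (fun t => (1 - u (2 * t) / u t - r t * I)%:E))); first exact: cvgB.
  by apply/funext => t /=; rewrite opprB addrC subrK.
have I0 : I != 0 by rewrite gt_eqF.
rewrite -(mulfK I0 alpha) -/(r _).
have -> : (fun t => t * F t / u t) = (fun t => r t * I / I).
  by apply/funext => t; rewrite mulfK.
exact: cvgMr_tmp.
Unshelve. all: by end_near. Qed.

End Karamata.

(** * Marginal densities *)

Section LebesgueVector.
Context (R : realType) (V : finType).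
Local Notation T := (rvec R V).
Local Open Scope ereal_scope.

Definition lebvec : {measure set T -> \bar R} := iterk R (enum V) (cst 0%R).

Lemma integral_lebvec s (F : T -> \bar R) x : perm_eq s (enum V) ->
  measurable_fun setT F -> (forall y, 0 <= F y) ->
  \int[lebvec]_y F y = iterint s F x.
Proof.
move=> sV mF F0; rewrite -[LHS]/(\int[iterk R (enum V) (cst 0%R)]_y F y).
transitivity (iterint (enum V) F (cst 0%R)); first by rewrite iterint.unlock.
rewrite -(iterint_perm _ mF F0 sV); apply: iterint_agree => // v.
by rewrite (perm_mem sV) mem_enum.
Qed.

End LebesgueVector.

Section Density.
Context (R : realType) (V : finType) d (Omega : measurableType d)
  (P : probability Omega R) (X : V -> {RV P >-> R}) (f : rvec R V -> R).
Hypothesis densf : joint_density X f.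
Local Notation T := (rvec R V).
Local Notation mu := (@lebesgue_measure R).
Local Open Scope ereal_scope.

Let mX v : measurable_fun setT (X v). Proof. exact: measurable_funPT. Qed.

(** [f] is constrained on the orthant only; extending it by zero allows integration over the whole
    space. *)
Definition dens0 (x : T) : R := if x \in @orthant R V then f x else 0%R.

Lemma measurable_dens0 : measurable_fun setT dens0.
Proof.
have [mf _ _] := densf.
have -> : dens0 = f \_ (@orthant R V).
  by apply/funext => x; rewrite /dens0 patchE.
exact: (measurable_restrictT f (@measurable_orthant R V)).1.
Qed.

Lemma dens0_ge0 x : (0 <= dens0 x)%R.
Proof.
have [_ f0 _] := densf; rewrite /dens0; case: ifPn => //; rewrite inE; exact: f0.
Qed.

Let mEd : measurable_fun setT (EFin \o dens0).
Proof. by apply/measurable_EFinP; exact: measurable_dens0. Qed.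
Let Ed0 x : 0 <= (dens0 x)%:E. Proof. by rewrite lee_fin dens0_ge0. Qed.

Lemma restrict_density (c : T -> R) :
  ((fun x => (c x * f x)%:E) \_ (@orthant R V)) = (fun x => (c x)%:E * (dens0 x)%:E).
Proof.
by apply/funext => x; rewrite patchE /dens0; case: ifP; rewrite ?mule0// EFinM.
Qed.

Lemma density_lebvec (F : T -> \bar R) : measurable_fun setT F ->
  (forall x, 0 <= F x) ->
  \int[P]_w F (fun v => X v w) = \int[lebvec R V]_x (F x * (dens0 x)%:E).
Proof.
move=> mF F0; have [mf f0 PE] := densf.
have mXv : measurable_fun setT (fun w => (fun v => X v w) : T).
  by apply: measurable_to_rvec => v; exact: mX.
rewrite -(ge0_integral_mpush P mXv)//.
apply: (ge0_integral_density measurable_dens0 dens0_ge0) => //.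
move=> A mA; rewrite -[LHS]/(P [set w | A (fun v => X v w)]) PE//.
have m1f : measurable_fun (@orthant R V) (fun x => (\1_A x * f x)%:E).
  apply/measurable_EFinP; apply: measurable_funM; last exact: mf.
  exact: measurable_indic.
rewrite iter_integralE ?enum_uniq//; last first.
  by move=> x xo; rewrite lee_fin mulr_ge0 ?f0.
rewrite restrict_density -[A in RHS]setTI integral_setI_indic.
rewrite (@integral_lebvec _ _ (enum V) _ (fun=> 0%R))//.
- apply: emeasurable_funM => //; apply/measurable_EFinP; exact: measurable_indic.
- by move=> x; rewrite mule_ge0// lee_fin.
Qed.

Definition others (W : seq V) : seq V := [seq v <- enum V | v \notin W].

Lemma others_uniq W : uniq (others W).
Proof. exact/filter_uniq/enum_uniq. Qed.

Lemma perm_others W : uniq W -> perm_eq (W ++ others W) (enum V).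
Proof.
move=> uW; apply: uniq_perm; rewrite ?enum_uniq//.
  rewrite cat_uniq uW others_uniq andbT.
  by apply/hasPn => x; rewrite mem_filter => /andP[].
by move=> x; rewrite mem_cat mem_filter mem_enum andbT orbN.
Qed.

Definition marg W (x : T) : \bar R := iterint (others W) (EFin \o dens0) x.

Lemma marg_ge0 W x : 0 <= marg W x.
Proof. exact: iterint_ge0. Qed.

Lemma measurable_marg W : measurable_fun setT (marg W).
Proof. exact: measurable_iterint. Qed.

Lemma marginalE W x : orthant x -> marginal f W x = marg W x.
Proof.
move=> xo; have [mf f0 _] := densf.
rewrite /marginal (iter_integralE (others_uniq W))//.
- apply: eq_iterint => y; rewrite patchE /= /dens0.
  by case: ifP.
- exact/measurable_EFinP.
Qed.

Lemma marg_agree W x y : (forall v, v \in W -> x v = y v) -> marg W x = marg W y.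
Proof.
move=> xy; apply: iterint_agree => // v.
by rewrite mem_filter mem_enum andbT negbK; exact: xy.
Qed.

Lemma integral_marg W (c : T -> R) x : uniq W ->
  measurable_fun setT c -> (forall y, (0 <= c y)%R) ->
  (forall y z, (forall v, v \in W -> y v = z v) -> c y = c z) ->
  \int[P]_w (c (fun v => X v w))%:E = iterint W (fun y => (c y)%:E * marg W y) x.
Proof.
move=> uW mc c0 cW.
have mEc : measurable_fun setT (EFin \o c) by exact/measurable_EFinP.
have mcd : measurable_fun setT (fun y => (c y)%:E * (dens0 y)%:E).
  exact: emeasurable_funM.
have cd0 y : 0 <= (c y)%:E * (dens0 y)%:E by rewrite mule_ge0// lee_fin.
rewrite (@density_lebvec (EFin \o c))//.
rewrite (integral_lebvec x (perm_others uW))// iterint_cat//.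
apply: eq_iterint => y; rewrite iterint_mull// => y' z yz.
apply: cW => v vW; apply: yz.
by rewrite mem_filter vW.
Qed.

Definition marg1 v t : \bar R := marg [:: v] (fun=> t).
Definition marg2 a b s t : \bar R := marg [:: a; b] (fun v => if v == a then s else t).

Lemma measurable_marg1 v : measurable_fun setT (marg1 v : measurableTypeR R -> \bar R).
Proof.
apply: (measurableT_comp (measurable_marg [:: v])).
by apply: measurable_to_rvec => i; exact: measurable_id.
Qed.

Lemma measurable_marg2 a b : measurable_fun setT
  (fun z : measurableTypeR R * measurableTypeR R => marg2 a b z.1 z.2).
Proof.
apply: (measurableT_comp (measurable_marg [:: a; b])).
by apply: measurable_to_rvec => i; case: (i == a); [exact: measurable_fst|exact: measurable_snd].
Qed.

Lemma marg2C a b s t : a != b -> marg2 a b s t = marg2 b a t s.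
Proof.
move=> ab; rewrite /marg2 /marg /others.
rewrite (_ : [seq v <- enum V | v \notin [:: b; a]] = [seq v <- enum V | v \notin [:: a; b]]).
  apply: marg_agree => v; rewrite !inE => /orP[]/eqP ->; rewrite eqxx.
    by rewrite (negbTE ab).
  by rewrite eq_sym (negbTE ab).
by apply: eq_filter => v; rewrite !inE orbC.
Qed.

Lemma marg1_law v (c : R -> R) : measurable_fun setT c -> (forall t, (0 <= c t)%R) ->
  \int[P]_w (c (X v w))%:E = \int[mu]_t ((c t)%:E * marg1 v t).
Proof.
move=> mc c0; have mcv : measurable_fun setT (fun x : T => c (x v)).
  exact: (measurableT_comp mc (measurable_coord v)).
rewrite (@integral_marg [:: v] (fun x => c (x v)) (fun=> 0%R))//; last first.
  by move=> y z yz; rewrite yz ?mem_head.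
have mm : measurable_fun setT (fun y : T => (c (y v))%:E * marg [:: v] y).
  by apply: emeasurable_funM; [exact/measurable_EFinP|exact: measurable_marg].
have m0 (y : T) : 0 <= (c (y v))%:E * marg [:: v] y.
  by rewrite mule_ge0 ?lee_fin ?marg_ge0.
rewrite iterint_cons//; apply: eq_integral => t _; rewrite iterint_nil//.
rewrite /set_coord eqxx; congr (_ * _); apply: marg_agree => i.
by rewrite inE => /eqP ->; rewrite eqxx.
Qed.

Lemma marg2_law a b (c : R -> R -> R) : a != b ->
  measurable_fun setT (fun z : measurableTypeR R * measurableTypeR R => c z.1 z.2) ->
  (forall s t, (0 <= c s t)%R) ->
  \int[P]_w (c (X a w) (X b w))%:E =
    \int[mu]_s \int[mu]_t ((c s t)%:E * marg2 a b s t).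
Proof.
move=> ab mc c0; have mcv : measurable_fun setT (fun x : T => c (x a) (x b)).
  apply: (measurableT_comp mc (g := fun x : T => (x a, x b))).
  by apply/measurable_fun_pairP; split; exact: measurable_coord.
rewrite (@integral_marg [:: a; b] (fun x => c (x a) (x b)) (fun=> 0%R))//=; first last.
- by move=> y z yz; rewrite !yz ?inE ?eqxx ?orbT.
- by rewrite inE ab.
have mm : measurable_fun setT (fun y : T => (c (y a) (y b))%:E * marg [:: a; b] y).
  by apply: emeasurable_funM; [exact/measurable_EFinP|exact: measurable_marg].
have m0 (y : T) : 0 <= (c (y a) (y b))%:E * marg [:: a; b] y.
  by rewrite mule_ge0 ?lee_fin ?marg_ge0.
rewrite iterint_cons//; apply: eq_integral => s _.
rewrite iterint_cons//; apply: eq_integral => t _; rewrite iterint_nil//.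
rewrite /set_coord !eqxx (negbTE ab); congr (_ * _); apply: marg_agree => i.
by rewrite !inE => /orP[]/eqP ->; rewrite ?eqxx ?(negbTE ab)// eq_sym (negbTE ab).
Qed.

(** Both sides are iterated integrals of the same version of the density, up to the order of the
    variables; hence the identity holds for every s and not merely almost everywhere. *)
Lemma marg1_marg2 a b s : a != b -> marg1 a s = \int[mu]_t marg2 a b s t.
Proof.
move=> ab; rewrite /marg1 /marg.
rewrite (@iterint_perm _ _ _ (b :: others [:: a; b]))//; last first.
  rewrite -(perm_cons a); apply: (@perm_trans _ (enum V)).
    by rewrite (@perm_others [:: a]).
  by rewrite perm_sym (@perm_others [:: a; b])//= inE ab.
rewrite iterint_cons//; apply: eq_integral => t _; apply: marg_agree => v.
rewrite /set_coord !inE => /orP[]/eqP ->; rewrite eqxx ?(negbTE ab)//.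
by rewrite eq_sym (negbTE ab).
Qed.

Lemma integral_marg1 v : \int[mu]_t marg1 v t = 1.
Proof.
have := @marg1_law v (fun=> 1%R) (measurable_cst _) (fun=> ler01).
rewrite integral_probability_cst => ->.
by apply: eq_integral => t _; rewrite mul1e.
Qed.

Lemma marg_neg W v x : v \in W -> (x v < 0)%R -> marg W x = 0.
Proof.
move=> vW xv; pose c (y : T) : R := \1_[set y : T | (0 <= y v)%R] y.
have cE y : c y = (if 0 <= y v then 1 else 0)%R.
  rewrite /c indicE; case: ifPn => h; first by rewrite mem_set.
  by rewrite memNset//; exact/negP.
rewrite /marg (@eq_iterint _ _ _ _ (fun y => (c y)%:E * (dens0 y)%:E)); last first.
  move=> y; rewrite cE; case: ifPn => yv; rewrite ?mul1e// mul0e /= /dens0.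
  by rewrite ifF//; apply/negbTE; rewrite notin_setE => /(_ v); exact/negP.
rewrite iterint_mull//.
- by rewrite cE leNgt xv mul0e.
- apply: measurable_indic; rewrite -[X in measurable X]setTI.
  rewrite (_ : mkset _ = (fun x : T => x v) @^-1` `[0%R, +oo[); first exact: measurable_coord.
  by apply/seteqP; split=> y /=; rewrite in_itv/= andbT.
- by move=> y z yz; rewrite !cE yz// mem_filter negb_and vW.
Qed.

End Density.

(** * Transition densities *)

Section Transition.
Context (R : realType) (V : finType) d (Omega : measurableType d)
  (P : probability Omega R) (X : V -> {RV P >-> R}) (f : rvec R V -> R).
Hypothesis densf : joint_density X f.
Local Notation T := (rvec R V).
Local Notation mu := (@lebesgue_measure R).
Local Open Scope ereal_scope.

Let mX v : measurable_fun setT (X v). Proof. exact: measurable_funPT. Qed.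

(** Real-valued version of the marginal density: [fine] turns an infinite value into 0, and the
    nonpositive half-line is cut off. *)
Definition mdens1 v (t : R) : R := if (0 < t)%R then fine (marg1 f v t) else 0%R.

Definition quot a b (s t : R) : R :=
  if (0 < s)%R && (0 < t)%R then (fine (marg2 f a b s t) / mdens1 a s)%R else 0%R.

Definition regular a b : set R := [set s | \int[mu]_t (quot a b s t)%:E = 1].

(* The default density makes [transition a b s] a probability density also at
   the exceptional points [s], and keeps it supported by (0, +oo). *)
Definition transition a b (s t : R) : R :=
  if s \in regular a b then quot a b s t else \1_(`]0%R, 1%R]%classic : set R) t.

Let mpos : measurable [set t : R | (0 < t)%R].
Proof.
rewrite (_ : [set t : R | (0 < t)%R] = `]0%R, +oo[%classic)//.
by apply/seteqP; split=> t /=; rewrite in_itv/= andbT.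
Qed.

Let mgt0 d' (S : measurableType d') (h : S -> R) : measurable_fun setT h ->
  measurable_fun setT (fun x => (0 < h x)%R).
Proof. by move=> mh; apply: measurable_fun_ltr => //; exact: measurable_cst. Qed.

Let mind d' (S : measurableType d') (h : S -> measurableTypeR R)
    (B : set (measurableTypeR R)) : measurable B -> measurable_fun setT h ->
  measurable_fun setT (fun x => \1_B (h x) : R).
Proof.
move=> mB mh; have m1 : measurable_fun setT (\1_B : measurableTypeR R -> R).
  exact: measurable_indic.
exact: (measurableT_comp m1 mh).
Qed.

Lemma mdens1_ge0 v t : (0 <= mdens1 v t)%R.
Proof. by rewrite /mdens1; case: ifP => // _; apply: fine_ge0; exact: (marg_ge0 densf). Qed.

Lemma measurable_mdens1 v : measurable_fun setT (mdens1 v : measurableTypeR R -> R).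
Proof.
apply: measurable_fun_ifT => //; first by apply: mgt0; exact: measurable_id.
by apply: measurableT_comp => //; exact: (measurable_marg1 densf).
Qed.

Lemma quot_ge0 a b s t : (0 <= quot a b s t)%R.
Proof.
rewrite /quot; case: ifP => // _; rewrite divr_ge0 ?mdens1_ge0//.
by apply: fine_ge0; exact: (marg_ge0 densf).
Qed.

Lemma measurable_quot a b : measurable_fun setT
  (fun z : measurableTypeR R * measurableTypeR R => quot a b z.1 z.2).
Proof.
rewrite (_ : (fun z => _) = (fun z : measurableTypeR R * measurableTypeR R =>
  if (0 < z.1)%R && (0 < z.2)%R then
  (fine (marg2 f a b z.1 z.2) * mdens1 a z.1 `^ (- 1))%R else 0%R)).
  apply: measurable_fun_ifT => //.
    apply: measurable_and; apply: mgt0; [exact: measurable_fst|exact: measurable_snd].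
  apply: measurable_funM.
    by apply: measurableT_comp => //; exact: (measurable_marg2 densf).
  apply: (@measurableT_comp _ _ _ _ _ _ (@powR R ^~ (- 1)%R)) => //.
  exact: (measurableT_comp (measurable_mdens1 a) measurable_fst).
by apply/funext => z; rewrite /quot powR_inv1// mdens1_ge0.
Qed.

Let mEquot a b : measurable_fun setT
  (fun z : measurableTypeR R * measurableTypeR R => (quot a b z.1 z.2)%:E).
Proof. by apply/measurable_EFinP; exact: measurable_quot. Qed.

Lemma measurable_regular a b : measurable (regular a b : set (measurableTypeR R)).
Proof.
have mI : measurable_fun setT (fun s : measurableTypeR R =>
    \int[mu]_t (quot a b s t)%:E).
  apply: (measurable_fun_fubini_tonelli_F _ (mEquot a b)) => z.
  by rewrite lee_fin quot_ge0.
rewrite -[regular a b]setTI.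
exact: (mI measurableT [set 1] (emeasurable_set1 _)).
Qed.

Lemma measurable_transition a b : measurable_fun setT
  (fun z : measurableTypeR R * measurableTypeR R => transition a b z.1 z.2).
Proof.
apply: measurable_fun_ifT.
- apply: (measurable_fun_bool true); rewrite setTI.
  rewrite (_ : _ @^-1` _ = regular a b `*` setT).
    exact: measurableX (measurable_regular a b) measurableT.
  by apply/seteqP; split=> z /= => [/set_mem|[/mem_set]].
- exact: measurable_quot.
- by apply: mind; [exact: measurable_itv|exact: measurable_snd].
Qed.

Lemma transition_ge0 a b s t : (0 <= transition a b s t)%R.
Proof. by rewrite /transition; case: ifP => _; rewrite ?quot_ge0// indicE. Qed.

Lemma transition_nonpos a b s t : (t <= 0)%R -> transition a b s t = 0%R.
Proof.
move=> t0; rewrite /transition /quot [(0 < t)%R]ltNge t0 andbF; case: ifP => // _.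
by rewrite indicE memNset//= in_itv/= ltNge t0.
Qed.

Lemma measurable_transition1 a b s (A : set (measurableTypeR R)) :
  measurable_fun A (fun t => (transition a b s t)%:E).
Proof.
apply/measurable_EFinP; apply: measurable_funTS.
exact: (measurableT_comp (measurable_transition a b) (pair1_measurable s)).
Qed.

Lemma integral_transition a b s : \int[mu]_t (transition a b s t)%:E = 1.
Proof.
have [sr|sr] := boolP (s \in regular a b).
  rewrite -[RHS](set_mem sr).
  by apply: eq_integral => t _; rewrite /transition sr.
rewrite (eq_integral (fun t : measurableTypeR R => (\1_(`]0%R, 1%R]%classic : set R) t)%:E)) => [|t _]; last first.
  by rewrite /transition (negbTE sr).
transitivity (mu `]0%R, 1%R]%classic); first by rewrite integral_indic// setIT.
by rewrite lebesgue_measure_itv/= lte_fin ltr01 sube0.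
Qed.

Lemma measurable_kernel_mass a b (B : set R) : measurable B ->
  measurable_fun setT (fun s : measurableTypeR R => \int[mu]_(t in B) (transition a b s t)%:E).
Proof.
move=> mB.
under eq_fun do rewrite -[X in \int[mu]_(t in X) _]setTI integral_setI_indic.
apply: (measurable_fun_fubini_tonelli_F (fun z : measurableTypeR R * measurableTypeR R =>
  (\1_B z.2)%:E * (transition a b z.1 z.2)%:E)).
- apply: emeasurable_funM; apply/measurable_EFinP; last exact: measurable_transition.
  exact: (mind mB measurable_snd).
- by move=> z; rewrite mule_ge0 ?lee_fin ?transition_ge0// indicE.
Qed.

(** The two versions can differ only at 0 and where the integrable marginal is infinite; on the
    negative half-line both vanish. *)
Lemma mdens1_ae v : ae_eq mu setT (EFin \o mdens1 v) (marg1 f v).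
Proof.
have m1 := measurable_marg1 densf v.
have i1 : mu.-integrable setT (marg1 f v : measurableTypeR R -> \bar R).
  apply/integrableP; split=> //.
  rewrite (eq_integral (marg1 f v : measurableTypeR R -> \bar R)) => [|t _]; last first.
    by rewrite gee0_abs//; exact: (marg_ge0 densf).
  by rewrite (integral_marg1 densf) ltry.
have fin := integrable_ae measurableT i1.
have n0 : {ae mu, forall t : measurableTypeR R, t != 0%R}.
  exists [set 0%R]; split=> //; first exact: lebesgue_measure_set1.
  by move=> t /= /negP; rewrite negbK => /eqP.
apply: filterS2 fin n0 => t fint t0 _ /=.
rewrite /mdens1; case: ltgtP t0 => // [t0 _|t0 _].
  by rewrite fineK// fint.
by rewrite /marg1 (marg_neg densf (v := v))// mem_head.
Qed.

Lemma marginal_law v (F : R -> \bar R) :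
  measurable_fun setT (F : measurableTypeR R -> \bar R) -> (forall t, 0 <= F t) ->
  \int[P]_w F (X v w) = \int[mu]_t (F t * (mdens1 v t)%:E).
Proof.
move=> mF F0.
have mXm : measurable_fun setT (X v : Omega -> measurableTypeR R) by exact: mX.
rewrite -(ge0_integral_mpush P mXm)//.
apply: (ge0_integral_density (measurable_mdens1 v) (mdens1_ge0 v)) => // A mA.
transitivity (\int[P]_w (\1_A (X v w))%:E).
  rewrite (_ : (fun w => _) = (fun w => (\1_(X v @^-1` A) w)%:E)); last first.
    by apply/funext => w; rewrite !indicE.
  rewrite integral_indic ?setIT//.
  by rewrite -[X in measurable X]setTI; exact: mXm.
have m1A : measurable_fun setT (\1_A : R -> R) by exact: measurable_indic.
rewrite (marg1_law densf v m1A) => [|t]; last by rewrite indicE.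
rewrite -[A in RHS]setTI integral_setI_indic.
apply: ge0_ae_eq_integral => //.
- apply: emeasurable_funM; last exact: (measurable_marg1 densf).
  by apply/measurable_EFinP; exact: measurable_indic.
- apply: emeasurable_funM; apply/measurable_EFinP; last exact: measurable_mdens1.
  exact: measurable_indic.
- by move=> t _; rewrite mule_ge0 ?lee_fin ?indicE//; exact: (marg_ge0 densf).
- by move=> t _; rewrite mule_ge0 ?lee_fin ?indicE// mdens1_ge0.
- by apply: filterS (mdens1_ae v) => t /= -> //.
Qed.

Let m2 a b s (A : set (measurableTypeR R)) :
  measurable_fun A (fun t : measurableTypeR R => marg2 f a b s t).
Proof.
apply: measurable_funTS.
exact: (measurableT_comp (measurable_marg2 densf a b) (pair1_measurable s)).
Qed.

(** The marginal density of X_a is finite at s, so the pair density at s is integrable in t, hence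
    finite for almost every t, and the quotient can be multiplied back. *)
Lemma quot_marg2 a b s (A : set R) : a != b -> measurable A ->
  (0 < mdens1 a s)%R -> (mdens1 a s)%:E = marg1 f a s ->
  (mdens1 a s)%:E * \int[mu]_(t in A) (quot a b s t)%:E =
  \int[mu]_(t in A) marg2 f a b s t.
Proof.
move=> ab mA F0 Es.
have m20 t : 0 <= marg2 f a b s t by exact: (marg_ge0 densf).
have s0 : (0 < s)%R by move: F0; rewrite /mdens1; case: ifP => //; rewrite ltxx.
have i2 : mu.-integrable setT (fun t : measurableTypeR R => marg2 f a b s t).
  apply/integrableP; split=> //.
  rewrite (eq_integral (fun t : measurableTypeR R => marg2 f a b s t)) => [|t _]; last by rewrite gee0_abs.
  by rewrite -(marg1_marg2 densf s ab) -Es ltry.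
have fin := integrable_ae measurableT i2.
have n0 : {ae mu, forall t : measurableTypeR R, t != 0%R}.
  exists [set 0%R]; split=> //; first exact: lebesgue_measure_set1.
  by move=> t /= /negP; rewrite negbK => /eqP.
have mq : measurable_fun A (fun t : measurableTypeR R => (quot a b s t)%:E).
  apply/measurable_EFinP; apply: measurable_funTS.
  exact: (measurableT_comp (measurable_quot a b) (pair1_measurable s)).
rewrite -ge0_integralZl//; last 2 first.
- by move=> t _; rewrite lee_fin quot_ge0.
- by rewrite lee_fin mdens1_ge0.
apply: ge0_ae_eq_integral => //.
- exact: measurable_funeM.
- by move=> t _; rewrite mule_ge0 ?lee_fin ?mdens1_ge0 ?quot_ge0.
apply: filterS2 fin n0 => t fint t0 _.
rewrite /quot s0/=; case: ltgtP t0 => // [t0 _|t0 _].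
  by rewrite -EFinM mulrC divfK ?gt_eqF// fineK// fint.
rewrite mule0 /marg2 (marg_neg densf (v := b))//.
  by rewrite !inE eqxx orbT.
by rewrite eq_sym (negbTE ab).
Qed.

(** Integrating the previous identity over the line gives F times the mass of the quotient equal to
    F, with 0 < F < +oo. The default density thus occurs only where the marginal is zero, infinite,
    or cut off. *)
Lemma regular_gt0 a b s : a != b -> (0 < mdens1 a s)%R ->
  (mdens1 a s)%:E = marg1 f a s -> regular a b s.
Proof.
move=> ab F0 Es; rewrite /regular/=.
have := quot_marg2 ab measurableT F0 Es; rewrite -(marg1_marg2 densf s ab) -Es.
have : 0 <= \int[mu]_t (quot a b s t)%:E.
  by apply: integral_ge0 => t' _; rewrite lee_fin quot_ge0.
case: (integral _ _ _) => [r| |]//= r0.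
  by rewrite -EFinM => -[] /(canRL (mulKf (lt0r_neq0 F0))); rewrite mulVf ?gt_eqF// => ->.
by rewrite gt0_muley// lte_fin.
Qed.

(** If the marginal vanishes at s, the pair density has integral 0 in t and both sides are 0;
    otherwise s is regular and the default plays no part. *)
Lemma transition_marg2 a b s (B : set R) : a != b -> measurable B ->
  (mdens1 a s)%:E = marg1 f a s ->
  (mdens1 a s)%:E * \int[mu]_(t in B) (transition a b s t)%:E =
  \int[mu]_(t in B) marg2 f a b s t.
Proof.
move=> ab mB Es.
have [E0|E0] := eqVneq (mdens1 a s) 0%R.
  rewrite E0 mul0e; apply/esym/eqP; rewrite eq_le integral_ge0 => [|t _]; last exact: (marg_ge0 densf).
  have -> : 0 = \int[mu]_t marg2 f a b s t by rewrite -(marg1_marg2 densf s ab) -Es E0.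
  by rewrite andbT; apply: ge0_subset_integral => // t _; exact: (marg_ge0 densf).
have F0 : (0 < mdens1 a s)%R by rewrite lt_neqAle eq_sym E0 mdens1_ge0.
rewrite -quot_marg2//; congr (_ * _); apply: eq_integral => t _.
by rewrite /transition ifT// inE; exact: regular_gt0.
Qed.

Lemma pair_law a b (A B : set R) : a != b -> measurable A -> measurable B ->
  P (X a @^-1` A `&` X b @^-1` B) =
  \int[P]_(w in X a @^-1` A) \int[mu]_(t in B) (transition a b (X a w) t)%:E.
Proof.
move=> ab mA mB.
transitivity (\int[P]_w (\1_A (X a w) * \1_B (X b w))%:E).
  rewrite (_ : (fun w => _) = (fun w => (\1_(X a @^-1` A `&` X b @^-1` B) w)%:E)); last first.
    by apply/funext => w; rewrite indicI !indicE.
  rewrite integral_indic ?setIT//.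
  by apply: measurableI; rewrite -[X in measurable X]setTI; exact: mX.
have mc : measurable_fun setT
    (fun z : measurableTypeR R * measurableTypeR R => \1_A z.1 * \1_B z.2 : R)%R.
  apply: measurable_funM; first exact: (mind mA measurable_fst).
  exact: (mind mB measurable_snd).
rewrite (marg2_law densf ab (c := fun s t => \1_A s * \1_B t)%R mc); last first.
  by move=> s t; rewrite mulr_ge0// indicE.
rewrite -[X in \int[P]_(w in X) _]setTI integral_setI_indic.
pose F (s : R) := (\1_A s)%:E * \int[mu]_(t in B) (transition a b s t)%:E.
transitivity (\int[P]_w F (X a w)); last first.
  by apply: eq_integral => w _; rewrite /F !indicE.
have mF : measurable_fun setT (F : measurableTypeR R -> \bar R).
  apply: emeasurable_funM; last exact: measurable_kernel_mass.
  by apply/measurable_EFinP; exact: measurable_indic.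
have F0 s : 0 <= F s.
  rewrite mule_ge0 ?lee_fin ?indicE//; apply: integral_ge0 => t _.
  by rewrite lee_fin transition_ge0.
rewrite marginal_law//.
have E1 s : \int[mu]_t ((\1_A s * \1_B t)%:E * marg2 f a b s t) =
    (\1_A s)%:E * \int[mu]_(t in B) marg2 f a b s t.
  rewrite -[X in _ = _ * \int[mu]_(t in X) _]setTI [X in _ = _ * X]integral_setI_indic.
  rewrite -ge0_integralZl ?lee_fin ?indicE//; last 2 first.
  - by apply: emeasurable_funM => //; apply/measurable_EFinP; exact: measurable_indic.
  - by move=> t _; rewrite mule_ge0 ?lee_fin//; exact: (marg_ge0 densf).
  by apply: eq_integral => t _; rewrite EFinM muleA.
under eq_integral do rewrite E1.
apply: ge0_ae_eq_integral => //.
- apply: emeasurable_funM; first by apply/measurable_EFinP; exact: measurable_indic.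
  under eq_fun do rewrite -[X in \int[mu]_(t in X) _]setTI integral_setI_indic.
  apply: (measurable_fun_fubini_tonelli_F (fun z : measurableTypeR R * measurableTypeR R =>
    (\1_B z.2)%:E * marg2 f a b z.1 z.2)).
    apply: emeasurable_funM; last exact: (measurable_marg2 densf).
    apply/measurable_EFinP.
    exact: (mind mB measurable_snd).
  by move=> z; rewrite mule_ge0 ?lee_fin ?indicE//; exact: (marg_ge0 densf).
- by apply: emeasurable_funM => //; apply/measurable_EFinP; exact: measurable_mdens1.
- move=> s _; rewrite mule_ge0 ?lee_fin ?indicE//; apply: integral_ge0 => t _.
  exact: (marg_ge0 densf).
- by move=> s _; rewrite mule_ge0// lee_fin mdens1_ge0.
- apply: filterS (mdens1_ae a) => s /= /(_ I) Es _.
  by rewrite /F -(transition_marg2 ab mB Es) -muleA (muleC (integral _ _ _)).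
Qed.

End Transition.

(** * Asymptotics of the marginals and of the transitions *)

Section Scaling.
Context (R : realType).
Local Open Scope ring_scope.

Lemma mulr_cvg_pinfty (l : R) : 0 < l -> l * t @[t --> +oo] --> +oo.
Proof. by move=> l0; apply: gt0_cvgMry => //; exact: cvg_id. Qed.

Lemma near_pinfty_scale (l : R) (S : R -> Prop) : 0 < l ->
  (\forall t \near +oo, S t) -> \forall t \near +oo, S (l * t).
Proof. by move=> l0 H; have := mulr_cvg_pinfty l0 H. Qed.

Lemma cvg_pinfty_scale (T : topologicalType) (h : R -> T) (y : T) (l : R) : 0 < l ->
  h t @[t --> +oo] --> y -> h (l * t) @[t --> +oo] --> y.
Proof. by move=> l0 H; apply: (cvg_comp _ _ (mulr_cvg_pinfty l0) H). Qed.

End Scaling.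

Section Asymptotics.
Context (R : realType) (V : finType) d (Omega : measurableType d)
  (P : probability Omega R) (X : V -> {RV P >-> R}) (f : rvec R V -> R).
Hypothesis densf : joint_density X f.
Variables (alpha : R) (g : R -> R) (c : V -> R).
Hypothesis alpha0 : 0 < alpha.
Hypothesis rvg : regularly_varying g (- alpha - 1).
Hypothesis c_gt0 : forall v, 0 < c v.
Hypothesis fg : forall v,
  (marginal1 f v t / (g t)%:E)%E @[t --> +oo] --> (c v)%:E.
Local Notation mu := (@lebesgue_measure R).
Local Notation F := (mdens1 f).

Lemma near_gt0 : \forall t \near +oo, (0 : R) < t.
Proof. by apply: nbhs_pinfty_gt; exact: num_real. Qed.

Lemma near_g_gt0 : \forall t \near +oo, 0 < g t.
Proof.
case: rvg => -[t0 [g0 _]] _; near=> t; apply: g0; near: t.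
by apply: nbhs_pinfty_gt; exact: num_real.
Unshelve. all: by end_near. Qed.

Lemma marginal1E v t : 0 < t -> marginal1 f v t = marg1 f v t.
Proof. by move=> t0; apply: marginalE densf _ _ _ => w; exact: ltW. Qed.

(** A limit of f_v / g in (0, +oo) forces f_v to be eventually finite and positive, so that near
    infinity the real-valued version is the given marginal. *)
Lemma near_marg1 v :
  \forall t \near +oo, (F v t)%:E = marg1 f v t /\ 0 < F v t.
Proof.
have [H1 H2] := (fine_cvgP _ _).1 (@fg v).
have H3 : \forall t \near +oo, `|c v - fine (marginal1 f v t / (g t)%:E)%E| < c v.
  exact: (cvgrPdist_lt _ _).1 H2 _ (c_gt0 v).
near=> t.
have t0 : 0 < t by near: t; exact: near_gt0.
have g0 : 0 < g t by near: t; exact: near_g_gt0.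
have : (marginal1 f v t / (g t)%:E)%E \is a fin_num by near: t.
have : `|c v - fine (marginal1 f v t / (g t)%:E)%E| < c v by near: t.
rewrite marginal1E// /mdens1 t0 inver gt_eqF//.
have := marg_ge0 densf [:: v] (fun=> t); rewrite -/(marg1 f v t).
case: (marg1 f v t) => [r| |]//= r0; last by rewrite gt0_mulye// lte_fin invr_gt0.
move=> h _; split=> //; move: h; rewrite lee_fin in r0.
move=> h; rewrite lt_neqAle r0 andbT; apply/eqP => r00.
by move: h; rewrite -r00 mul0r subr0 gtr0_norm// ltxx.
Unshelve. all: by end_near. Qed.

Lemma mdens1_g v : F v t / g t @[t --> +oo] --> c v.
Proof.
have [_ H2] := (fine_cvgP _ _).1 (@fg v).
apply: cvg_trans H2; apply: near_eq_cvg; near=> t.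
have t0 : 0 < t by near: t; exact: near_gt0.
have g0 : 0 < g t by near: t; exact: near_g_gt0.
have [E _] : (F v t)%:E = marg1 f v t /\ 0 < F v t by near: t; exact: near_marg1.
by rewrite /= marginal1E// -E inver gt_eqF.
Unshelve. all: by end_near. Qed.

Lemma mdens1_ratio a b l : 0 < l ->
  F a (l * t) / F b t @[t --> +oo] --> c a / c b * l `^ (- alpha - 1).
Proof.
move=> l0; case: rvg => _ /(_ _ l0) rl.
have H : (F a (l * t) / g (l * t)) * (g (l * t) / g t) / (F b t / g t)
    @[t --> +oo] --> c a * l `^ (- alpha - 1) / c b.
  apply: cvgM; first apply: cvgM => //.
    exact: (cvg_pinfty_scale l0 (mdens1_g (v := a))).
  by apply: cvgV; [rewrite gt_eqF|exact: mdens1_g].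
rewrite mulrAC; apply: cvg_trans H; apply: near_eq_cvg; near=> t.
have g0 : 0 < g t by near: t; exact: near_g_gt0.
have gl0 : 0 < g (l * t) by near: t; exact: near_pinfty_scale near_g_gt0.
have [_ Fb] : (F b t)%:E = marg1 f b t /\ 0 < F b t by near: t; exact: near_marg1.
by field; rewrite !gt_eqF.
Unshelve. all: by end_near. Qed.

Local Notation b := (fun t : R => alpha / (t * g t)).

Lemma b_gt0 : \forall t \near +oo, 0 < b t.
Proof.
near=> t; have t0 : 0 < t by near: t; exact: near_gt0.
have g0 : 0 < g t by near: t; exact: near_g_gt0.
by rewrite divr_gt0// mulr_gt0.
Unshelve. all: by end_near. Qed.

Lemma regularly_varying_b : regularly_varying b alpha.
Proof.
case: rvg => -[t0 [g0 mg]] rl; split.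
  exists (Num.max t0 0); split=> [t|].
    by rewrite gt_max => /andP[tt0 t1]; rewrite divr_gt0// mulr_gt0// g0.
  apply: measurable_funM => //.
  apply: (eq_measurable_fun (fun t : R => (t * g t) `^ (-1) : R)) => [t|].
    rewrite inE/= in_itv/= andbT gt_max => /andP[tt0 t1].
    by rewrite powR_inv1// mulr_ge0 ?(ltW t1)// ltW// g0.
  apply: (measurableT_comp (measurable_powR _)); apply: measurable_funM => //.
  apply: measurable_funS mg => //; move=> t /=.
  by rewrite !in_itv/= !andbT gt_max => /andP[].
move=> l l0.
have H : l^-1 * (g (l * t) / g t)^-1 @[t --> +oo] --> l^-1 * (l `^ (- alpha - 1))^-1.
  by apply: cvgM; [exact: cvg_cst|apply: cvgV; [rewrite gt_eqF ?powR_gt0|exact: rl]].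
have -> : l `^ alpha = l^-1 * (l `^ (- alpha - 1))^-1.
  rewrite -powRN -[l^-1]powR_inv1 ?ltW// -powRD; last by rewrite (gt_eqF l0) implybT.
  by congr powR; ring.
apply: cvg_trans H; apply: near_eq_cvg; near=> t.
have tp : 0 < t by near: t; exact: near_gt0.
have gt0 : 0 < g t by near: t; exact: near_g_gt0.
have gl0 : 0 < g (l * t) by near: t; exact: near_pinfty_scale near_g_gt0.
by field; rewrite !gt_eqF.
Unshelve. all: by end_near. Qed.

Lemma mdens1_tail u (e : R) : P [set w | e < X u w] = (\int[mu]_(s in `]e, +oo[) (F u s)%:E)%E.
Proof.
have -> : [set w | e < X u w] = X u @^-1` `]e, +oo[%classic.
  by apply/seteqP; split=> w /=; rewrite in_itv/= andbT.
transitivity (\int[P]_w (\1_(`]e, +oo[%classic) (X u w))%:E)%E.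
  rewrite -[X in P X]setIT -integral_indic//; exact: measurable_funPTI.
rewrite (@marginal_law _ _ _ _ _ _ _ densf u (fun s => (\1_(`]e, +oo[%classic) s)%:E)).
- by rewrite -integral_setI_indic setTI.
- by apply/measurable_EFinP; exact: measurable_indic.
- by move=> s; rewrite lee_fin indicE.
Qed.

(** With U(t) = P(X_u > t), b(t) U(t) = (F/g)(t) alpha / (t F(t) / U(t)). The first factor tends to
    c_u and, by Karamata, the last quotient tends to alpha. *)
Lemma tail_b u :
  ((b t)%:E * P [set w | (t < X u w)%R])%E @[t --> +oo] --> (c u)%:E.
Proof.
have k : t * F u t / fine (\int[mu]_(s in `]t, +oo[) (F u s)%:E)%E @[t --> +oo] --> alpha.
  apply: karamata => //.
  - exact: (measurable_mdens1 densf u).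
  - by move=> s; exact: (mdens1_ge0 densf).
  - have <- : (\int[P]_w (cst 1%E : R -> \bar R) (X u w) = \int[mu]_s (F u s)%:E)%E.
      by rewrite (marginal_law densf)//; apply: eq_integral => s _; rewrite mul1e.
    by rewrite (integral_probability_cst P) ltry.
  - by apply: filterS (near_marg1 u) => t [].
  - by move=> l l0; have := mdens1_ratio (a := u) (b := u) l0; rewrite divff ?gt_eqF// mul1r.
have H : (F u t / g t) * alpha * (t * F u t / fine (\int[mu]_(s in `]t, +oo[) (F u s)%:E)%E)^-1
    @[t --> +oo] --> c u * alpha * alpha^-1.
  apply: cvgM; last by apply: cvgV => //; rewrite gt_eqF.
  by apply: cvgM; [exact: mdens1_g|exact: cvg_cst].
have fin t : P [set w | t < X u w] \is a fin_num.
  apply: fin_num_measure; rewrite (_ : [set w | t < X u w] = X u @^-1` `]t, +oo[%classic).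
    exact: measurable_funPTI.
  by apply/seteqP; split=> w /=; rewrite in_itv/= andbT.
apply/fine_cvgP; split; first by apply: nearW => t; rewrite fin_numM.
rewrite mulfK ?gt_eqF// in H.
apply: cvg_trans H; apply: near_eq_cvg; near=> t.
have tp : 0 < t by near: t; exact: near_gt0.
have gt0 : 0 < g t by near: t; exact: near_g_gt0.
have [_ Fb] : (F u t)%:E = marg1 f u t /\ 0 < F u t by near: t; exact: near_marg1.
rewrite /= fineM// mdens1_tail /= invf_div; field.
by rewrite !gt_eqF.
Unshelve. all: by end_near. Qed.

Section Edge.

Variables x y : V.
Hypotheses (xy : x != y).

(** The repair depends on the conditioning value t alone, so a single threshold serves all s. *)
Lemma near_transition : \forall t \near +oo, forall s, 0 < s ->
  transition f x y t s = fine (marg2 f x y t s) / F x t.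
Proof.
near=> t.
have t0 : 0 < t by near: t; exact: near_gt0.
have [E F0] : (F x t)%:E = marg1 f x t /\ 0 < F x t by near: t; exact: near_marg1.
move=> s s0; rewrite /transition ifT; last by rewrite inE; exact: (regular_gt0 densf).
by rewrite /quot t0 s0.
Unshelve. all: by end_near. Qed.

Lemma transition_cvg z r : 0 < z ->
  (t%:E * marginal2 f x y t (t * z)%R / marginal1 f x t)%E @[t --> +oo] --> r%:E ->
  t * transition f x y t (t * z) @[t --> +oo] --> r.
Proof.
move=> z0 /fine_cvgP[H1 H2]; apply: cvg_trans H2; apply: near_eq_cvg; near=> t.
have t0 : 0 < t by near: t; exact: near_gt0.
have [E F0] : (F x t)%:E = marg1 f x t /\ 0 < F x t by near: t; exact: near_marg1.
have tr : forall s, 0 < s -> transition f x y t s = fine (marg2 f x y t s) / F x t.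
  by near: t; exact: near_transition.
have : (t%:E * marginal2 f x y t (t * z)%R / marginal1 f x t)%E \is a fin_num by near: t.
rewrite /= marginal1E// -E tr ?mulr_gt0// inver gt_eqF//.
have -> : marginal2 f x y t (t * z) = marg2 f x y t (t * z).
  by apply: marginalE densf _ _ _ => v; case: ifP => _; rewrite ltW// mulr_gt0.
have := marg_ge0 densf [:: x; y] (fun v => if v == x then t else t * z).
rewrite -/(marg2 f x y t (t * z)).
case: (marg2 _ _ _ _ _) => [m| |]//= m0; first by rewrite mulrA.
by rewrite gt0_muley ?lte_fin// gt0_mulye// lte_fin invr_gt0.
Unshelve. all: by end_near. Qed.

End Edge.

(** The joint density of the two nodes at the same point can be factored in either order: F_y(t)
    times the transition from t to tz equals F_x(tz) times the transition from tz to t. Both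
    factorisations are passed to the limit, the second along zt; the ratio F_x(zt)/F_y(t)
    contributes the constants and the power of z. *)
Lemma transition_swap x y (r r' z : R) : x != y -> 0 < z ->
  t * transition f y x t (t * z) @[t --> +oo] --> r ->
  t * transition f x y t (t * z^-1) @[t --> +oo] --> r' ->
  c y * z `^ alpha * r = c x * z ^- 2 * r'.
Proof.
move=> xy z0 H1 H2.
have H3 := cvg_pinfty_scale z0 H2.
have H4 : (z * t * transition f x y (z * t) (z * t / z)) * z^-1 * (F x (z * t) / F y t)
    @[t --> +oo] --> r' * z^-1 * (c x / c y * z `^ (- alpha - 1)).
  by apply: cvgM; [apply: cvgM; [exact: H3|exact: cvg_cst]|exact: mdens1_ratio].
have H5 : (z * t * transition f x y (z * t) (z * t / z)) * z^-1 * (F x (z * t) / F y t)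
    @[t --> +oo] --> r.
  apply: cvg_trans H1; apply: near_eq_cvg; near=> t.
  have t0 : 0 < t by near: t; exact: near_gt0.
  have [_ Fy] : (F y t)%:E = marg1 f y t /\ 0 < F y t by near: t; exact: near_marg1.
  have [_ Fx] : (F x (z * t))%:E = marg1 f x (z * t) /\ 0 < F x (z * t).
    by near: t; exact: (near_pinfty_scale z0 (near_marg1 x)).
  have tr : forall s, 0 < s -> transition f y x t s = fine (marg2 f y x t s) / F y t.
    by near: t; apply: near_transition; rewrite eq_sym.
  have tr' : forall s, 0 < s ->
      transition f x y (z * t) s = fine (marg2 f x y (z * t) s) / F x (z * t).
    by near: t; exact: (near_pinfty_scale z0 (near_transition xy)).
  have -> : z * t / z = t by field; rewrite gt_eqF.
  rewrite tr ?mulr_gt0// tr'// (mulrC t z) (marg2C densf _ _ xy).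
  by field; rewrite !gt_eqF.
have -> := cvg_unique _ H5 H4 => //.
have -> : z `^ (- alpha - 1) = z `^ (- alpha) * z^-1.
  by rewrite powRD ?powR_inv1 ?ltW// (gt_eqF z0) implybT.
rewrite powRN; field.
by rewrite !gt_eqF ?powR_gt0.
Unshelve. all: by end_near. Qed.

End Asymptotics.

(** * The Markov property in terms of transition densities *)

Section JointLaw.
Context (R : realType) d (Omega : measurableType d) (P : probability Omega R).
Variables (X : {RV P >-> R}) (A : set Omega) (mA : measurable A).
Local Open Scope ereal_scope.

(** The measure D -> P(A, X in D), dominated by the law of X; its density is P(A | X = x). *)
Definition trace_law : set R -> \bar R :=
  pushforward (mrestr P mA) X.

HB.instance Definition _ := Measure.copy trace_law
  (mpush (mrestr P mA) (@measurable_funPT _ _ _ _ X)).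

Let trace_law_fin : fin_num_fun trace_law.
Proof.
move=> D mD; apply: (@fin_num_measure _ _ _ P).
by apply: measurableI => //; exact: measurable_funPTI.
Qed.

HB.instance Definition _ := @Measure_isFinite.Build _ _ _ trace_law trace_law_fin.

Lemma trace_lawE D : trace_law D = P (A `&` X @^-1` D).
Proof. by rewrite setIC. Qed.

Lemma joint_density_wrt : exists r : R -> R,
  [/\ measurable_fun setT r, forall x, (0 <= r x)%R,
   P.-integrable setT (EFin \o r \o X) &
   forall D, measurable D -> P (A `&` X @^-1` D) = \int[distribution P X]_(x in D) (r x)%:E].
Proof.
have dom : trace_law `<< distribution P X.
  apply/null_content_dominatesP => D mD D0; apply/eqP.
  rewrite eq_le measure_ge0 andbT -D0 trace_lawE; apply: le_measure; rewrite ?inE.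
  - by apply: measurableI => //; exact: measurable_funPTI.
  - exact: measurable_funPTI.
  - exact: subIsetr.
have [r [r0 rfin ri rE]] := radon_nikodym_sigma_finite dom.
have mr : measurable_fun setT r by exact: measurable_int ri.
have mfr : measurable_fun setT (fine \o r) by exact: measurableT_comp.
exists (fine \o r); split=> //.
- by move=> x; rewrite fine_ge0.
- apply/integrableP; split.
    apply/measurable_EFinP; exact: (measurableT_comp mfr (@measurable_funPT _ _ _ _ X)).
  rewrite (_ : (fun x => _) = (r \o X)); last first.
    by apply/funext => w /=; rewrite ger0_norm ?fine_ge0// fineK.
  rewrite -ge0_integral_distribution//.
  by rewrite -rE// -ge0_fin_numE ?measure_ge0// fin_num_measure.
- move=> D mD; rewrite -trace_lawE; transitivity (\int[distribution P X]_(x in D) r x).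
    exact: rE.
  by apply: eq_integral => x _; rewrite /= fineK.
Qed.

End JointLaw.

Section MarkovBox.
Context (R : realType) (V : finType) d (Omega : measurableType d)
  (P : probability Omega R) (X : V -> {RV P >-> R}) (f : rvec R V -> R).
Hypothesis densf : joint_density X f.
Variable E : {set V * V}.
Hypothesis markovX : global_markov X E.
Local Notation mu := (@lebesgue_measure R).
Local Open Scope ereal_scope.

Lemma sigma_of_in (W : {set V}) v (B : set R) : v \in W -> measurable B ->
  sigma_of X W (X v @^-1` B).
Proof.
move=> vW mB; apply: sub_sigma_algebra; exists v => //.
by exists B => //; rewrite setTI.
Qed.

Lemma sigma_of1 a H : sigma_of X [set a]%SET H ->
  exists2 B, measurable B & H = X a @^-1` B.
Proof.
have -> : sigma_of X [set a]%SET = preimage_set_system setT (X a) measurable.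
  rewrite /sigma_of (_ : \bigcup_(v in _) _ =
      preimage_set_system setT (X a) measurable); last first.
    apply/seteqP; split=> [B [v /= ]|B XB]; first by rewrite inE => /eqP ->.
    by exists a => //=; rewrite inE.
  rewrite sigma_algebra_id//.
  exact: sigma_algebra_preimage (@sigma_algebra_measurable _ R).
by move=> [B mB <-]; exists B => //; rewrite setTI.
Qed.

Lemma sigma_of_box (W : {set V}) (B : V -> set R) : (forall i, measurable (B i)) ->
  sigma_of X W [set w | forall i, i \in W -> B i (X i w)].
Proof.
move=> mB.
rewrite (_ : [set w | _] = \bigcap_(i in [set` W]) (X i @^-1` B i))//.
apply: (@fin_bigcap_measurable _ (g_sigma_algebraType
  (\bigcup_(v in [set` W]) preimage_set_system setT (X v) measurable))).
  exact: finite_finset.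
by move=> i /= iW; exact: sigma_of_in.
Qed.

Let k a v (B' : set R) (x : R) := \int[mu]_(t in B') (transition f a v x t)%:E.

Let k_le1 a v B' x : measurable B' -> k a v B' x <= 1.
Proof.
move=> mB; rewrite -(integral_transition f a v x); apply: ge0_subset_integral => //.
  exact: (measurable_transition1 densf).
by move=> t _; rewrite lee_fin (transition_ge0 densf).
Qed.

Let k_ge0 a v B' x : 0 <= k a v B' x.
Proof. by apply: integral_ge0 => t _; rewrite lee_fin (transition_ge0 densf). Qed.

Let k_fin a v B' x : measurable B' -> k a v B' x \is a fin_num.
Proof. by move=> mB; rewrite ge0_fin_numE// (le_lt_trans (k_le1 _ _ _ mB))// ltry. Qed.

Lemma cond_prob_transition a v (B' : set R) : a != v -> measurable B' ->
  cond_prob P (sigma_of X [set a]%SET) (X v @^-1` B') (fun w => fine (k a v B' (X a w))).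
Proof.
move=> av mB'.
have mk : measurable_fun setT (fine \o k a v B').
  by apply: measurableT_comp => //; exact: (measurable_kernel_mass densf a v mB').
split.
- move=> B mB; rewrite (_ : _ @^-1` B = X a @^-1` ((fine \o k a v B') @^-1` B))//.
  by apply: sigma_of_in; rewrite ?inE// -[X in measurable X]setTI; exact: mk.
- apply: (@le_integrable _ _ _ _ _ measurableT _ (cst 1)).
  + apply/measurable_EFinP; exact: (measurableT_comp mk (@measurable_funPT _ _ _ _ (X a))).
  + move=> w _ /=; rewrite normr1 ger0_norm ?fine_ge0//.
    by rewrite -[leLHS]/(fine _)%:E fineK ?k_le1// k_fin.
  + exact: finite_measure_integrable_cst.
- move=> H /sigma_of1[B mB ->]; rewrite setIC (pair_law densf av mB mB').
  by apply: eq_integral => w _; rewrite fineK// k_fin.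
Qed.

(** Conditionally on the parent, the box on the other nodes and the event on v are independent. The
    first has conditional probability r(X_a), from Radon-Nikodym, and the second is the transition;
    integrating out X_a turns r back into the restriction to the box. *)
Lemma markov_box (W : {set V}) a v (B : V -> set R) (B' : set R) :
  a \in W -> v \notin W -> separates E [set a]%SET (W :\ a)%SET [set v]%SET ->
  (forall i, measurable (B i)) -> measurable B' ->
  P ([set w | forall i, i \in W -> B i (X i w)] `&` X v @^-1` B') =
  \int[P]_(w in [set w | forall i, i \in W -> B i (X i w)])
    \int[mu]_(t in B') (transition f a v (X a w) t)%:E.
Proof.
move=> aW vW sep mB mB'.
have av : a != v by apply: contraNneq vW => <-.
pose A := [set w | forall i, i \in (W :\ a)%SET -> B i (X i w)].
have -> : [set w | forall i, i \in W -> B i (X i w)] = A `&` X a @^-1` B a.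
  apply/seteqP; split=> w /=.
    by move=> H; split=> [i|]; [rewrite !inE => /andP[_ iW]|]; exact: H.
  move=> [H Ha] i iW; have [->//|ia] := eqVneq i a.
  by apply: H; rewrite !inE ia.
(* The Markov property speaks of non-empty sets; when [a] is the only earlier node, the law of the
   pair is already the claim. *)
have [W0|W0] := eqVneq (W :\ a)%SET finset.set0.
  have -> : A = setT by apply/seteqP; split=> w // _ i; rewrite W0 inE.
  by rewrite setTI (pair_law densf av (mB a) mB').
have sA : sigma_of X (W :\ a)%SET A by exact: sigma_of_box.
have mA : measurable A.
  rewrite (_ : A = \bigcap_(i in [set` (W :\ a)%SET]) (X i @^-1` B i))//.
  apply: fin_bigcap_measurable; first exact: finite_finset.
  by move=> i _; exact: measurable_funPTI.
have [r [mr r0 ri rE]] := joint_density_wrt (X a) mA.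
have cA : cond_prob P (sigma_of X [set a]%SET) A (r \o X a).
  split=> //.
  - move=> D mD; apply: (@sigma_of_in [set a]%SET a (r @^-1` D)); rewrite ?inE//.
    by rewrite -[X in measurable X]setTI; exact: mr.
  - move=> H /sigma_of1[D mD ->]; rewrite rE//.
    rewrite -[D in RHS]setTI integral_setI_indic ge0_integral_distribution.
    + rewrite -[X in \int[P]_(w in X) _]setTI integral_setI_indic.
      by apply: eq_integral => w _; rewrite !indicE.
    + apply: emeasurable_funM; apply/measurable_EFinP => //; exact: measurable_indic.
    + by move=> x; rewrite mule_ge0 ?lee_fin ?indicE.
have vW' : v \notin (W :\ a)%SET by rewrite !inE negb_and vW orbT.
have H1 : [set v]%SET != finset.set0 by apply/finset.set0Pn; exists v; rewrite inE.
have H2 : [set a]%SET != finset.set0 by apply/finset.set0Pn; exists a; rewrite inE.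
have H3 : ((W :\ a) :&: [set v])%SET = finset.set0.
  apply/setP => i; rewrite [LHS]inE [RHS]inE; apply/negP => /andP[iW].
  by rewrite inE => /eqP iv; rewrite -iv iW in vW'.
have H4 : ((W :\ a) :&: [set a])%SET = finset.set0.
  by apply/setP => i; rewrite !inE; case: (i == a); rewrite ?andbF.
have H5 : ([set v] :&: [set a])%SET = finset.set0.
  apply/setP => i; rewrite !inE; case: eqP => // ->.
  by rewrite eq_sym (negbTE av).
have vv : v \in [set v]%SET by rewrite inE.
have aa : a \in [set a]%SET by rewrite inE.
have [_ _ /(_ _ (sigma_of_in aa (mB a)))] :=
  markovX W0 H1 H2 H3 H4 H5 sep sA (sigma_of_in vv mB') cA (cond_prob_transition av mB').
rewrite setIAC => <-.
pose F x := (\1_(B a) x)%:E * k a v B' x.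
have mF : measurable_fun setT F.
  apply: emeasurable_funM; first by apply/measurable_EFinP; exact: measurable_indic.
  exact: (measurable_kernel_mass densf a v mB').
have F0 x : 0 <= F x by rewrite mule_ge0 ?lee_fin ?indicE.
(* The law of X_a with density r is the trace law of [A], so the factor r is exchanged for
   integration over [A]. *)
transitivity (\int[distribution P (X a)]_x (F x * (r x)%:E)).
  rewrite ge0_integral_distribution//; last 2 first.
  - by apply: emeasurable_funM => //; exact/measurable_EFinP.
  - by move=> x; rewrite mule_ge0// lee_fin.
  rewrite -[X in \int[P]_(w in X) _]setTI integral_setI_indic; apply: eq_integral => w _.
  by rewrite /F /= EFinM fineK ?k_fin// -muleA (muleC (k _ _ _ _)) !indicE.
rewrite -(@ge0_integral_density _ _ _ _ (trace_law (X a) mA))//; last first.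
  by move=> D mD; exact: etrans (trace_lawE _ mA D) (rE _ mD).
rewrite (@ge0_integral_mpush _ _ _ _ _ (mrestr P mA) (X a))//.
rewrite (@ge0_integral_density _ _ _ P (mrestr P mA) \1_A)//; last 2 first.
- by move=> D mD; rewrite integral_indic// /= /mrestr setIC.
- exact: (measurableT_comp mF (@measurable_funPT _ _ _ _ (X a))).
rewrite -[A `&` X a @^-1` B a in RHS]setTI integral_setI_indic; apply: eq_integral => w _.
by rewrite /F muleAC -EFinM indicI /= mulrC !indicE.
Qed.

End MarkovBox.

(** * The law of X along the tree *)

Lemma weight_cons (R : realType) (V : finType) (rho : V -> rvec R V -> R -> R) v s x :
  weight rho (v :: s) x = rho v x (x v) * weight rho s x.
Proof. exact: big_cons. Qed.

Section TreeWeight.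
Context (R : realType) (V : finType) (E : {set V * V}).
Local Notation T := (rvec R V).
Local Notation mu := (@lebesgue_measure R).
Variables (u : V) (parent : V -> V).

(** The root has its own density; every other node is drawn by [k] from the value of its parent. The
    same shape serves the law of X, its rescaling, the limit and the increments. *)
Definition treerho (r : R -> R) (k : V -> V -> R -> R -> R) (v : V) (x : T) (t : R) : R :=
  if v == u then r t else k (parent v) v (x (parent v)) t.

Lemma treerho_neq r k v x t : v != u -> treerho r k v x t = k (parent v) v (x (parent v)) t.
Proof. by rewrite /treerho => /negbTE ->. Qed.

Lemma treerho_ge0 r k v x t : (forall t, 0 <= r t) -> (forall a b x t, 0 <= k a b x t) ->
  0 <= treerho r k v x t.
Proof. by move=> r0 k0; rewrite /treerho; case: eqP. Qed.

Lemma measurable_treerho r k v :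
  measurable_fun setT (r : measurableTypeR R -> R) ->
  (forall a b, measurable_fun setT
    (fun z : measurableTypeR R * measurableTypeR R => k a b z.1 z.2)) ->
  measurable_fun setT (fun z : T * measurableTypeR R => treerho r k v z.1 z.2).
Proof.
move=> mr mk; rewrite /treerho; case: eqP => _.
  exact: (measurableT_comp mr measurable_snd).
have mg : measurable_fun setT (fun z : T * measurableTypeR R =>
    (z.1 (parent v), z.2) : measurableTypeR R * measurableTypeR R).
  apply/measurable_fun_pairP; split; last exact: measurable_snd.
  exact: (measurableT_comp (measurable_coord (parent v)) measurable_fst).
exact: (measurableT_comp (mk (parent v) v) mg).
Qed.

Variable s : seq V.
Hypothesis perm_s : perm_eq (u :: s) (enum V).
Hypothesis att : forall p v q, s = p ++ v :: q -> attached E u p v (parent v).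

Lemma order_uniq : uniq (u :: s).
Proof. by rewrite (perm_uniq perm_s) enum_uniq. Qed.

Lemma order_parent p v q : s = p ++ v :: q ->
  [/\ v != u, parent v \in u :: p, parent v \notin v :: q, v \notin u :: p & v \notin q].
Proof.
move=> spq; have [ap _ _ _ _] := att spq.
have := order_uniq; rewrite spq -cat_cons cat_uniq => /and3P[_ /hasPn H /andP[vq _]].
have vp : v \notin u :: p by apply: H; rewrite inE eqxx.
split=> //; first by apply: contraNneq vp => ->; rewrite inE eqxx.
by apply/negP => /H; rewrite /= ap.
Qed.

End TreeWeight.

Section TreeLaw.
Context (R : realType) (V : finType) d (Omega : measurableType d)
  (P : probability Omega R) (X : V -> {RV P >-> R}) (f : rvec R V -> R).
Hypothesis densf : joint_density X f.
Variable E : {set V * V}.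
Hypothesis markovX : global_markov X E.
Variables (u : V) (parent : V -> V) (s : seq V).
Hypothesis perm_s : perm_eq (u :: s) (enum V).
Hypothesis att : forall p v q, s = p ++ v :: q -> attached E u p v (parent v).
Local Notation mu := (@lebesgue_measure R).
Local Open Scope ereal_scope.

(** This is [chain] started before the root: the root contributes its marginal, and each later node
    the conditional density given its parent provided by [markov_box]. *)
Lemma tree_law (F : rvec R V -> \bar R) : measurable_fun setT F -> (forall x, 0 <= F x) ->
  \int[P]_w F (fun v => X v w) =
  \int[lebvec R V]_x ((weight (treerho u parent (mdens1 f u) (transition f)) (u :: s) x)%:E * F x).
Proof.
move=> mF F0; pose rho := treerho u parent (mdens1 f u) (transition f).
have mrho v : measurable_fun setT (fun z : rvec R V * measurableTypeR R => rho v z.1 z.2).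
  apply: measurable_treerho; first exact: (measurable_mdens1 densf).
  exact: (measurable_transition densf).
have rho0 v x t : (0 <= rho v x t)%R.
  by apply: treerho_ge0 => *; [exact: (mdens1_ge0 densf)|exact: (transition_ge0 densf)].
rewrite (integral_lebvec (cst 0%R) perm_s); last 2 first.
- by apply: emeasurable_funM => //; apply/measurable_EFinP; exact: measurable_weight.
- by move=> x; rewrite mule_ge0// lee_fin weight_ge0.
have uus := order_uniq perm_s.
rewrite -(@chain _ _ _ _ P (fun v => X v : Omega -> R) (cst 0%R) rho)//; last first.
  case=> [|u' p] v q /= [].
    move=> <- _; split=> [x y _|B B' _ mB']; first by rewrite /rho /treerho eqxx.
    rewrite (_ : [set w | _] = setT); last by apply/seteqP; split.
    rewrite setTI /rho /treerho eqxx (integral_probability_cst P).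
    transitivity (\int[P]_w (\1_B' (X u w))%:E).
      by rewrite -[X in P X]setIT -integral_indic//; exact: measurable_funPTI.
    rewrite (@marginal_law _ _ _ _ _ _ _ densf u (fun s => (\1_B' s)%:E)).
    - by rewrite -integral_setI_indic setTI.
    - by apply/measurable_EFinP; exact: measurable_indic.
    - by move=> t; rewrite lee_fin indicE.
  move=> <- spq; have [vu pp pq vp _] := order_parent perm_s att spq.
  have [_ pE sep _ _] := att spq.
  split=> [x y xy|B B' mB mB'].
    by rewrite /rho /treerho (negbTE vu); apply/funext => t; rewrite xy.
  rewrite (_ : [set w | _] = [set w | forall i, i \in [set x in u :: p]%SET -> B i (X i w)]); last first.
    by apply/seteqP; split=> w H i; have := H i; rewrite inE.
  rewrite (@markov_box _ _ _ _ _ _ _ densf E markovX _ (parent v))//; last 2 first.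
  - by rewrite inE.
  - by rewrite inE.
  apply: eq_integral => w _; rewrite /rho /treerho (negbTE vu) /partvec.
  by rewrite pp.
apply: eq_integral => w _; congr F; apply/funext => v.
by rewrite /partvec (perm_mem perm_s) mem_enum.
Qed.

End TreeLaw.

(** * The limit density *)

Section IterintSet.
Context (R : realType) (V : finType).
Local Notation T := (rvec R V).
Local Open Scope ereal_scope.

Lemma measurable_set_coord_fun v (h : T -> R) : measurable_fun setT h ->
  measurable_fun setT (fun y : T => set_coord y v (h y)).
Proof.
move=> mh; apply: measurable_to_rvec => w; rewrite /set_coord.
by case: (w == v) => //; exact: measurable_coord.
Qed.

(** Neither coordinate v nor anything read by [h] is integrated, so the overwriting may take place
    before the integration. *)
Lemma iterint_set_coord s v (h : T -> R) (G : T -> \bar R) x : v \notin s ->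
  measurable_fun setT h -> measurable_fun setT G -> (forall y, 0 <= G y) ->
  (forall y z, (forall i, i \notin s -> y i = z i) -> h y = h z) ->
  iterint s (fun y => G (set_coord y v (h y))) x = iterint s G (set_coord x v (h x)).
Proof.
move=> + mh mG G0; have mGs := measurableT_comp mG (measurable_set_coord_fun v mh).
elim: s x => [|w s IH] x vs hs; first by rewrite !iterint_nil.
rewrite !iterint_cons//; apply: eq_integral => t _.
move: vs; rewrite inE negb_or => /andP[vw vs].
rewrite IH//; last by move=> y z yz; apply: hs => i; rewrite inE negb_or => /andP[_]; exact: yz.
congr (iterint s G _); rewrite (hs (set_coord x w t) x); last first.
  by move=> i; rewrite inE negb_or /set_coord => /andP[/negbTE ->].
apply/funext => i; rewrite /set_coord.
by case: eqP => // ->; rewrite (negbTE vw).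
Qed.

End IterintSet.

Section LimitKernel.
Context (R : realType) (V : finType) (E : {set V * V}) (q : V -> V -> R -> R).
Hypothesis pdfq : forall a b, (a, b) \in E -> pdf_pos (q a b).
Local Notation mu := (@lebesgue_measure R).
Local Notation T := (rvec R V).
Local Open Scope ereal_scope.

Definition qpos a b (t : R) : R := if ((a, b) \in E) && (0 < t)%R then q a b t else 0%R.

(** For x > 0, the density of x M when M has density q; it is the limit of the rescaled transition
    from tx. *)
Definition klim a b (x t : R) : R := if (0 < x)%R then (qpos a b (t / x) / x)%R else 0%R.

Lemma qpos_ge0 a b t : (0 <= qpos a b t)%R.
Proof. by rewrite /qpos; case: ifP => // /andP[/pdfq[_ q0 _] t0]; exact: q0. Qed.

Lemma qpos_restrict a b : (a, b) \in E -> qpos a b = (q a b \_ `]0%R, +oo[).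
Proof.
by move=> ab; apply/funext => t; rewrite /qpos ab patchE mem_setE in_itv/= andbT.
Qed.

Lemma measurable_qpos a b : measurable_fun setT (qpos a b : measurableTypeR R -> R).
Proof.
have [ab|ab] := boolP ((a, b) \in E); last first.
  by rewrite (_ : qpos a b = cst 0%R)//; apply/funext => t; rewrite /qpos (negbTE ab).
rewrite qpos_restrict//; apply/(measurable_restrictT _ _).1 => //.
by have [] := pdfq ab.
Qed.

Lemma integral_qposI a b (A : set R) : (a, b) \in E ->
  \int[mu]_(t in A) (qpos a b t)%:E = \int[mu]_(t in A `&` `]0%R, +oo[) (q a b t)%:E.
Proof.
move=> ab; rewrite integral_mkcondr; apply: eq_integral => t _.
by rewrite qpos_restrict// !patchE; case: ifP.
Qed.

Lemma integral_qpos a b : (a, b) \in E -> \int[mu]_t (qpos a b t)%:E = 1.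
Proof. by move=> ab; rewrite integral_qposI// setTI; have [] := pdfq ab. Qed.

Lemma klim_ge0 a b x t : (0 <= klim a b x t)%R.
Proof. by rewrite /klim; case: ifP => // x0; rewrite divr_ge0 ?qpos_ge0// ltW. Qed.

Lemma klim_nonpos a b x t : (t <= 0)%R -> klim a b x t = 0%R.
Proof.
move=> t0; rewrite /klim; case: ifP => // x0; rewrite /qpos ifF ?mul0r//.
by apply/negP => /andP[_]; rewrite pmulr_lgt0 ?invr_gt0// ltNge t0.
Qed.

Lemma measurable_klim a b :
  measurable_fun setT (fun z : measurableTypeR R * measurableTypeR R => klim a b z.1 z.2).
Proof.
rewrite (_ : (fun z => _) = (fun z : measurableTypeR R * measurableTypeR R =>
  if (0 < z.1)%R then (qpos a b (z.2 * z.1 `^ (- 1)) * z.1 `^ (- 1))%R else 0%R)); last first.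
  by apply/funext => z; rewrite /klim; case: ifP => // z0; rewrite powR_inv1// ltW.
have minv : measurable_fun setT
    (fun z : measurableTypeR R * measurableTypeR R => z.1 `^ (- 1) : R)%R.
  exact: (measurableT_comp (measurable_powR _) measurable_fst).
apply: measurable_fun_ifT => //.
  by apply: measurable_fun_ltr => //.
apply: measurable_funM => //.
apply: (measurableT_comp (measurable_qpos a b)).
by apply: measurable_funM => //; exact: measurable_snd.
Qed.

Lemma integral_klim_scale a b (x : R) (G : R -> \bar R) : (0 < x)%R ->
  measurable_fun setT (G : measurableTypeR R -> \bar R) -> (forall t, 0 <= G t) ->
  \int[mu]_t ((klim a b x t)%:E * G t) = \int[mu]_t ((qpos a b t)%:E * G (x * t)%R).
Proof.
move=> x0 mG G0; rewrite (ge0_integral_scale x0); last 2 first.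
- apply: emeasurable_funM => //; apply/measurable_EFinP.
  exact: (measurableT_comp (measurable_klim a b) (pair1_measurable x)).
- by move=> t; rewrite mule_ge0// lee_fin klim_ge0.
apply: eq_integral => t _; rewrite muleA -EFinM /klim x0 mulrC.
by rewrite [(x * t)%R]mulrC mulfK ?gt_eqF// divfK ?gt_eqF.
Qed.

Variables (u : V) (parent : V -> V) (s : seq V).
Hypothesis perm_s : perm_eq (u :: s) (enum V).
Hypothesis att : forall p v q, s = p ++ v :: q -> attached E u p v (parent v).
Variable r : R -> R.
Hypothesis mr : measurable_fun setT (r : measurableTypeR R -> R).
Hypothesis r0 : forall t, (0 <= r t)%R.

(** The left fold visits parents before children: when v is reached its parent already holds a
    cumulated product, so increments become values along the tree. *)
Definition treemul (p : seq V) (x : T) : T :=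
  foldl (fun x v => set_coord x v (x (parent v) * x v)%R) x p.

Lemma measurable_treemul p : measurable_fun setT (treemul p).
Proof.
elim: p => [|v p IH]; first exact: measurable_id.
apply: (measurableT_comp IH).
by apply: measurable_set_coord_fun; apply: measurable_funM; exact: measurable_coord.
Qed.

Local Notation rhoN := (treerho u parent r (fun a b _ t => qpos a b t)).
Local Notation rhoL := (treerho u parent r klim).

Lemma measurable_rhoN v :
  measurable_fun setT (fun z : T * measurableTypeR R => rhoN v z.1 z.2).
Proof.
apply: measurable_treerho => // a b.
exact: (measurableT_comp (measurable_qpos a b) measurable_snd).
Qed.

Lemma rhoN_ge0 v x t : (0 <= rhoN v x t)%R.
Proof. by apply: treerho_ge0 => // *; exact: qpos_ge0. Qed.

Lemma measurable_rhoL v :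
  measurable_fun setT (fun z : T * measurableTypeR R => rhoL v z.1 z.2).
Proof. by apply: measurable_treerho => // a b; exact: measurable_klim. Qed.

Lemma rhoL_ge0 v x t : (0 <= rhoL v x t)%R.
Proof. by apply: treerho_ge0 => // *; exact: klim_ge0. Qed.

Let mwN p : measurable_fun setT (fun x => (weight rhoN p x)%:E).
Proof. by apply/measurable_EFinP; apply: measurable_weight; exact: measurable_rhoN. Qed.
Let mwL p : measurable_fun setT (fun x => (weight rhoL p x)%:E).
Proof. by apply/measurable_EFinP; apply: measurable_weight; exact: measurable_rhoL. Qed.
Let wN0 p x : 0 <= (weight rhoN p x)%:E.
Proof. by rewrite lee_fin; apply: weight_ge0; exact: rhoN_ge0. Qed.
Let wL0 p x : 0 <= (weight rhoL p x)%:E.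
Proof. by rewrite lee_fin; apply: weight_ge0; exact: rhoL_ge0. Qed.

(* Substituting [x_v = x_(parent v) * m_v] in the order in which the nodes are
   attached turns the density of the increments into that of the limit. *)
Lemma tree_change p p' (F : T -> \bar R) x : s = p ++ p' ->
  measurable_fun setT F -> (forall y, 0 <= F y) ->
  (forall i, i \in u :: p -> (0 < x i)%R) ->
  iterint p' (fun y => (weight rhoN p' y)%:E * F (treemul p' y)) x =
  iterint p' (fun y => (weight rhoL p' y)%:E * F y) x.
Proof.
move=> + mF F0; elim: p' p x => [|v p' IH] p x spq xpos.
  have mFt := measurableT_comp mF (measurable_treemul [::]).
  rewrite !iterint_nil//.
  - by rewrite /weight !big_nil.
  - exact: emeasurable_funM.
  - exact: emeasurable_funM.
have mFt p0 := measurableT_comp mF (measurable_treemul p0).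
have mN p0 : measurable_fun setT (fun y => (weight rhoN p0 y)%:E * F (treemul p0 y)).
  exact: (emeasurable_funM (mwN p0) (mFt p0)).
have mL p0 : measurable_fun setT (fun y => (weight rhoL p0 y)%:E * F y).
  exact: emeasurable_funM.
have N0 p0 y : 0 <= (weight rhoN p0 y)%:E * F (treemul p0 y) by exact: mule_ge0.
have L0 p0 y : 0 <= (weight rhoL p0 y)%:E * F y by exact: mule_ge0.
have [vu pp pq vp vp'] := order_parent perm_s att spq.
have [pv pvp'] : parent v != v /\ parent v \notin p'.
  by move: pq; rewrite inE negb_or => /andP.
rewrite !iterint_cons//.
pose J y := iterint p' (fun y => (weight rhoN p' y)%:E * F (treemul p' y)) y.
transitivity (\int[mu]_t ((qpos (parent v) v t)%:E * J (set_coord x v (x (parent v) * t)%R))).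
  apply: eq_integral => t _.
  transitivity (iterint p' (fun y => (qpos (parent v) v (y v))%:E *
      ((weight rhoN p' y)%:E * F (treemul (v :: p') y))) (set_coord x v t)).
    apply: eq_iterint => y; by rewrite weight_cons EFinM -muleA treerho_neq.
  rewrite (iterint_mull (c := fun y : T => qpos (parent v) v (y v))); last 5 first.
  - exact: (emeasurable_funM (mwN p') (mFt (v :: p'))).
  - by move=> y; exact: mule_ge0.
  - exact: (measurableT_comp (measurable_qpos _ _) (measurable_coord v)).
  - by move=> y; exact: qpos_ge0.
  - by move=> y z yz; rewrite yz.
  rewrite {1}/set_coord eqxx; congr (_ * _); rewrite /J.
  transitivity (iterint p' (fun y =>
      (fun y => (weight rhoN p' y)%:E * F (treemul p' y))
        (set_coord y v (y (parent v) * y v)%R)) (set_coord x v t)).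
    (* The weight of the increments of later nodes reads those nodes' own coordinates, none of which
       is v; overwriting coordinate v leaves it unchanged. *)
    apply: eq_iterint => y; congr ((_)%:E * _); apply: eq_big_seq => i ip.
    have iv : (i == v) = false by apply/negbTE; apply: contraNneq vp' => <-.
    by rewrite /treerho /set_coord iv.
  have mh : measurable_fun setT (fun y : T => (y (parent v) * y v)%R).
    by apply: measurable_funM; exact: measurable_coord.
  rewrite (@iterint_set_coord _ _ p' v (fun y : T => (y (parent v) * y v)%R)
    (fun y => (weight rhoN p' y)%:E * F (treemul p' y)))//; last first.
    by move=> y z yz; rewrite !yz.
  congr (iterint p' _ _); apply/funext => i; rewrite /set_coord eqxx (negbTE pv).
  by case: eqP.
have xp : (0 < x (parent v))%R by exact: xpos.
have mJ : measurable_fun setT (fun t : measurableTypeR R => J (set_coord x v t)).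
  exact: measurable_iterint1.
rewrite -(integral_klim_scale (parent v) v xp mJ); last first.
  by move=> t; exact: iterint_ge0.
apply: eq_integral => t _.
rewrite (_ : (fun y => _) = (fun y => (klim (parent v) v (y (parent v)) (y v))%:E *
    ((weight rhoL p' y)%:E * F y))); last first.
  apply/funext => y; by rewrite weight_cons EFinM -muleA treerho_neq.
rewrite iterint_mull//; last 3 first.
- have mg : measurable_fun setT (fun y : T =>
    (y (parent v), y v) : measurableTypeR R * measurableTypeR R).
    by apply/measurable_fun_pairP; split; exact: measurable_coord.
  exact: (measurableT_comp (measurable_klim (parent v) v) mg).
- by move=> y; exact: klim_ge0.
- by move=> y z yz; rewrite !yz.
have -> : set_coord x v t (parent v) = x (parent v) by rewrite /set_coord (negbTE pv).
have -> : set_coord x v t v = t by rewrite /set_coord eqxx.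
(* The induction requires the values already assigned to be positive; for t <= 0 the kernel is zero
   and both sides vanish. *)
have [t0|t0] := leP t 0%R; first by rewrite klim_nonpos// !mul0e.
congr (_ * _); apply: (IH (rcons p v)); first by rewrite cat_rcons.
move=> i; rewrite -rcons_cons mem_rcons inE /set_coord.
by case: eqP => //= _; exact: xpos.
Qed.

Lemma mass_rhoN p p' x : s = p ++ p' ->
  iterint p' (fun y => (weight rhoN p' y)%:E) x = 1.
Proof.
elim: p' p x => [|v p' IH] p x spq.
  by rewrite iterint_nil// /weight big_nil.
have [vu pp pq vp vp'] := order_parent perm_s att spq.
have [_ pE _ _ _] := att spq.
rewrite iterint_cons// -(integral_qpos pE); apply: eq_integral => t _.
transitivity (iterint p' (fun y => (qpos (parent v) v (y v))%:E * (weight rhoN p' y)%:E)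
    (set_coord x v t)).
  by apply: eq_iterint => y; rewrite weight_cons EFinM treerho_neq.
rewrite (iterint_mull (c := fun y : T => qpos (parent v) v (y v)))//.
- by rewrite (IH (rcons p v)) ?cat_rcons// mule1 /set_coord eqxx.
- exact: (measurableT_comp (measurable_qpos _ _) (measurable_coord v)).
- by move=> y; exact: qpos_ge0.
- by move=> y z yz; rewrite yz.
Qed.

(** The root is integrated last. The inner integral overwrites every other coordinate, so the
    constant vector z can stand for a vector with root value z. *)
Lemma integral_weight_root (F : T -> \bar R) : measurable_fun setT F -> (forall y, 0 <= F y) ->
  \int[lebvec R V]_x ((weight rhoL (u :: s) x)%:E * F x) =
  \int[mu]_z ((r z)%:E * iterint s (fun y => (weight rhoL s y)%:E * F y) (cst z)).
Proof.
move=> mF F0; rewrite (integral_lebvec (cst 0%R) perm_s); last 2 first.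
- exact: emeasurable_funM.
- by move=> x; exact: mule_ge0.
have mw : measurable_fun setT (fun y => (weight rhoL s y)%:E * F y) by exact: emeasurable_funM.
have mw' : measurable_fun setT (fun y => (weight rhoL (u :: s) y)%:E * F y) by exact: emeasurable_funM.
have /= /andP[us _] := order_uniq perm_s.
have sV i : i \notin s -> i = u.
  have : i \in u :: s by rewrite (perm_mem perm_s) mem_enum.
  by rewrite inE => /orP[/eqP//|->].
rewrite iterint_cons//; last by move=> x; exact: mule_ge0.
apply: eq_integral => z _.
transitivity (iterint s (fun y => (r (y u))%:E * ((weight rhoL s y)%:E * F y)) (set_coord (cst 0%R) u z)).
  by apply: eq_iterint => y; rewrite weight_cons EFinM -muleA {1}/treerho eqxx.
rewrite (iterint_mull (c := fun y : T => r (y u)))//.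
- rewrite {1}/set_coord eqxx; congr (_ * _); apply: iterint_agree => // [y|v /sV ->].
    exact: mule_ge0.
  by rewrite /set_coord eqxx.
- by move=> x; exact: mule_ge0.
- exact: (measurableT_comp mr (measurable_coord u)).
- by move=> y z' yz; rewrite yz.
Qed.

End LimitKernel.

(** * The spectral vector Theta *)

Section ThetaLaw.
Context (R : realType) (V : finType) (E : {set V * V}) (q : V -> V -> R -> R).
Hypothesis pdfq : forall a b, (a, b) \in E -> pdf_pos (q a b).
Local Notation mu := (@lebesgue_measure R).
Local Notation T := (rvec R V).
Local Open Scope ereal_scope.
Variables (u : V) (parent : V -> V) (s : seq V).
Hypothesis treeE : undirected_tree E.
Hypothesis perm_s : perm_eq (u :: s) (enum V).
Hypothesis att : forall p v q, s = p ++ v :: q -> attached E u p v (parent v).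
Context d (Omega : measurableType d) (P : probability Omega R)
  (M : V * V -> {RV P >-> R}).
Hypothesis M_law : forall e, e \in E -> forall A : set R, measurable A ->
  P (M e @^-1` A) = \int[mu]_(t in A) (qpos E q e.1 e.2 t)%:E.
Hypothesis indepM : independent_on E M.

Let Y v := M (parent v, v) : Omega -> R.

(** Induction along the attachment order: the path to v is the path to its parent plus one new edge,
    which is exactly one multiplication in the fold. *)
Lemma treemul_Theta (z : R) w :
  treemul parent s (partvec Y (cst z) s w) = (fun v => z * Theta E M u w v)%R.
Proof.
set x := partvec _ _ _ _.
have us : u \notin s by have /= /andP[] := order_uniq perm_s.
have H p p' : s = p ++ p' -> forall v, treemul parent p x v =
    if v \in u :: p then (z * Theta E M u w v)%R else x v.
  elim/last_ind: p p' => [|p a IH] p' spq v.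
    rewrite /= inE; case: eqP => // ->.
    by rewrite /Theta tree_path_refl// big_set0 mulr1 /x /partvec (negbTE us).
  move: spq; rewrite cat_rcons => spq.
  have [au pp pq ap ap'] := order_parent perm_s att spq.
  have [_ aE _ tE tN] := att spq.
  rewrite /treemul foldl_rcons -/(treemul parent p x) /set_coord -rcons_cons mem_rcons inE.
  case: eqP => [->|_] /=; last exact: (IH _ spq).
  rewrite !(IH _ spq) pp (negbTE ap) /x /partvec spq mem_cat inE eqxx orbT /Y.
  by rewrite -mulrA /Theta tE big_setU1//= [(M _ w * _)%R]mulrC.
apply/funext => v; rewrite (H s [::]) ?cats0//.
by rewrite (perm_mem perm_s) mem_enum.
Qed.

(** Independence of the edge variables, read through the nodes: each non-root node carries the
    increment on the edge from its parent. *)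
Lemma independent_box p v q' (B : V -> set R) (B' : set R) : s = p ++ v :: q' ->
  (forall i, measurable (B i)) -> measurable B' ->
  P ([set w | forall i, i \in p -> B i (Y i w)] `&` Y v @^-1` B') =
  P [set w | forall i, i \in p -> B i (Y i w)] * P (Y v @^-1` B').
Proof.
move=> spq mB mB'; have [vu pp pq vp vp'] := order_parent perm_s att spq.
(* An edge used here is determined by its second node, so the sets are indexed by that node, with
   [B'] assigned to v. *)
pose Bf (e : V * V) := if e.2 == v then B' else B e.2.
pose J : {set V * V} := [set e | (e.2 \in p) && (e.1 == parent e.2)]%SET.
have JE : J \subset E.
  apply/fintype.subsetP => -[a b]; rewrite inE/= => /andP[bp /eqP ->].
  have [p1 [p2 pE]] : exists p1 p2, p = p1 ++ b :: p2.
    by exists (take (index b p) p), (drop (index b p).+1 p); rewrite -drop_index// cat_take_drop.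
  have [] // := @att p1 b (p2 ++ v :: q').
  by rewrite spq pE -catA.
have vE : (parent v, v) \in E by have [] := att spq.
have vJ : (parent v, v) \notin J.
  by rewrite inE/=; move: vp; rewrite inE negb_or => /andP[_ /negbTE ->].
have mBf e : measurable (Bf e) by rewrite /Bf; case: ifP.
have JB : \bigcap_(e in [set` J]) (M e @^-1` Bf e) =
    [set w | forall i, i \in p -> B i (Y i w)].
  have pv i : i \in p -> (i == v) = false.
    by move=> ip; apply/negbTE; apply: contraNneq vp => <-; rewrite inE ip orbT.
  apply/seteqP; split=> [w H i ip|w H [a i] /=].
    have := H (parent i, i); rewrite /= inE /= ip eqxx /Bf /= (pv _ ip); exact.
  by rewrite inE /= => /andP[ip /eqP ->]; rewrite /Bf /= (pv _ ip); exact: H.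
have vJB : \bigcap_(e in [set` ((parent v, v) |: J)%SET]) (M e @^-1` Bf e) =
    [set w | forall i, i \in p -> B i (Y i w)] `&` Y v @^-1` B'.
  rewrite -JB; apply/seteqP; split=> [w H|w [H1 H2] e /=].
    split=> [e eJ|]; first by apply: H; rewrite /= !inE; apply/orP; right; move: eJ; rewrite /= inE.
    by have := H (parent v, v); rewrite /= setU11 /Bf /= eqxx; exact.
  by rewrite in_setU1 => /orP[/eqP ->|eJ]; [rewrite /Bf /= eqxx|exact: H1].
rewrite -vJB indepM//; last by rewrite finset.subUset finset.sub1set vE JE.
by rewrite big_setU1//= -indepM// JB muleC {1}/Bf /= eqxx.
Qed.

Variables (alpha cu : R).
Hypotheses (alpha0 : (0 < alpha)%R) (cu0 : (0 < cu)%R).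

Definition rlim (z : R) : R := if (0 < z)%R then (cu * (alpha * z `^ (- alpha - 1)))%R else 0%R.

Lemma rlim_ge0 z : (0 <= rlim z)%R.
Proof. by rewrite /rlim; case: ifP => // _; rewrite !mulr_ge0 ?powR_ge0 ?ltW. Qed.

Lemma measurable_rlim : measurable_fun setT (rlim : measurableTypeR R -> R).
Proof.
apply: measurable_fun_ifT => //; last first.
  by do 2 apply: measurable_funM => //; exact: measurable_powR.
by apply: measurable_fun_ltr.
Qed.

Local Notation limweight := (weight (treerho u parent rlim (klim E q))).

(** The increments form a chain whose conditional densities ignore the past; multiplying them along
    the tree from root value z and changing variables by [tree_change] yields the limit kernels. *)
Lemma Theta_law (h : T -> \bar R) (z : R) : measurable_fun setT h ->
  (forall x, 0 <= h x) -> (0 < z)%R ->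
  \int[P]_w h (fun v => z * Theta E M u w v)%R =
  iterint s (fun x => (limweight s x)%:E * h x) (cst z).
Proof.
move=> mh h0 z0.
rewrite -(tree_change pdfq perm_s att measurable_rlim rlim_ge0 (p := [::]))//; last first.
have mht := measurableT_comp mh (measurable_treemul parent s).
have := @chain _ _ _ _ P Y (cst z) (treerho u parent rlim (fun a b _ t => qpos E q a b t))
  _ (measurable_rhoN pdfq u parent measurable_rlim) (rhoN_ge0 pdfq u parent rlim_ge0) s _ _ mht.
move=> <-//.
- by apply: eq_integral => w _; rewrite /= treemul_Theta.
- by have /= /andP[] := order_uniq perm_s.
- by move=> x; exact: h0.
move=> p v q' spq; have [vu _ _ _ _] := order_parent perm_s att spq.
have [_ aE _ _ _] := att spq.
split=> [x y _|B B' mB mB']; first by rewrite /treerho (negbTE vu).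
rewrite (independent_box spq)// M_law//= muleC.
transitivity (\int[P]_(w in [set w | forall i, i \in p -> B i (Y i w)])
    \int[mu]_(t in B') (qpos E q (parent v) v t)%:E).
  rewrite integral_cst//.
  rewrite (_ : [set w | _] = \bigcap_(i in [set` p]) (Y i @^-1` B i))//.
  by apply: fin_bigcap_measurable => // i _; exact: measurable_funPTI.
by apply: eq_integral => w _; apply: eq_integral => t _; rewrite treerho_neq.
Qed.

Lemma measurable_Theta v : measurable_fun setT (fun w => Theta E M u w v).
Proof.
rewrite /Theta; under eq_fun do rewrite -big_enum.
by apply: measurable_prod => e _; exact: measurable_funPT.
Qed.

(** Since Theta_(u,u) = 1, the root coordinate is the radius z and carries the density c_u alpha
    z^(-alpha-1). [Theta_law] treats the other coordinates at fixed z, and Tonelli exchanges z with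
    the expectation. *)
Lemma Theta_polar (h : T -> \bar R) : measurable_fun setT h -> (forall x, 0 <= h x) ->
  \int[lebvec R V]_x ((limweight (u :: s) x)%:E * h x) =
  cu%:E * \int[P]_w \int[mu]_(z in `]0%R, +oo[)
     (h (fun v => z * Theta E M u w v)%R * (alpha * z `^ (- alpha - 1))%:E).
Proof.
move=> mh h0; rewrite (integral_weight_root pdfq parent perm_s measurable_rlim rlim_ge0)//.
pose k z : R := if (0 < z)%R then (alpha * z `^ (- alpha - 1))%R else 0%R.
have k0 z : (0 <= k z)%R.
  by rewrite /k; case: ifP => // _; rewrite mulr_ge0 ?powR_ge0 ?ltW.
have mk : measurable_fun setT (k : measurableTypeR R -> R).
  apply: measurable_fun_ifT => //; last first.
    by apply: measurable_funM => //; exact: measurable_powR.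
  by apply: measurable_fun_ltr.
pose H (z : Omega * measurableTypeR R) :=
  h (fun v => z.2 * Theta E M u z.1 v)%R * (k z.2)%:E.
have mH : measurable_fun setT H.
  apply: emeasurable_funM; last first.
    by apply/measurable_EFinP; exact: (measurableT_comp mk measurable_snd).
  apply: (measurableT_comp mh); apply: measurable_to_rvec => v.
  apply: measurable_funM; first exact: measurable_snd.
  exact: (measurableT_comp (measurable_Theta v) measurable_fst).
have H0 z : 0 <= H z by rewrite mule_ge0// lee_fin.
transitivity (cu%:E * \int[P]_w \int[mu]_z H (w, z)).
  rewrite (fubini_tonelli H mH H0) -ge0_integralZl//; last 3 first.
  - exact: (measurable_fun_fubini_tonelli_G H mH H0).
  - by move=> z _; apply: integral_ge0 => w _; exact: H0.
  - by rewrite lee_fin ltW.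
  apply: eq_integral => z _; rewrite /H /rlim /k /=; case: ifP => z0; last first.
    by rewrite mul0e integral0_eq ?mule0// => w _; rewrite mule0.
  rewrite -Theta_law// ge0_integralZr//; last 2 first.
  - apply: (measurableT_comp mh); apply: measurable_to_rvec => v.
    by apply: measurable_funM => //; exact: measurable_Theta.
  - by rewrite lee_fin mulr_ge0 ?powR_ge0 ?ltW.
  by rewrite EFinM -muleA (muleC (_ * _)%:E).
apply: (congr1 (fun I => cu%:E * I)); apply: eq_integral => w _.
rewrite [RHS]integral_mkcond; apply: eq_integral => z _.
rewrite patchE mem_setE in_itv/= andbT /H /k /=.
by case: ifP => //; rewrite mule0.
Qed.

End ThetaLaw.

(** * Convergence on a half-space *)

Section WeightFacts.
Context (R : realType) (V : finType).
Local Notation T := (rvec R V).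

Lemma weight_eq0 (rho : V -> T -> R -> R) s v x : v \in s -> rho v x (x v) = 0 ->
  weight rho s x = 0.
Proof.
move=> vs r0; apply/eqP; rewrite prodf_seq_eq0; apply/hasP; exists v => //=.
by rewrite r0.
Qed.

Lemma cvg_weight (rho : R -> V -> T -> R -> R) (rho' : V -> T -> R -> R) s x :
  (forall v, v \in s -> rho t v x (x v) @[t --> +oo] --> rho' v x (x v)) ->
  weight (rho t) s x @[t --> +oo] --> weight rho' s x.
Proof.
elim: s => [|v s IH] H.
  by rewrite /weight big_nil; under eq_fun do rewrite big_nil; exact: cvg_cst.
rewrite weight_cons; under eq_fun do rewrite weight_cons.
apply: cvgM; first by apply: H; rewrite inE eqxx.
by apply: IH => w ws; apply: H; rewrite inE ws orbT.
Qed.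

End WeightFacts.

Lemma measurable_coord_gt (R : realType) (V : finType) (v : V) (e : R) :
  measurable [set x : rvec R V | e < x v].
Proof.
rewrite (_ : [set x | _] = (fun x : rvec R V => x v) @^-1` `]e, +oo[%classic).
  by rewrite -[X in measurable X]setTI; exact: measurable_coord.
by apply/seteqP; split=> x /=; rewrite in_itv/= andbT.
Qed.

Lemma indic_coord_gt (R : realType) (V : finType) (v : V) (e : R) (x : rvec R V) :
  \1_[set x : rvec R V | (e < x v)%R] x = (e < x v)%R%:R :> R.
Proof. by rewrite indicE; congr (nat_of_bool _)%:R; apply/idP/idP => [/set_mem|/mem_set]. Qed.

Section RootLimit.
Context (R : realType) (V : finType) (E : {set V * V}) (q : V -> V -> R -> R).
Hypothesis noloop : forall a, (a, a) \notin E.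
Hypothesis pdfq : forall a b, (a, b) \in E -> pdf_pos (q a b).
Local Notation mu := (@lebesgue_measure R).
Local Notation T := (rvec R V).
Context d (Omega : measurableType d)
  (P : probability Omega R) (X : V -> {RV P >-> R}) (f : rvec R V -> R).
Hypothesis densf : joint_density X f.
Hypothesis markovX : global_markov X E.
Variables (alpha : R) (g : R -> R) (c : V -> R).
Hypothesis alpha0 : 0 < alpha.
Hypothesis rvg : regularly_varying g (- alpha - 1).
Hypothesis c_gt0 : forall v, 0 < c v.
Hypothesis fg : forall v,
  (marginal1 f v t / (g t)%:E)%E @[t --> +oo] --> (c v)%:E.
Hypothesis fq : forall a b, (a, b) \in E -> forall y : R, 0 < y ->
  (t%:E * marginal2 f a b t (t * y)%R / marginal1 f a t)%E @[t --> +oo]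
    --> (q a b y)%:E.
Variables (u : V) (parent : V -> V) (s : seq V).
Hypothesis perm_s : perm_eq (u :: s) (enum V).
Hypothesis att : forall p v q, s = p ++ v :: q -> attached E u p v (parent v).
Local Notation b := (fun t : R => alpha / (t * g t)).

(** The absolute values make the prelimit densities nonnegative for every real t, as Scheffe's lemma
    asks; for large t they change nothing. *)
Definition rscale t z := `|b t| * `|t| * mdens1 f u (t * z).
Definition kscale t v w x y := `|t| * transition f v w (t * x) (t * y).
Definition hscale t := weight (treerho u parent (rscale t) (kscale t)) (u :: s).
Definition hlim := weight (treerho u parent (rlim alpha (c u)) (klim E q)) (u :: s).

Lemma measurable_hscale t : measurable_fun setT (hscale t).
Proof.
apply: measurable_weight => v; apply: measurable_treerho => [|a a'].
  apply: measurable_funM => //.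
  by apply: (measurableT_comp (measurable_mdens1 densf u)); exact: measurable_funM.
apply: measurable_funM => //.
have mg : measurable_fun setT (fun z : measurableTypeR R * measurableTypeR R =>
    (t * z.1, t * z.2) : measurableTypeR R * measurableTypeR R).
  by apply/measurable_fun_pairP; split; apply: measurable_funM.
exact: (measurableT_comp (measurable_transition densf a a') mg).
Qed.

Lemma hscale_ge0 t x : 0 <= hscale t x.
Proof.
apply: weight_ge0 => v y z; apply: treerho_ge0 => *.
  by rewrite !mulr_ge0// (mdens1_ge0 densf).
by rewrite !mulr_ge0// (transition_ge0 densf).
Qed.

Lemma measurable_hlim : measurable_fun setT hlim.
Proof.
apply: measurable_weight => v; apply: (measurable_rhoL pdfq).
exact: measurable_rlim.
Qed.

Lemma hlim_ge0 x : 0 <= hlim x.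
Proof.
by apply: weight_ge0 => v y z; apply: (rhoL_ge0 pdfq); exact: rlim_ge0.
Qed.

Lemma hlim_nonpos v x : x v <= 0 -> hlim x = 0.
Proof.
move=> xv; apply: (@weight_eq0 _ _ _ _ v); first by rewrite (perm_mem perm_s) mem_enum.
by rewrite /treerho; case: eqP => _; [rewrite /rlim ltNge xv|exact: klim_nonpos].
Qed.

(** Scaling all coordinates by t produces t to the power #|V|, and each factor of the density
    absorbs one power. *)
Lemma hscale_law (F : T -> \bar R) t : measurable_fun setT F -> (forall x, 0 <= F x)%E ->
  0 < t -> 0 < b t ->
  ((b t)%:E * \int[P]_w F (fun v => X v w / t)%R)%E =
  (\int[lebvec R V]_x ((hscale t x)%:E * F x))%E.
Proof.
move=> mF F0 t0 bt0.
pose W := weight (treerho u parent (mdens1 f u) (transition f)) (u :: s).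
have mW : measurable_fun setT W.
  apply: measurable_weight => v; apply: measurable_treerho.
    exact: (measurable_mdens1 densf).
  exact: (measurable_transition densf).
have W0 x : 0 <= W x.
  by apply: weight_ge0 => v y z; apply: treerho_ge0 => *;
    [exact: (mdens1_ge0 densf)|exact: (transition_ge0 densf)].
have mFs := measurableT_comp mF (measurable_scalev (V := V) t^-1).
have E1 : (\int[P]_w F (fun v => X v w / t)%R)%E =
    (\int[lebvec R V]_x ((W x)%:E * F (scalev t^-1 x)))%E.
  rewrite -(tree_law densf markovX perm_s att mFs); last by move=> x; exact: F0.
  by apply: eq_integral => w _; congr F; apply/funext => v; rewrite /scalev mulrC.
have mG : measurable_fun setT (fun x => (W x)%:E * F (scalev t^-1 x))%E.
  by apply: emeasurable_funM => //; exact/measurable_EFinP.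
have G0 x : (0 <= (W x)%:E * F (scalev t^-1 x))%E by rewrite mule_ge0// lee_fin.
have mG' : measurable_fun setT (fun x => (hscale t x)%:E * F x)%E.
  by apply: emeasurable_funM => //; apply/measurable_EFinP; exact: measurable_hscale.
have G0' x : (0 <= (hscale t x)%:E * F x)%E by rewrite mule_ge0// lee_fin hscale_ge0.
rewrite E1 !(integral_lebvec (cst 0%R) perm_s)//.
have -> : cst 0 = scalev t (cst 0) :> T by apply/funext => v; rewrite /scalev mulr0.
rewrite iterint_scale// muleA -EFinM.
have mGs := measurableT_comp mG (measurable_scalev (V := V) t).
rewrite -(iterint_mull (c := cst (b t * t ^+ size (u :: s)))) => //; last 2 first.
- by move=> y; exact: G0.
- by move=> y; rewrite mulr_ge0 ?exprn_ge0 ?ltW.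
have -> : scalev t (cst 0) = cst 0 :> T by apply/funext => v; rewrite /scalev mulr0.
apply: eq_iterint => x; rewrite /= muleA -EFinM; congr (_%:E * _)%E; last first.
  by congr F; apply/funext => v; rewrite /scalev mulKf ?gt_eqF.
have us : u \notin s by have /= /andP[] := order_uniq perm_s.
have Hs p : u \notin p -> weight (treerho u parent (rscale t) (kscale t)) p x =
    t ^+ size p * weight (treerho u parent (mdens1 f u) (transition f)) p (scalev t x).
  elim: p => [|v p IH] vp; first by rewrite /weight !big_nil mulr1.
  move: vp; rewrite inE negb_or eq_sym => /andP[vu up].
  rewrite !weight_cons IH// !treerho_neq// /kscale gtr0_norm// exprS.
  by rewrite /scalev; ring.
have H1 r k y z : treerho u parent r k u y z = r z by rewrite /treerho eqxx.
rewrite /hscale /W !weight_cons Hs// !H1 /rscale !gtr0_norm// exprS.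
by rewrite /scalev; ring.
Qed.

(** If all coordinates are positive the convergence is factor by factor, each transition being
    evaluated along x_parent t. If some coordinate is nonpositive, necessarily not the root, its
    factor is zero both in the limit and for t > 0. *)
Lemma hscale_cvg x : 0 < x u -> hscale t x @[t --> +oo] --> hlim x.
Proof.
move=> xu; have [/forallP xpos|] := boolP [forall v, 0 < x v]; last first.
  rewrite negb_forall => /existsP[v]; rewrite -leNgt => xv.
  rewrite (hlim_nonpos xv); apply: cvg_near_cst; near=> t.
  have t0 : 0 < t by near: t; exact: near_gt0.
  apply: (@weight_eq0 _ _ _ _ v); first by rewrite (perm_mem perm_s) mem_enum.
  have vu : v != u by apply: contraTneq xu => <-; rewrite -leNgt.
  rewrite treerho_neq// /kscale transition_nonpos ?mulr0//.
  by rewrite pmulr_rle0.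
apply: cvg_weight => v; rewrite inE => /orP[/eqP ->|vs].
  rewrite /treerho eqxx /rlim (xpos u).
  have H : alpha * (mdens1 f u (x u * t) / g (x u * t)) * (g (x u * t) / g t) @[t --> +oo]
      --> alpha * c u * x u `^ (- alpha - 1).
    apply: cvgM; last by have [_] := rvg; apply.
    apply: cvgM; first exact: cvg_cst.
    exact: (cvg_pinfty_scale xu (mdens1_g (v := u) densf rvg c_gt0 fg)).
  rewrite mulrA (mulrC (c u)).
  apply: cvg_trans H; apply: near_eq_cvg; near=> t.
  have t0 : 0 < t by near: t; exact: near_gt0.
  have bt0 : 0 < alpha / (t * g t) by near: t; exact: (b_gt0 alpha0 rvg).
  have g0 : 0 < g t by near: t; exact: (near_g_gt0 rvg).
  have gx0 : 0 < g (x u * t) by near: t; exact: (near_pinfty_scale xu (near_g_gt0 rvg)).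
  rewrite /rscale !gtr0_norm// (mulrC t (x u)); field.
  by rewrite !gt_eqF.
have [p1 [p2 spq]] : exists p1 p2, s = p1 ++ v :: p2.
  by exists (take (index v s) s), (drop (index v s).+1 s); rewrite -drop_index// cat_take_drop.
have [vu _ _ _ _] := order_parent perm_s att spq; have [_ aE _ _ _] := att spq.
have av : parent v != v by apply: contraTneq aE => ->; exact: noloop.
under eq_fun do rewrite treerho_neq//.
rewrite treerho_neq// /klim (xpos (parent v)).
have xp := xpos (parent v).
have yp : 0 < x v / x (parent v) by rewrite divr_gt0 ?xpos.
have H : x (parent v) * t * transition f (parent v) v (x (parent v) * t)
    (x (parent v) * t * (x v / x (parent v))) / x (parent v) @[t --> +oo]
    --> q (parent v) v (x v / x (parent v)) / x (parent v).
  apply: cvgM; last exact: cvg_cst.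
  apply: (cvg_pinfty_scale (h := fun t => t * transition f (parent v) v t (t * (x v / x (parent v)))) xp).
  exact: (transition_cvg densf rvg c_gt0 fg av yp (fq aE yp)).
rewrite /qpos aE yp /=.
apply: cvg_trans H; apply: near_eq_cvg; near=> t.
have t0 : 0 < t by near: t; exact: near_gt0.
rewrite /kscale gtr0_norm// (mulrC t (x (parent v))).
have -> : x (parent v) * t * (x v / x (parent v)) = t * x v by field; rewrite gt_eqF.
by field; rewrite gt_eqF.
Unshelve. all: by end_near. Qed.

Local Notation D e := [set x : T | e < x u].

(** The constraint concerns the root only; the remaining nodes integrate to 1 after the substitution
    by increments, leaving the tail of the power law. *)
Lemma hlim_mass e : 0 < e ->
  (\int[lebvec R V]_x ((hlim x)%:E * (\1_(D e) x)%:E))%E = (c u * e `^ (- alpha))%:E.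
Proof.
move=> e0; have mr := measurable_rlim alpha (c u).
have r0 := rlim_ge0 alpha0 (c_gt0 u).
have mD : measurable_fun setT (\1_(D e) : T -> R).
  by apply: measurable_indic; exact: measurable_coord_gt.
rewrite (integral_weight_root pdfq parent perm_s mr r0); last 2 first.
- exact/measurable_EFinP.
- by move=> x; rewrite lee_fin indicE.
have mw : measurable_fun setT (fun y => (weight (treerho u parent (rlim alpha (c u)) (klim E q)) s y)%:E).
  by apply/measurable_EFinP; apply: measurable_weight => v; exact: (measurable_rhoL pdfq).
have w0 y : (0 <= (weight (treerho u parent (rlim alpha (c u)) (klim E q)) s y)%:E)%E.
  by rewrite lee_fin; apply: weight_ge0 => v x t; exact: (rhoL_ge0 pdfq).
have us : u \notin s by have /= /andP[] := order_uniq perm_s.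
transitivity (\int[mu]_(z in `]e, +oo[) (c u * (alpha * z `^ (- alpha - 1)))%:E)%E.
  rewrite [RHS]integral_mkcond; apply: eq_integral => z _.
  transitivity ((rlim alpha (c u) z)%:E * ((\1_(D e) (cst z : T))%:E *
      iterint s (fun y => (weight (treerho u parent (rlim alpha (c u)) (klim E q)) s y)%:E) (cst z)))%E.
    congr (_ * _)%E; rewrite -(iterint_mull (c := \1_(D e)))//.
    - by apply: eq_iterint => y; rewrite muleC.
    - by move=> y y' yy'; rewrite !indic_coord_gt yy'.
  rewrite patchE mem_setE in_itv/= andbT indic_coord_gt /cst.
  case: ifPn => [ez|ez]; last by rewrite mul0e mule0.
  have z0 : 0 < z by exact: lt_trans ez.
  rewrite mul1e /rlim z0.
  have := tree_change pdfq perm_s att mr r0 (p := [::]) (p' := s) (F := cst 1%E) (x := cst z) erefl.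
  rewrite /=; under eq_iterint do rewrite mule1.
  under [X in _ -> _ -> _ -> _ = X]eq_iterint do rewrite mule1.
  rewrite (mass_rhoN pdfq perm_s att mr r0 (p := [::]))// => <-//; first by rewrite mule1.
under eq_integral do rewrite EFinM.
rewrite ge0_integralZl//.
- by rewrite integral_power_tail.
- apply/measurable_EFinP; apply: measurable_funTS.
  by apply: measurable_funM => //; exact: measurable_powR.
- by move=> z _; rewrite lee_fin mulr_ge0 ?powR_ge0// ltW.
- by rewrite lee_fin ltW.
Qed.

Lemma tail_scaled e : 0 < e ->
  ((b t)%:E * P [set w | (e < X u w / t)%R])%E @[t --> +oo] --> (c u * e `^ (- alpha))%:E.
Proof.
move=> e0; have [_ rb] := regularly_varying_b alpha0 rvg.
have /fine_cvgP[H1 H2] := cvg_pinfty_scale e0 (tail_b (u := u) densf alpha0 rvg c_gt0 fg).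
have H3 : fine ((b (e * t))%:E * P [set w | (e * t < X u w)%R])%E * (b (e * t) / b t)^-1
    @[t --> +oo] --> c u * (e `^ alpha)^-1.
  apply: cvgM; first exact: H2.
  by apply: cvgV; [rewrite gt_eqF// powR_gt0|exact: rb].
rewrite -powRN in H3.
have me t : measurable [set w | (e < X u w / t)%R].
  have m1 : measurable_fun setT (fun w => X u w / t).
    by apply: measurable_funM => //; exact: measurable_funPT.
  have := m1 measurableT _ (measurable_itv `]e, +oo[); rewrite setTI.
  by congr measurable; apply/seteqP; split=> w /=; rewrite in_itv/= andbT.
apply/fine_cvgP; split.
  by apply: nearW => t; rewrite fin_numM// fin_num_measure.
apply: cvg_trans H3; apply: near_eq_cvg; near=> t.
have t0 : 0 < t by near: t; exact: near_gt0.
have bt0 : 0 < b t by near: t; exact: (b_gt0 alpha0 rvg).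
have bet0 : 0 < b (e * t) by near: t; exact: (near_pinfty_scale e0 (b_gt0 alpha0 rvg)).
have Et : [set w | (e * t < X u w)%R] = [set w | (e < X u w / t)%R].
  by apply/seteqP; split=> w /=; rewrite ltr_pdivlMr.
rewrite Et /= !fineM ?fin_num_measure//=; move: bt0 bet0.
move: (fine (P _)) (alpha / (t * g t)) (alpha / (e * t * g (e * t))) => p x y x0 y0.
by field; rewrite !gt_eqF.
Unshelve. all: by end_near. Qed.

(** On x_u > e the density converges pointwise by [hscale_cvg], and its mass is b(t) P(X_u / t > e),
    which converges to the mass of the limit by [tail_scaled] and [hlim_mass]; Scheffe's lemma
    applies. *)
Lemma root_limit (phi : T -> R) (C e : R) : 0 < e -> measurable_fun setT phi ->
  (forall x, 0 <= phi x <= C) ->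
  ((b t)%:E * \int[P]_w (phi (fun v => X v w / t) * \1_(D e) (fun v => X v w / t)%R)%:E)%E
    @[t --> +oo] -->
  (\int[lebvec R V]_x ((hlim x)%:E * (phi x * \1_(D e) x)%:E))%E.
Proof.
move=> e0 mphi phiC.
have mD : measurable (D e) by exact: measurable_coord_gt.
have m1 : measurable_fun setT (\1_(D e) : T -> R) by exact: measurable_indic.
pose h := hscale.
have mh t : measurable_fun setT (h t) by exact: measurable_hscale.
have h0 t x : 0 <= h t x by exact: hscale_ge0.
have ml : measurable_fun setT hlim by exact: measurable_hlim.
have l0 x : 0 <= hlim x by exact: hlim_ge0.
have DE (k k' : T -> R) : (\int[lebvec R V]_(x in D e) (k x * k' x)%:E =
    \int[lebvec R V]_x ((k' x)%:E * (k x * \1_(D e) x)%:E))%E.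
  rewrite -[X in (\int[_]_(x in X) _ = _)%E]setTI integral_setI_indic; apply: eq_integral => x _.
  by rewrite -!EFinM; congr EFin; ring.
have DE1 (k : T -> R) : (\int[lebvec R V]_(x in D e) (k x)%:E =
    \int[lebvec R V]_x ((k x)%:E * (\1_(D e) x)%:E))%E.
  rewrite -[X in (\int[_]_(x in X) _ = _)%E]setTI integral_setI_indic; apply: eq_integral => x _.
  by rewrite muleC.
have near_law (F : T -> R) : measurable_fun setT F -> (forall x, 0 <= F x) ->
    \forall t \near +oo, ((b t)%:E * \int[P]_w (F (fun v => X v w / t))%:E)%E =
      (\int[lebvec R V]_x ((h t x)%:E * (F x)%:E))%E.
  move=> mF F0; near=> t.
  have t0 : 0 < t by near: t; exact: near_gt0.
  have bt0 : 0 < b t by near: t; exact: (b_gt0 alpha0 rvg).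
  apply: (hscale_law (F := fun x => (F x)%:E)) => //.
  exact/measurable_EFinP.
have mass : (\int[lebvec R V]_(x in D e) (hlim x)%:E = (c u * e `^ (- alpha))%:E)%E.
  by rewrite DE1 hlim_mass.
have lim : (\int[lebvec R V]_(x in D e) (h t x)%:E)%E @[t --> +oo] -->
    (\int[lebvec R V]_(x in D e) (hlim x)%:E)%E.
  rewrite mass; apply: cvg_trans (tail_scaled e0); apply: near_eq_cvg; near=> t; rewrite DE1.
  have <- : ((b t)%:E * \int[P]_w (\1_(D e) (fun v => X v w / t)%R)%:E)%E =
      (\int[lebvec R V]_x ((h t x)%:E * (\1_(D e) x)%:E))%E.
    by near: t; apply: near_law => // x; rewrite indicE.
  have mX : measurable_fun setT (fun w => (fun v => X v w / t) : T).
    by apply: measurable_to_rvec => v; apply: measurable_funM => //; exact: measurable_funPT.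
  have m2 : measurable [set w | (e < X u w / t)%R].
    by have := mX measurableT _ mD; rewrite setTI.
  by rewrite -[X in P X]setIT -integral_indic.
have := @scheffe_pinfty _ _ _ (lebvec R V) (D e) mD h hlim phi C
  (fun t => measurable_funTS (mh t)) (measurable_funTS ml) (fun t x _ => h0 t x)
  (fun x _ => l0 x) _ _ lim (measurable_funTS mphi) _ _.
rewrite DE mass => H.
have {}H : (\int[lebvec R V]_(x in D e) (phi x * h t x)%:E)%E @[t --> +oo] -->
    (\int[lebvec R V]_x ((hlim x)%:E * (phi x * \1_(D e) x)%:E))%E.
  apply: H.
  - move=> x /= ex; apply: hscale_cvg.
    exact: lt_trans ex.
  - by rewrite ltry.
  - by have /andP[p0 pC] := phiC (cst 0); exact: le_trans pC.
  - by move=> x _; have /andP[p0 pC] := phiC x; rewrite ger0_norm.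
apply: cvg_trans H; apply: near_eq_cvg; near=> t.
rewrite DE; apply/esym; near: t.
apply: (near_law (fun x => phi x * \1_(D e) x)) => [|x]; first exact: measurable_funM.
by have /andP[p0 _] := phiC x; rewrite mulr_ge0// indicE.
Unshelve. all: by end_near. Qed.

End RootLimit.

(** * Gluing the half-spaces *)

Section Gluing.
Context (R : realType) (V : finType) d (Omega : measurableType d)
  (P : probability Omega R) (X : V -> {RV P >-> R}).
Local Notation T := (rvec R V).
Variables (b : R -> R) (N : V -> {measure set T -> \bar R}).
Local Notation D u e := [set x : T | (e < x u)%R].
Local Open Scope ereal_scope.

Definition scaled_mean (phi : T -> R) t :=
  (b t)%:E * \int[P]_w (phi (fun v => X v w / t)%R)%:E.

Hypothesis b_gt0 : \forall t \near +oo%R, (0 < b t)%R.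
Hypothesis Nlim : forall u (phi : T -> R) (C e : R), (0 < e)%R -> measurable_fun setT phi ->
  (forall x, 0 <= phi x <= C)%R ->
  scaled_mean (fun x => phi x * \1_(D u e) x)%R t @[t --> +oo%R] -->
    \int[N u]_x (phi x * \1_(D u e) x)%:E.
Hypothesis Npos : forall u, N u (~` [set x | forall v, (0 < x v)%R]) = 0.
Hypothesis Nfin : forall u (e : R), (0 < e)%R -> N u (D u e) < +oo.

Let mD u e : measurable (D u e). Proof. exact: measurable_coord_gt. Qed.

Let m1D u e : measurable_fun setT (\1_(D u e) : T -> R).
Proof. exact: measurable_indic. Qed.

Let mpos : measurable [set x : T | forall v, (0 < x v)%R].
Proof.
rewrite (_ : [set x : T | _] = \bigcap_(v in setT) D v 0%R); last first.
  by apply/seteqP; split=> [x H v _|x H v]; exact: H.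
by apply: fin_bigcap_measurable => //; exact: finite_finset.
Qed.

(** For sets on which both x_u and x_u' exceed 1/(n+1), the limits seen from u and from u' are
    limits of the same scaled means. These regions increase to the part of the set with positive
    coordinates, and the rest is null for both. *)
Lemma N_root_eq u u' A : measurable A -> N u A = N u' A.
Proof.
move=> mA; pose pos := [set x : T | forall v, (0 < x v)%R].
pose B n := A `&` pos `&` (D u n.+1%:R^-1 `&` D u' n.+1%:R^-1).
have mB n : measurable (B n) by apply: measurableI; apply: measurableI.
have e0 n : (0 < n.+1%:R^-1 :> R)%R by rewrite invr_gt0.
have NB u1 u2 n : N u1 (A `&` pos `&` (D u1 n.+1%:R^-1 `&` D u2 n.+1%:R^-1)) =
    \int[N u1]_x (\1_(A `&` pos `&` D u2 n.+1%:R^-1) x * \1_(D u1 n.+1%:R^-1) x)%:E.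
  rewrite -[X in N _ X]setIT -integral_indic//; last by apply: measurableI; apply: measurableI.
  by apply: eq_integral => x _; rewrite -[RHS]/(((_ \* _) x)%R%:E) -indicI (setIC (D u1 _)) setIA.
have NBE n : N u (B n) = N u' (B n).
  rewrite /B NB (setIC (D u _)) NB.
  have m1 u1 : measurable_fun setT (\1_(A `&` pos `&` D u1 n.+1%:R^-1) : T -> R).
    by apply: measurable_indic; apply: measurableI => //; apply: measurableI.
  have b1 u1 x : (0 <= (\1_(A `&` pos `&` D u1 n.+1%:R^-1) x : R) <= 1)%R.
    by rewrite indicE ler0n lern1 leq_b1.
  have HE : (fun x => \1_(A `&` pos `&` D u' n.+1%:R^-1) x * \1_(D u n.+1%:R^-1) x)%R =
      (fun x => \1_(A `&` pos `&` D u n.+1%:R^-1) x * \1_(D u' n.+1%:R^-1) x)%R :> (T -> R).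
    by apply/funext => x; rewrite !indicI /= mulrAC.
  have H := Nlim (u := u) (e0 n) (m1 u') (b1 u').
  have H' := Nlim (u := u') (e0 n) (m1 u) (b1 u).
  rewrite -HE in H'; exact: (cvg_unique (@ereal_hausdorff R) H H').
have NA u1 : N u1 A = N u1 (A `&` pos).
  apply/eqP; rewrite eq_le; apply/andP; split; last first.
    by apply: le_measure; rewrite ?inE//; apply: measurableI.
  apply: (@le_trans _ _ (N u1 ((A `&` pos) `|` ~` pos))).
    apply: le_measure; rewrite ?inE//.
      by apply: measurableU; [apply: measurableI|apply: measurableC].
    by move=> x Ax; have [xp|xp] := pselect (pos x); [left|right].
  apply: (le_trans (measureU2 _ _ _)); [by apply: measurableI|by apply: measurableC|].
  by rewrite -[leRHS]adde0; apply: leeD => //; have := Npos u1; move=> /eqP; rewrite eq_le => /andP[].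
have BU : A `&` pos = \bigcup_n B n.
  apply/seteqP; split=> [x [Ax xp]|x [n _ [[]]]//].
  have [n nx] : exists n, (n.+1%:R^-1 < Num.min (x u) (x u'))%R.
    have m0 : (0 < Num.min (x u) (x u'))%R by rewrite lt_min !xp.
    by have [n _ Hn] := near_infty_natSinv_lt (PosNum m0); exists n; exact: (Hn n (leqnn n)).
  by exists n => //; split=> //; split=> /=; move: nx; rewrite lt_min => /andP[].
have Bnd : nondecreasing_seq B.
  move=> m n mn; apply/subsetPset => x [xA [xu xu']]; split=> //.
  have h : (n.+1%:R^-1 <= m.+1%:R^-1 :> R)%R by rewrite lef_pV2 ?posrE// ler_nat ltnS.
  by split=> /=; exact: le_lt_trans h _.
have mU : measurable (\bigcup_n B n) by exact: bigcupT_measurable.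
rewrite !NA BU; 
have Nlim1 u1 := cvg_lim (@ereal_hausdorff R) (nondecreasing_cvg_mu (mu := N u1) mB mU Bnd).
have EE : N u \o B = N u' \o B by apply/funext => n; exact: NBE.
exact: etrans (esym (Nlim1 _ u)) (etrans (congr1 (fun h : nat -> \bar R => limn h) EE) (Nlim1 _ u')).
Qed.

Let cnt e (x : T) : R := (\sum_u \1_(D u e) x)%R.

(** The half-spaces x_u > e overlap; dividing by the number of them that contain x makes [phi] a
    finite sum of functions, each living on one half-space, where the limit from that root is
    available. *)
Lemma glue_limit u0 (phi : T -> R) (C e : R) : (0 < e)%R -> measurable_fun setT phi ->
  (forall x, 0 <= phi x <= C)%R ->
  (forall x, phi x != 0%R -> exists u, (e < x u)%R) ->
  scaled_mean phi t @[t --> +oo%R] --> \int[N u0]_x (phi x)%:E /\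
  \int[N u0]_x (phi x)%:E < +oo.
Proof.
move=> e0 mphi phiC phi_supp.
have phi0 x : (0 <= phi x)%R by have /andP[] := phiC x.
have cntE x : cnt e x = #|[pred u | (e < x u)%R]|%:R.
  rewrite /cnt -sum1_card natr_sum [RHS]big_mkcond/=; apply: eq_bigr => u _.
  by rewrite indic_coord_gt inE; case: (e < x u)%R.
have mcnt : measurable_fun setT (cnt e).
  by apply: measurable_sum => u; exact: m1D.
have cnt0 x : (0 <= cnt e x)%R by rewrite cntE.
(* Where no coordinate exceeds e the count is 0 and [phi] vanishes; elsewhere the count is at least
   1, so the bound C is preserved. *)
pose psi x := (phi x * cnt e x `^ (- 1))%R.
have mpsi : measurable_fun setT psi.
  by apply: measurable_funM => //; exact: (measurableT_comp (measurable_powR _) mcnt).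
have psiC x : (0 <= psi x <= C)%R.
  have /andP[p0 pC] := phiC x; rewrite mulr_ge0 ?powR_ge0//=.
  apply: le_trans pC; rewrite ler_piMr// powR_inv1// cntE.
  case: #|_| => [|n]; first by rewrite invr0.
  by rewrite invf_le1 ?ltr0n// ler1n.
have phiE x : phi x = (\sum_u psi x * \1_(D u e) x)%R.
  rewrite -mulr_sumr -/(cnt e x) /psi powR_inv1//.
  have [->|/phi_supp[u ue]] := eqVneq (phi x) 0%R; first by rewrite !mul0r.
  rewrite divfK// cntE pnatr_eq0 -lt0n; apply/card_gt0P; exists u.
  by rewrite inE.
have psi1 u x : (0 <= psi x * \1_(D u e) x)%R.
  by have /andP[p0 _] := psiC x; rewrite mulr_ge0// indicE.
have mpsi1 u : measurable_fun setT (fun x => (psi x * \1_(D u e) x)%:E).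
  by apply/measurable_EFinP; apply: measurable_funM.
have mX t : measurable_fun setT (fun w => (fun v => X v w / t) : T)%R.
  by apply: measurable_to_rvec => v; apply: measurable_funM => //; exact: measurable_funPT.
have intE : \int[N u0]_x (phi x)%:E = \sum_u \int[N u]_x (psi x * \1_(D u e) x)%:E.
  under eq_integral do rewrite phiE -sumEFin.
  transitivity (\sum_u \int[N u0]_x (psi x * \1_(D u e) x)%:E).
    rewrite ge0_integral_sum// => u x _; by rewrite lee_fin.
  by apply: eq_bigr => u _; apply: eq_measure_integral => A mA _; exact: N_root_eq.
split; last first.
  rewrite intE; apply: lte_sum_pinfty => u _.
  apply: (@le_lt_trans _ _ (\int[N u]_x (C%:E * (\1_(D u e) x)%:E))).
    apply: ge0_le_integral => //.
    - by move=> x _; rewrite lee_fin.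
    - by apply/measurable_EFinP; apply: measurable_funM.
    - move=> x _; rewrite lee_fin ler_wpM2r ?indicE//.
      by have /andP[] := psiC x.
  have C0 : (0 <= C)%R by have /andP[p0] := phiC (cst 0%R); exact: le_trans.
  rewrite ge0_integralZl//; last exact/measurable_EFinP.
  by rewrite integral_indic// setIT lte_mul_pinfty// Nfin.
rewrite intE.
have : \sum_u scaled_mean (fun x => psi x * \1_(D u e) x)%R t @[t --> +oo%R] -->
    \sum_u \int[N u]_x (psi x * \1_(D u e) x)%:E.
  apply: cvg_nnesum => u _; last exact: Nlim.
  near=> t; rewrite mule_ge0//.
    by rewrite lee_fin ltW//; near: t; exact: b_gt0.
  by apply: integral_ge0 => w _; rewrite lee_fin.
apply: cvg_trans; apply: near_eq_cvg; near=> t.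
rewrite /scaled_mean -ge0_sume_distrr => [|u _]; last first.
  by apply: integral_ge0 => w _; rewrite lee_fin.
congr (_ * _); rewrite -ge0_integral_sum//; last 2 first.
- by move=> u; exact: (measurableT_comp (mpsi1 u) (mX t)).
- by move=> u w _; rewrite lee_fin.
by apply: eq_integral => w _; rewrite sumEFin phiE.
Unshelve. all: by end_near. Qed.

End Gluing.

(** * Convergence in M0 *)

Section Orthant0.
Context (R : realType) (V : finType).
Local Notation T := (rvec R V).
Local Notation O := (@orthant0 R V).

Lemma orthant0_gt0 (x : T) : O x <-> orthant x /\ exists v, 0 < x v.
Proof.
split=> [[x0 xn]|[x0 [v xv]]]; split=> //.
  apply/not_existsP => H; apply: xn; apply/funext => v; apply/eqP.
  by rewrite eq_le x0 andbT leNgt; apply/negP; exact: H.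
by move=> x0'; move: xv; rewrite x0' ltxx.
Qed.

Lemma measurable_orthant0 : measurable O.
Proof.
rewrite (_ : O = @orthant R V `&` \bigcup_(v in [set: V]) [set x | 0 < x v]).
  apply: measurableI; first exact: measurable_orthant.
  by apply: fin_bigcup_measurable => // v _; exact: measurable_coord_gt.
apply/seteqP; split=> [x /orthant0_gt0[x0 [v xv]]|x [x0 [v _ xv]]].
  by split=> //; exists v.
by apply/orthant0_gt0; split=> //; exists v.
Qed.

(** The preimage of an open interval is the trace on the orthant of an open set of the ambient
    space, hence Borel. *)
Lemma measurable_within (h : T -> R) : {within O, continuous h} -> measurable_fun O h.
Proof.
move=> ch; apply: (measurability _ (RGenOpens.measurableE R)).
move=> _ [_ [a [b ->] <-]].
have oab : open (`]a, b[%classic : set R) by exact: interval_open.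
have /continuousP/(_ _ oab)/open_subspaceP[W oW WE] := ch.
rewrite setIC -WE; apply: measurableI; last exact: measurable_orthant0.
exact: sub_sigma_algebra.
Qed.

Lemma maxcoord_gt (x : T) e : 0 <= e -> e < maxcoord x -> exists u, e < x u.
Proof.
move=> e0 H; apply/not_existsP => nH; move: H; apply/negP; rewrite -leNgt.
by apply: bigmax_le => // v _; rewrite leNgt; apply/negP; exact: nH.
Qed.

End Orthant0.

Section M0Limit.
Context (R : realType) (V : finType) d (Omega : measurableType d)
  (P : probability Omega R) (X : V -> {RV P >-> R}).
Local Notation T := (rvec R V).
Local Notation O := (@orthant0 R V).
Variables (b : R -> R) (nu : {measure set T -> \bar R}).
Hypothesis b_gt0 : \forall t \near +oo, 0 < b t.
Hypothesis nulim : forall (phi : T -> R) (C e : R), 0 < e -> measurable_fun setT phi ->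
  (forall x, 0 <= phi x <= C) -> (forall x, phi x != 0 -> exists u, e < x u) ->
  scaled_mean X b phi t @[t --> +oo] --> (\int[nu]_x (phi x)%:E)%E /\
  (\int[nu]_x (phi x)%:E < +oo)%E.
Hypothesis nu_support : nu (~` O) = 0%E.

Let mO : measurable O. Proof. exact: measurable_orthant0. Qed.

Let mX t : measurable_fun setT (fun w => (fun v => X v w / t) : T).
Proof.
by apply: measurable_to_rvec => v; apply: measurable_funM => //; exact: measurable_funPT.
Qed.

(** A measure is required for every real t, hence |b t|; it is b t for large t. *)
Let m_ t : {measure set T -> \bar R} :=
  mscale (NngNum (normr_ge0 (b t))) (mrestr (mpush P (mX t)) mO).

Let m_E t A : m_ t A = (`|b t|%R%:E * P [set w | (A `&` O) (fun v => X v w / t)%R])%E.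
Proof. by []. Qed.

Let m_support t : m_ t (~` O) = 0%E.
Proof.
rewrite m_E (_ : [set w | _] = set0) ?measure0 ?mule0//.
by apply/seteqP; split=> w //= -[].
Qed.

Let m_finite t B : measurable B ->
  (exists2 e, 0 < e & B `<=` O `&` [set x | e <= maxcoord x]) -> (m_ t B < +oo)%E.
Proof.
move=> mB _; rewrite m_E lte_mul_pinfty ?lee_fin//.
rewrite -ge0_fin_numE// fin_num_measure//.
by have := mX t measurableT (measurableI _ _ mB mO); rewrite setTI.
Qed.

Let nu_finite B : measurable B ->
  (exists2 e, 0 < e & B `<=` O `&` [set x | e <= maxcoord x]) -> (nu B < +oo)%E.
Proof.
move=> mB [e e0 Be].
(* Half of e, since max x >= e is a weak inequality and the support condition in [nulim] is
   strict. *)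
have e20 : 0 < e / 2 by rewrite divr_gt0.
have [] := @nulim (\1_B) 1 (e / 2) e20.
- exact: measurable_indic.
- by move=> x; rewrite indicE ler0n lern1 leq_b1.
- move=> x; rewrite indicE pnatr_eq0 eqb0 negbK => /set_mem /Be[_ /= xe].
  apply: maxcoord_gt; first exact: ltW.
  by apply: lt_le_trans xe; rewrite ltr_pdivrMr// ltr_pMr// ltr1n.
by move=> _; rewrite integral_indic// setIT.
Qed.

Let m t : M0 R V := MkM0 (m_support t) (@m_finite t).
Let nu0 : M0 R V := MkM0 nu_support nu_finite.

Let m_integral t (phi : T -> R) : measurable_fun setT phi -> (forall x, 0 <= phi x) ->
  (forall x, ~ O x -> phi x = 0) ->
  (\int[m t]_x (phi x)%:E)%E = (`|b t|%R%:E * \int[P]_w (phi (fun v => X v w / t)%R)%:E)%E.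
Proof.
move=> mphi phi0 phiO.
have mE : measurable_fun setT (EFin \o phi) by exact/measurable_EFinP.
rewrite -[LHS]/(\int[m_ t]_x (phi x)%:E)%E ge0_integral_mscale//; last first.
  by move=> x _; rewrite lee_fin.
congr (_ * _)%E.
rewrite (@ge0_integral_density _ _ _ (mpush P (mX t)) (mrestr (mpush P (mX t)) mO) \1_O)//.
- rewrite ge0_integral_mpush; last 2 first.
  + apply: emeasurable_funM => //; apply/measurable_EFinP; exact: measurable_indic.
  + by move=> x; rewrite mule_ge0// lee_fin ?indicE.
  apply: eq_integral => w _; set x : T := fun v => _.
  rewrite -EFinM indicE; congr EFin; have [xO|xO] := pselect (O x).
    by rewrite mem_set ?mulr1.
  by rewrite phiO ?mul0r.
- by move=> A mA; rewrite integral_indic// setIC.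
- by move=> x _; rewrite lee_fin.
Qed.

(** The topology is initial for the evaluations, so convergence is tested on one function h at a
    time. Its positive and negative parts, extended by zero, are bounded and supported where some
    coordinate exceeds e, so [nulim] applies to each. *)
Lemma M0_limit : exists (m : R -> M0 R V) (nu' : M0 R V),
  [/\ M0_measure nu' = nu,
    \forall t \near +oo, forall A : set T, measurable A ->
      m t A = ((b t)%:E * P [set w | (A `&` O) (fun v => X v w / t)%R])%E
  & m t @[t --> +oo] --> nu'].
Proof.
exists m, nu0; split=> //.
  near=> t => A mA; have bt : 0 < b t by near: t.
  by rewrite -[LHS]/(m_ t A) m_E gtr0_norm.
apply/cvg_sup => -[h [hc [C hC] [e e0 he]]].
have mh : measurable_fun setT (h \_ O).
  exact: (measurable_restrictT h mO).1 (measurable_within hc).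
have hO x : ~ O x -> (h \_ O) x = 0 by move=> xO; rewrite patchE memNset.
(* Domination by |h| transmits both the bound and the support condition, so both parts of h are
   covered at once. *)
have key (phi : T -> R) : measurable_fun setT phi -> (forall x, 0 <= phi x <= `|(h \_ O) x|) ->
    (\int[m t]_x (phi x)%:E)%E @[t --> +oo] --> (\int[nu]_x (phi x)%:E)%E /\
    (\int[nu]_x (phi x)%:E)%E \is a fin_num.
  move=> mphi phih.
  have phi0 x : 0 <= phi x by have /andP[] := phih x.
  have [||||H1 H2] := @nulim phi `|C| e => //.
  - move=> x; rewrite phi0; have /andP[_ /le_trans] := phih x; apply.
    rewrite patchE; case: ifP => [/set_mem xO|_]; last by rewrite normr0.
    by apply: le_trans (ler_norm _); exact: hC.
  - move=> x phix; have hx : (h \_ O) x != 0.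
      by apply: contra_neq phix => hx; apply/eqP; rewrite eq_le phi0 andbT;
        have /andP[_] := phih x; rewrite hx normr0.
    have xO : O x by apply: contrapT => /hO hx0; rewrite hx0 eqxx in hx.
    apply: maxcoord_gt; first exact: ltW.
    rewrite ltNge; apply/negP => /(he _ xO) hx0.
    by move: hx; rewrite patchE mem_set// hx0 eqxx.
  split; last by rewrite ge0_fin_numE//; apply: integral_ge0 => x _; rewrite lee_fin.
  apply: cvg_trans H1; apply: near_eq_cvg; near=> t.
  have bt : 0 < b t by near: t.
  rewrite m_integral// ?gtr0_norm// => x xO; apply/eqP; rewrite eq_le phi0 andbT.
  by have /andP[_] := phih x; rewrite hO// normr0.
pose hp x := Num.max ((h \_ O) x) 0; pose hn x := Num.max (- (h \_ O) x) 0.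
have mhp : measurable_fun setT hp by exact: measurable_maxr.
have mhn : measurable_fun setT hn by apply: measurable_maxr => //; exact: measurable_funN.
have [p1 p2] : (\int[m t]_x (hp x)%:E)%E @[t --> +oo] --> (\int[nu]_x (hp x)%:E)%E /\
    (\int[nu]_x (hp x)%:E)%E \is a fin_num.
  by apply: key => // x; rewrite /hp le_max lexx orbT ge_max ler_norm normr_ge0.
have [n1 n2] : (\int[m t]_x (hn x)%:E)%E @[t --> +oo] --> (\int[nu]_x (hn x)%:E)%E /\
    (\int[nu]_x (hn x)%:E)%E \is a fin_num.
  by apply: key => // x; rewrite /hn le_max lexx orbT ge_max -normrN ler_norm normr_ge0.
have evalE (n : M0 R V) : M0_eval (exist _ h (And3 hc (ex_intro _ C hC) (ex_intro2 _ _ e e0 he))) n =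
    fine (\int[n]_x (hp x)%:E - \int[n]_x (hn x)%:E)%E.
  rewrite /M0_eval /Rintegral /= integral_mkcond integralE; congr (fine (_ - _)%E).
    apply: eq_integral => x _; rewrite funeposE /hp !patchE.
    by case: ifP => _; rewrite -EFin_max.
  apply: eq_integral => x _; rewrite funenegE /hn !patchE.
  by rewrite EFin_max EFinN; case: ifP.
have evalcvg : M0_eval (exist _ h (And3 hc (ex_intro _ C hC) (ex_intro2 _ _ e e0 he))) (m t)
    @[t --> +oo] --> M0_eval (exist _ h (And3 hc (ex_intro _ C hC) (ex_intro2 _ _ e e0 he))) nu0.
  rewrite evalE; under eq_fun do rewrite evalE.
  apply: fine_cvg; rewrite fineK; last by rewrite fin_numB p2 n2.
  by apply: cvgeB => //; rewrite fin_num_adde_defl// fin_numN.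
move=> A /= [_ [[B Bop <-] Bnu sBA]].
by apply: filterS sBA _; apply: evalcvg; exact: open_nbhs_nbhs.
Unshelve. all: by end_near. Qed.

End M0Limit.

(** * Increments and transition kernels *)

Section BorelCopy.
Context (R : realType).
Local Open Scope ereal_scope.

(* [R] and [measurableTypeR R] carry the same sigma-algebra with different displays. *)
Lemma measurable_copy : measurable_fun setT (fun x : measurableTypeR R => x : R).
Proof. exact: measurable_id. Qed.

Lemma integral_copy (m : {measure set (measurableTypeR R) -> \bar R})
    (nu : {measure set R -> \bar R}) (D : set R) (F : R -> \bar R) :
  (forall A : set R, measurable A -> nu A = m A) -> measurable D -> measurable_fun D F ->
  \int[nu]_(x in D) F x = \int[m]_(x in D) F x.
Proof.
move=> num mD mF.
rewrite (@eq_measure_integral _ _ _ _ (mpush m measurable_copy)); last first.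
  by move=> A mA _; exact: num.
rewrite integralE [RHS]integralE; congr (_ - _);
  (rewrite (ge0_integral_pushforward measurable_copy)//; [
    exact: measurable_funepos || exact: measurable_funeneg]).
Qed.

End BorelCopy.

Section IncrementLaw.
Context (R : realType) (V : finType) (E : {set V * V}) (q : V -> V -> R -> R).
Hypothesis pdfq : forall a b, (a, b) \in E -> pdf_pos (q a b).
Local Notation mu := (@lebesgue_measure R).
Local Open Scope ereal_scope.

(* The value off [E] is irrelevant; it only makes the law a probability. *)
Definition incdens (e : V * V) (t : R) : R :=
  if e \in E then qpos E q e.1 e.2 t else \1_(`]0%R, 1%R]%classic : set R) t.

Lemma incdens_ge0 e t : (0 <= incdens e t)%R.
Proof. by rewrite /incdens; case: ifP => _; [exact: qpos_ge0|rewrite indicE]. Qed.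

Lemma measurable_incdens e : measurable_fun setT (incdens e : measurableTypeR R -> R).
Proof.
have [eE|eE] := boolP (e \in E).
  rewrite (_ : incdens e = qpos E q e.1 e.2); first exact: measurable_qpos.
  by apply/funext => t; rewrite /incdens eE.
rewrite (_ : incdens e = \1_(`]0%R, 1%R]%classic : set R)); first exact: measurable_indic.
by apply/funext => t; rewrite /incdens (negbTE eE).
Qed.

Definition inclaw (e : V * V) : set R -> \bar R :=
  pushforward (mdens mu (measurable_incdens e) (incdens_ge0 e)) (fun x : measurableTypeR R => x : R).

HB.instance Definition _ e := Measure.copy (inclaw e)
  (mpush (mdens mu (measurable_incdens e) (incdens_ge0 e)) (@measurable_copy R)).

Let inclaw_setT e : inclaw e setT = 1.
Proof.
rewrite -[LHS]/(\int[mu]_t (incdens e t)%:E).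
have [eE|eE] := boolP (e \in E).
  rewrite -(@integral_qpos _ _ E q pdfq e.1 e.2); last by case: e eE.
  by apply: eq_integral => t _; rewrite /incdens eE.
transitivity (\int[mu]_t (\1_(`]0%R, 1%R]%classic) t)%:E).
  by apply: eq_integral => t _; rewrite /incdens (negbTE eE).
rewrite integral_indic// setIT.
by rewrite -[LHS]/(mu `]0%R, 1%R]%classic) lebesgue_measure_itv/= lte_fin ltr01 oppr0 adde0.
Qed.

HB.instance Definition _ e := Measure_isProbability.Build _ _ _ (inclaw e) (inclaw_setT e).

Lemma inclawE a b A : (a, b) \in E -> measurable A ->
  inclaw (a, b) A = \int[mu]_(y in A `&` `]0%R, +oo[) (q a b y)%:E.
Proof.
move=> ab mA; rewrite -(@integral_qposI _ _ E)// -[LHS]/(\int[mu]_(t in A) (incdens (a, b) t)%:E).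
by apply: eq_integral => t _; rewrite /incdens ab.
Qed.

Lemma inclaw_ge0 e : inclaw e `[0%R, +oo[%classic = 1.
Proof.
rewrite -(inclaw_setT e) -[LHS]/(\int[mu]_(t in `[0%R, +oo[) (incdens e t)%:E).
rewrite integral_mkcond; apply: eq_integral => t _; rewrite patchE mem_setE in_itv/= andbT.
case: leP => // t0; rewrite /incdens; case: ifP => _.
  by rewrite /qpos ltNge (ltW t0) andbF.
by rewrite indicE memNset//= in_itv/= ltNge (ltW t0).
Qed.

Lemma inclaw0 e : inclaw e [set 0%R] = 0.
Proof.
rewrite -[LHS]/(\int[mu]_(t in [set 0%R]) (incdens e t)%:E) integral0_eq// => t /= ->.
rewrite /incdens; case: ifP => _; first by rewrite /qpos ltxx andbF.
by rewrite indicE memNset//= in_itv/= ltxx.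
Qed.

End IncrementLaw.

(** * The transition densities as a version of the conditional distribution *)

Section TransitionKernel.
Context (R : realType) (V : finType) d (Omega : measurableType d)
  (P : probability Omega R) (X : V -> {RV P >-> R}) (f : rvec R V -> R).
Hypothesis densf : joint_density X f.
Variables (a b : V).
Local Notation mu := (@lebesgue_measure R).
Local Open Scope ereal_scope.

Let mtr x : measurable_fun setT (transition f a b x : measurableTypeR R -> R).
Proof. exact: (measurableT_comp (measurable_transition densf a b) (pair1_measurable x)). Qed.

Definition trkernel (x : R) : {measure set R -> \bar R} :=
  mpush (mdens mu (mtr x) (transition_ge0 densf a b x)) (@measurable_copy R).

Let measurable_trkernel U : measurable U -> measurable_fun [set: R] (trkernel ^~ U).
Proof. by move=> mU; exact: (measurable_kernel_mass densf a b mU). Qed.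

HB.instance Definition _ := isKernel.Build _ _ R R R trkernel measurable_trkernel.

Let trkernel_setT x : trkernel x setT = 1.
Proof. exact: integral_transition. Qed.

HB.instance Definition _ := Kernel_isProbability.Build _ _ R R R trkernel trkernel_setT.

Lemma trkernel_cond : a != b ->
  cond_distribution (X b) (X a) (trkernel : R.-pker R ~> R).
Proof.
move=> ab; split=> [x _|A B mA mB].
  rewrite -(integral_transition f a b x) -[LHS]/(\int[mu]_(t in `[0%R, +oo[) (transition f a b x t)%:E).
  rewrite integral_mkcond; apply: eq_integral => t _; rewrite patchE mem_setE in_itv/= andbT.
  by case: leP => // t0; rewrite transition_nonpos// ltW.
rewrite (pair_law densf ab mA mB) -[X a @^-1` A]setTI integral_setI_indic.
rewrite -[A in RHS]setTI integral_setI_indic ge0_integral_distribution.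
- by apply: eq_integral => w _; rewrite /= !indicE.
- apply: emeasurable_funM; first by apply/measurable_EFinP; exact: measurable_indic.
  exact: measurable_trkernel.
- by move=> x; rewrite mule_ge0// lee_fin indicE.
Qed.

(** For t > 0, [h t] is the density of X_b / t given X_a = t. All these densities and their limit
    have mass 1, so Scheffe's lemma upgrades pointwise convergence to weak convergence. *)
Lemma trkernel_cvg (nu : probability R R) (r : R -> R) :
  measurable_fun setT (r : measurableTypeR R -> R) -> (forall t, (0 <= r t)%R) ->
  (forall t, (t <= 0)%R -> r t = 0%R) ->
  (forall A, measurable A -> nu A = \int[mu]_(t in A) (r t)%:E) ->
  (forall y : R, (0 < y)%R -> t * transition f a b t (t * y) @[t --> +oo%R] --> r y)%R ->
  weak_cvg (fun x => pushforward (trkernel x) (fun y : R => y / x)%R) nu.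
Proof.
move=> mr r0 rneg nuE rcvg phi cphi [C phiC].
pose I := `[0%R, +oo[%classic : set (measurableTypeR R).
have mI : measurable I by exact: measurable_itv.
have mphi : measurable_fun I (phi : measurableTypeR R -> R).
  by apply: subspace_continuous_measurable_fun.
pose h t y := (`|t| * transition f a b t (t * y))%R.
have mh t : measurable_fun setT (h t : measurableTypeR R -> R).
  apply: measurable_funM => //; apply: (measurableT_comp (mtr t)).
  exact: measurable_funM.
have h0 t y : (0 <= h t y)%R by rewrite mulr_ge0// (transition_ge0 densf).
have mass (k : measurableTypeR R -> R) : (forall y, (y <= 0)%R -> k y = 0%R) ->
    \int[mu]_(y in I) (k y)%:E = \int[mu]_y (k y)%:E.
  move=> k0; rewrite integral_mkcond; apply: eq_integral => y _.
  rewrite patchE mem_setE in_itv/= andbT; case: leP => // y0.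
  by rewrite k0// ltW.
have rI : \int[mu]_(y in I) (r y)%:E = 1.
  by rewrite mass// -nuE// probability_setT.
have hI t : (0 < t)%R -> \int[mu]_(y in I) (h t y)%:E = 1.
  move=> t0; rewrite mass; last first.
    move=> y y0; rewrite /h transition_nonpos ?mulr0//.
    by rewrite pmulr_rle0.
  rewrite -(integral_transition f a b t) [RHS](ge0_integral_scale t0).
  - by apply: eq_integral => y _; rewrite /h gtr0_norm// EFinM.
  - by apply/measurable_EFinP; exact: (mtr t).
  - by move=> y; rewrite lee_fin (transition_ge0 densf).
have lim : \int[mu]_(y in I) (h t y)%:E @[t --> +oo%R] --> \int[mu]_(y in I) (r y)%:E.
  rewrite rI; apply: cvg_near_cst; near=> t; apply: hI.
  by near: t; exact: near_gt0.
have C0 : (0 <= C)%R by apply: le_trans (phiC 0%R (lexx _)).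
have H := @scheffe_pinfty _ _ _ mu I mI h r phi C (fun t => measurable_funTS (mh t))
  (measurable_funTS mr) (fun t x _ => h0 t x) (fun x _ => r0 x) _ _ lim mphi C0 _.
have -> : \int[nu]_(y in `[0%R, +oo[) (phi y)%:E = \int[mu]_(y in I) (phi y * r y)%:E.
  rewrite (integral_copy (m := mdens mu mr r0))//.
    by rewrite integral_mdens//; exact/measurable_EFinP.
  exact/measurable_EFinP.
have {}H : \int[mu]_(y in I) (phi y * h t y)%:E @[t --> +oo%R] -->
    \int[mu]_(y in I) (phi y * r y)%:E.
  apply: H.
  - move=> y _; have [y0|y0] := ltP 0%R y; last first.
      rewrite rneg//; apply: cvg_near_cst; near=> t.
      have t0 : (0 < t)%R by near: t; exact: near_gt0.
      by rewrite /h transition_nonpos ?mulr0// pmulr_rle0.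
    apply: cvg_trans (rcvg y y0); apply: near_eq_cvg; near=> t.
    have t0 : (0 < t)%R by near: t; exact: near_gt0.
    by rewrite /h gtr0_norm.
  - by rewrite rI ltry.
  - by move=> y; rewrite /I/= in_itv/= andbT => /phiC.
apply: cvg_trans H; apply: near_eq_cvg; near=> t.
have t0 : (0 < t)%R by near: t; exact: near_gt0.
have mt : measurable_fun setT (fun y : R => y / t)%R by exact: measurable_funM.
rewrite -[RHS]/(\int[mpush (trkernel t) mt]_(y in I) (phi y)%:E).
rewrite (integral_copy (m := mdens mu (mh t) (h0 t)))//.
- by rewrite integral_mdens//; exact/measurable_EFinP.
- move=> A mA; rewrite -[LHS]/(\int[mu]_(y in (fun y => y / t)%R @^-1` A) (transition f a b t y)%:E).
  rewrite -[RHS]/(\int[mu]_(y in A) (h t y)%:E).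
  have mA' : measurable ((fun y : measurableTypeR R => y / t)%R @^-1` A).
    by rewrite -[X in measurable X]setTI; exact: mt.
  rewrite -[X in \int[mu]_(y in X) _ = _]setTI integral_setI_indic (ge0_integral_scale t0).
  + rewrite -[A in RHS]setTI integral_setI_indic; apply: eq_integral => y _.
    rewrite /h gtr0_norm// EFinM muleCA; congr (_ * _).
    have ty : (t * y / t = y)%R by rewrite mulrAC divff ?mul1r ?gt_eqF.
    by rewrite !indicE; congr ((nat_of_bool _)%:R%:E); apply/idP/idP => /set_mem /=;
      rewrite ?ty => yA; apply/mem_set => //=; rewrite ty.
  + have m1 : measurable_fun setT (\1_((fun y : measurableTypeR R => y / t)%R @^-1` A) : measurableTypeR R -> R).
      exact: measurable_indic.
    by apply: emeasurable_funM; apply/measurable_EFinP; [exact: m1|exact: (mtr t)].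
  + by move=> y; rewrite mule_ge0// lee_fin ?indicE// (transition_ge0 densf).
- exact/measurable_EFinP.
Unshelve. all: by end_near. Qed.

End TransitionKernel.

(** * Change of root *)

Section Tilting.
Context (R : realType) (V : finType) d (Omega : measurableType d)
  (P : probability Omega R).
Local Notation T := (rvec R V).
Local Notation O := (@orthant0 R V).
Local Notation mu := (@lebesgue_measure R).
Local Open Scope ereal_scope.
Variables (alpha : R) (c : V -> R) (N : V -> {measure set T -> \bar R})
  (Th : V -> Omega -> T).
Hypotheses (alpha0 : (0 < alpha)%R) (c_gt0 : forall v, (0 < c v)%R).
Hypothesis mTh : forall u v, measurable_fun setT (fun w => Th u w v).
Hypothesis Th_ge0 : forall u w v, (0 <= Th u w v)%R.
Hypothesis Th_root : forall u w, Th u w u = 1%R.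
Hypothesis N_root : forall u u' A, measurable A -> N u A = N u' A.
Hypothesis N_mass : forall u, N u [set x | (1 < x u)%R] = (c u)%:E.
Hypothesis N_polar : forall u (F : T -> \bar R), measurable_fun setT F ->
  (forall x, 0 <= F x) ->
  \int[N u]_x F x = (c u)%:E * \int[P]_w \int[mu]_(z in `]0%R, +oo[)
    (F (fun v => z * Th u w v)%R * (alpha * z `^ (- alpha - 1))%:E).

(** The radial mass of z > 1/r. At r = 0 both sides are 0, so the formula covers a vanishing
    Theta. *)
Lemma integral_power_indic (r : R) : (0 <= r)%R ->
  \int[mu]_(z in `]0%R, +oo[) ((1 < z * r)%R%:R%:E * (alpha * z `^ (- alpha - 1))%:E) =
  (r `^ alpha)%:E.
Proof.
rewrite le_eqVlt => /predU1P[<-|r0].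
  rewrite powR0 ?gt_eqF// integral0_eq// => z _.
  by rewrite mulr0 ltr10 mul0e.
have -> : (r `^ alpha = r^-1 `^ (- alpha))%R.
  by rewrite -powR_inv1 ?(ltW r0)// -powRrM mulN1r opprK.
rewrite -integral_power_tail ?invr_gt0// integral_mkcond [RHS]integral_mkcond.
apply: eq_integral => z _; rewrite !patchE !mem_setE !in_itv/= !andbT.
rewrite -(mul1r r^-1)%R ltr_pdivrMr//; case: ifPn => z0; last first.
  rewrite -leNgt in z0; rewrite ifF//; apply/negbTE; rewrite -leNgt.
  by rewrite (le_trans _ (@ler01 R))// mulr_le0_ge0// ltW.
by case: ifP => _; rewrite ?mul1e ?mul0e.
Qed.

(** The integrand depends on x / x_u' and on whether x_u' > 1. As the measure is the same for all
    roots, it may be integrated in polar form from u: the ratio does not depend on the radius, and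
    the radial integral of the constraint is Theta_(u,u')^alpha. *)
Lemma tilt u u' (h : T -> R) : measurable_fun setT h -> (forall x, 0 <= h x)%R ->
  \int[N u']_x (h (fun v => x v * x u' `^ (- 1)) * (1 < x u')%R%:R)%:E =
  (c u)%:E * \int[P]_w (h (fun v => Th u w v / Th u w u') * Th u w u' `^ alpha)%:E.
Proof.
move=> mh h0; pose F (x : T) := (h (fun v => x v * x u' `^ (- 1)) * (1 < x u')%R%:R)%:E.
have mF : measurable_fun setT F.
  apply/measurable_EFinP; apply: measurable_funM; last first.
    rewrite (_ : (fun x : T => _) = \1_[set x : T | (1 < x u')%R]).
      by apply: measurable_indic; exact: measurable_coord_gt.
    by apply/funext => x; rewrite indic_coord_gt.
  apply: (measurableT_comp mh); apply: measurable_to_rvec => v.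
  apply: measurable_funM; first exact: measurable_coord.
  exact: (measurableT_comp (measurable_powR _) (measurable_coord u')).
have F0 x : 0 <= F x by rewrite lee_fin mulr_ge0.
rewrite -[LHS]/(\int[N u']_x F x).
rewrite (@eq_measure_integral _ _ _ _ (N u)); last by move=> A mA _; exact: N_root.
rewrite N_polar//; congr (_ * _); apply: eq_integral => w _.
rewrite EFinM -integral_power_indic// -ge0_integralZl//; last 3 first.
- apply: emeasurable_funM; last first.
    apply/measurable_EFinP; apply: measurable_funTS.
    by apply: measurable_funM => //; exact: measurable_powR.
  apply/measurable_EFinP; apply: measurable_funTS.
  rewrite (_ : (fun z : measurableTypeR R => _) =
    \1_((fun z : measurableTypeR R => (z * Th u w u')%R : measurableTypeR R) @^-1` `]1%R, +oo[)).
    apply: measurable_indic; rewrite -[X in measurable X]setTI.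
    have mm : measurable_fun setT (fun z : measurableTypeR R => (z * Th u w u')%R : measurableTypeR R).
      exact: measurable_funM.
    exact: mm.
  apply/funext => z; rewrite indicE; congr (nat_of_bool _)%:R.
  by apply/idP/idP => [z1|/set_mem/=]; [apply/mem_set|]; rewrite /= in_itv/= andbT.
- by move=> z _; rewrite mule_ge0// lee_fin mulr_ge0 ?powR_ge0 ?ltW.
- by rewrite lee_fin.
apply: eq_integral => z; rewrite inE/= in_itv/= andbT => z0.
rewrite [RHS]muleA; congr (_ * _); rewrite /F -EFinM; congr EFin.
have [zr|] := boolP (1 < z * Th u w u')%R; last by rewrite !mulr0.
congr (_ * _)%R; congr h; apply/funext => v.
have r0 : (0 < Th u w u')%R.
  rewrite lt_neqAle Th_ge0 andbT eq_sym; apply: contraTneq zr => ->.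
  by rewrite mulr0 ltr10.
rewrite powR_inv1 ?mulr_ge0 ?(ltW z0)//.
by field; rewrite !gt_eqF.
Qed.

(** Tilting with h = 1: the left side is the mass of x_v > 1, which is c_v. *)
Lemma Th_moment u v : \int[P]_w (Th u w v `^ alpha)%:E = (c v / c u)%:E.
Proof.
have := @tilt u v (cst 1%R) (measurable_cst _) (fun=> ler01).
have -> : \int[N v]_x (cst 1 (fun v0 => x v0 * x v `^ (- 1)) * (1 < x v)%R%:R)%:E = (c v)%:E :> \bar R.
  rewrite -N_mass -[X in N v X]setIT -integral_indic//; last exact: measurable_coord_gt.
  by apply: eq_integral => x _; rewrite indic_coord_gt mul1r.
under eq_integral do rewrite mul1r.
move=> H; have cu := c_gt0 u.
rewrite mulrC EFinM H muleA -EFinM mulVf ?gt_eqF// mul1e.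
by [].
Qed.

(** The left side of [tilt] does not mention the root, so its right sides for u and u' agree; for u'
    the tilting factor is Theta_(u',u')^alpha = 1. *)
Lemma Th_change u u' (h : T -> R) : measurable_fun O h -> (forall x, O x -> 0 <= h x)%R ->
  \int[P]_w (h (Th u' w))%:E =
  \int[P]_w (h (fun v => Th u w v / Th u w u') * Th u w u' `^ alpha)%:E / (c u' / c u)%:E.
Proof.
move=> mh h0; pose hO := h \_ O.
have mhO : measurable_fun setT hO.
  exact: (measurable_restrictT h (@measurable_orthant0 R V)).1.
have hO0 x : (0 <= hO x)%R by rewrite /hO patchE; case: ifP => // /set_mem; exact: h0.
have ThO a w : O (Th a w).
  by apply/orthant0_gt0; split=> [v|]; [exact: Th_ge0|exists a; rewrite Th_root].
have H a : \int[N u']_x (hO (fun v => x v * x u' `^ (- 1)) * (1 < x u')%R%:R)%:E =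
    (c a)%:E * \int[P]_w (h (fun v => Th a w v / Th a w u') * Th a w u' `^ alpha)%:E.
  rewrite (tilt a u' mhO hO0); congr (_ * _); apply: eq_integral => w _; congr EFin.
  (* Where Theta_(a,u') = 0 the quotient is a division by zero, possibly outside the domain of h,
     but the factor 0^alpha = 0 cancels it on both sides. *)
  have [->|r0] := eqVneq (Th a w u') 0%R; first by rewrite powR0 ?gt_eqF// !mulr0.
  rewrite /hO patchE mem_set//; apply/orthant0_gt0; split=> [v|].
    by rewrite divr_ge0.
  by exists u'; rewrite divff.
have := H u'; rewrite (H u).
have -> : \int[P]_w (h (fun v => Th u' w v / Th u' w u') * Th u' w u' `^ alpha)%:E =
    \int[P]_w (h (Th u' w))%:E.
  apply: eq_integral => w _; rewrite Th_root powR1 mulr1; congr (h _)%:E.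
  by apply/funext => v; rewrite divr1.
move=> E1; have cu := c_gt0 u; have cu' := c_gt0 u'.
rewrite inver gt_eqF ?divr_gt0// invf_div muleC mulrC EFinM -muleA E1 muleA -EFinM.
by rewrite mulVf ?gt_eqF// mul1e.
Qed.

Lemma N_formula u (h : T -> \bar R) : measurable_fun O h -> (forall x, O x -> 0 <= h x) ->
  \int[N u]_(x in O) h x = (c u)%:E * \int[P]_w \int[mu]_(z in `]0%R, +oo[)
    (h (fun v => z * Th u w v)%R * (alpha * z `^ (- alpha - 1))%:E).
Proof.
move=> mh h0.
rewrite integral_mkcond N_polar; last 2 first.
- exact: (measurable_restrictT h (@measurable_orthant0 R V)).1.
- by move=> x; rewrite patchE; case: ifP => // /set_mem; exact: h0.
congr (_ * _); apply: eq_integral => w _; apply: eq_integral => z.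
rewrite inE/= in_itv/= andbT => z0; rewrite patchE mem_set//.
apply/orthant0_gt0; split=> [v|]; first by rewrite mulr_ge0// ltW.
by exists u; rewrite Th_root mulr1.
Qed.

End Tilting.

Unset Implicit Arguments.

Theorem theorem5p1 (R : realType) (V : finType) (cardV : (2 <= #|V|)%N)
  (E : {set V * V}) (treeE : undirected_tree E)
  (d : measure_display) (Omega : measurableType d) (P : probability Omega R)
  (X : V -> {RV P >-> R}) (X_ge0 : forall v w, 0 <= X v w)
  (markovX : global_markov X E)
  (f : rvec R V -> R) (densf : joint_density X f)
  (alpha : R) (halpha : - alpha - 1 < -1)
  (g : R -> R) (rvg : regularly_varying g (- alpha - 1))
  (c : V -> R) (c_gt0 : forall v, 0 < c v)
  (fg : forall v,
     (marginal1 f v t / (g t)%:E)%E @[t --> +oo] --> (c v)%:E)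
  (q : V -> V -> R -> R)
  (pdfq : forall a b, (a, b) \in E -> pdf_pos (q a b))
  (fq : forall a b, (a, b) \in E -> forall y : R, 0 < y ->
     (t%:E * marginal2 f a b t (t * y)%R / marginal1 f a t)%E @[t --> +oo]
       --> (q a b y)%:E) :
  let b := fun t : R => alpha / (t * g t) in
  exists mu : V * V -> probability R R,
  [/\ [/\ regularly_varying b alpha,
          forall u, ((b t)%:E * P [set w | (t < X u w)%R])%E @[t --> +oo]
            --> (c u)%:E,
          forall e, e \in E -> mu e `[0, +oo[%classic = 1%E
        & forall e, e \in E -> exists2 k : R.-pker R ~> R,
            cond_distribution (X e.2) (X e.1) k /\
            weak_cvg (fun x => pushforward (k x) (fun y : R => y / x)) (mu e)
          & (exists u e', [/\ away_from E u e, e' \in tree_path E u e.1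
                            & (0%E < mu e' [set 0%R])%E]) ->
            forall eta, 0 < eta ->
              limf_esup (fun x : R =>
                ereal_sup [set k (eps * x) [set y | eta < y / x]
                          | eps in `[0, delta]]) +oo%R
                @[delta --> 0^'+] --> 0%E],
      forall a b, (a, b) \in E ->
        (forall A : set R, measurable A ->
           mu (a, b) A =
           (\int[lebesgue_measure]_(y in A `&` `]0%R, +oo[) (q a b y)%:E)%E) /\
        {ae (@lebesgue_measure R), forall y : R, 0 < y ->
           c b * y `^ alpha * q b a y = c a * y ^- 2 * q a b y^-1}
    & forall (d' : measure_display) (Omega' : measurableType d')
        (P' : probability Omega' R) (M : V * V -> {RV P' >-> R}),
      (forall e w, e \in E -> 0 <= M e w) ->
      (forall e, e \in E -> forall A : set R, measurable A ->
         distribution P' (M e) A = mu e A) ->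
      independent_on E M ->
      [/\ forall u v,
            'E_P'[fun w => (Theta E M u w v `^ alpha)%R]%E = (c v / c u)%:E,
          exists (m : R -> M0 R V) (nu : M0 R V),
            [/\ \forall t \near +oo, forall A : set (rvec R V), measurable A ->
                  m t A = ((b t)%:E *
                    P [set w | (A `&` @orthant0 R V) (fun v => X v w / t)%R])%E,
                m t @[t --> +oo] --> nu
              & forall (u : V) (h : rvec R V -> \bar R),
                  measurable_fun (@orthant0 R V) h ->
                  (forall x, orthant0 x -> (0 <= h x)%E) ->
                  (\int[nu]_(x in @orthant0 R V) h x =
                   (c u)%:E * \int[P']_w \int[lebesgue_measure]_(z in `]0%R, +oo[)
                     (h (fun v => z * Theta E M u w v)%R *
                      (alpha * z `^ (- alpha - 1))%:E))%E]
        & forall (u u' : V) (h : rvec R V -> R),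
            measurable_fun (@orthant0 R V) h ->
            (forall x, orthant0 x -> 0 <= h x) ->
            ('E_P'[fun w => h (Theta E M u' w)] =
             'E_P'[fun w => (h (fun v => Theta E M u w v / Theta E M u w u') *
                             Theta E M u w u' `^ alpha)%R] /
             'E_P'[fun w => (Theta E M u w u' `^ alpha)%R])%E]].
Proof.
move=> b; have alpha0 : 0 < alpha by move: halpha; lra.
have [noloop _ _] := treeE.
have edge_neq x y : (x, y) \in E -> x != y.
  by move=> xyE; apply: contraTneq xyE => ->; exact: noloop.
(* An attachment order and a parent map are fixed for every root, because all roots are needed at
   once in the gluing and in the change of root. *)
have /choice[root rootP] : forall u, exists sp : seq V * (V -> V),
    perm_eq (u :: sp.1) (enum V) /\
    forall p v q, sp.1 = p ++ v :: q -> attached E u p v (sp.2 v).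
  by move=> u; have [s [parent H]] := tree_order treeE u; exists (s, parent).
have perm_s u : perm_eq (u :: (root u).1) (enum V) by have [] := rootP u.
have att u : forall p v q, (root u).1 = p ++ v :: q -> attached E u p v ((root u).2 v).
  by have [_] := rootP u.
pose lam u := hlim E q alpha c u (root u).2 (root u).1.
have mlam u : measurable_fun setT (lam u) by exact: measurable_hlim.
have lam0 u x : 0 <= lam u x by exact: hlim_ge0.
pose N u := mdens (lebvec R V) (mlam u) (lam0 u).
have NE u (F : rvec R V -> \bar R) : measurable_fun setT F -> (forall x, 0 <= F x)%E ->
    (\int[N u]_x F x = \int[lebvec R V]_x ((lam u x)%:E * F x))%E.
  by move=> mF F0; rewrite ge0_integral_mdens//; apply: eq_integral => x _; rewrite muleC.
have b_gt0' : \forall t \near +oo, 0 < b t by exact: (b_gt0 alpha0 rvg).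
have Nmass u (e : R) : 0 < e -> (N u [set x | (e < x u)%R] = (c u * e `^ (- alpha))%:E)%E.
  move=> e0; rewrite -[X in N u X]setIT -integral_indic//; last exact: measurable_coord_gt.
  rewrite NE; last 2 first.
  - by apply/measurable_EFinP; apply: measurable_indic; exact: measurable_coord_gt.
  - by move=> x; rewrite lee_fin indicE.
  exact: (hlim_mass pdfq alpha0 c_gt0 (perm_s u) (att u) e0).
have Npos u : N u (~` [set x | forall v, 0 < x v]) = 0%E.
  rewrite mdensE integral0_eq// => x /= /existsNP[v /negP]; rewrite -leNgt => xv.
  by rewrite /lam (hlim_nonpos _ _ _ _ _ (perm_s u) xv).
have Nlim u (phi : rvec R V -> R) (C e : R) : 0 < e -> measurable_fun setT phi ->
    (forall x, 0 <= phi x <= C) ->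
    scaled_mean X b (fun x => phi x * \1_[set x : rvec R V | e < x u] x) t @[t --> +oo] -->
    (\int[N u]_x (phi x * \1_[set x : rvec R V | e < x u] x)%:E)%E.
  move=> e0 mphi phiC; rewrite NE; last 2 first.
  - apply/measurable_EFinP; apply: measurable_funM => //.
    by apply: measurable_indic; exact: measurable_coord_gt.
  - by move=> x; have /andP[p0 _] := phiC x; rewrite lee_fin mulr_ge0// indicE.
  exact: (root_limit noloop pdfq densf markovX alpha0 rvg c_gt0 fg fq (perm_s u) (att u) e0 mphi phiC).
have Nfin u (e : R) : 0 < e -> (N u [set x | (e < x u)%R] < +oo)%E.
  by move=> e0; rewrite Nmass// ltry.
have Nroot u u' A : measurable A -> N u A = N u' A.
  exact: (N_root_eq (P := P) (X := X) (b := b) Nlim Npos).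
have cvg_edge x y : (x, y) \in E -> forall z : R, 0 < z ->
    t * transition f x y t (t * z) @[t --> +oo] --> q x y z.
  move=> xyE z z0.
  exact: (transition_cvg densf rvg c_gt0 fg (edge_neq _ _ xyE) z0 (fq _ _ xyE _ z0)).
exists (fun e => inclaw pdfq e : probability R R); split.
- split.
  + exact: regularly_varying_b.
  + by move=> u; exact: (tail_b densf alpha0 rvg c_gt0 fg).
  + by move=> e _; exact: inclaw_ge0.
  + case=> x y xyE; exists (trkernel densf x y : R.-pker R ~> R); last first.
      by move=> [u [e' [_ _]]] /=; rewrite [X in (_ < X)%E](inclaw0 pdfq e') ltxx.
    split; first by apply: trkernel_cond; exact: edge_neq.
    apply: (@trkernel_cvg _ _ _ _ _ _ _ _ _ _ _ (qpos E q x y)).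
    * exact: measurable_qpos.
    * exact: qpos_ge0.
    * by move=> t t0; rewrite /qpos ltNge t0 andbF.
    * by move=> A mA; rewrite [LHS](inclawE pdfq)// -(@integral_qposI _ _ E).
    * by move=> z z0; rewrite /qpos xyE z0 /=; exact: cvg_edge.
- move=> x y xyE; split; first by move=> A mA; exact: inclawE.
  have yxE : (y, x) \in E by have [_ symE _] := treeE; exact: symE.
  (* The versions at hand give the identity at every positive z. *)
  apply: aeW => z z0.
  apply: (transition_swap densf rvg c_gt0 fg (edge_neq _ _ xyE) z0 (cvg_edge _ _ yxE z z0)).
  by apply: cvg_edge => //; rewrite invr_gt0.
move=> d' Omega' P' M M_ge0 M_law indepM.
have M_law' e : e \in E -> forall A : set R, measurable A ->
    P' (M e @^-1` A) = (\int[lebesgue_measure]_(t in A) (qpos E q e.1 e.2 t)%:E)%E.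
  move=> eE A mA; rewrite -[LHS]/(distribution P' (M e) A) M_law//.
  case: e eE => x y xyE; rewrite [LHS](inclawE pdfq)//.
  by rewrite -(@integral_qposI _ _ E).
pose Th u w := Theta E M u w.
have mTh u v : measurable_fun setT (fun w => Th u w v) by exact: measurable_Theta.
have Th_ge0 u w v : 0 <= Th u w v.
  rewrite /Th /Theta prodr_ge0// => e eT; apply: M_ge0.
  by have /fintype.subsetP := tree_path_sub treeE u v; exact.
have Th_root u w : Th u w u = 1 by rewrite /Th /Theta tree_path_refl// big_set0.
have N_polar u (F : rvec R V -> \bar R) : measurable_fun setT F -> (forall x, 0 <= F x)%E ->
    (\int[N u]_x F x = (c u)%:E * \int[P']_w \int[lebesgue_measure]_(z in `]0%R, +oo[)
      (F (fun v => z * Th u w v)%R * (alpha * z `^ (- alpha - 1))%:E))%E.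
  move=> mF F0; rewrite NE//.
  exact: (Theta_polar pdfq treeE (perm_s u) (att u) M_law' indepM alpha0 (c_gt0 u)).
have N_mass1 u : N u [set x | 1 < x u] = (c u)%:E by rewrite Nmass// powR1 mulr1.
have moment u v := Th_moment alpha0 c_gt0 Th_ge0 Nroot N_mass1 N_polar u v.
split.
- by move=> u v; rewrite unlock; exact: moment.
(* The limit measure is represented as seen from one node u0; [Nroot] later transports it to any
   root u. *)
- have /card_gt0P[u0 _] : (0 < #|V|)%N by exact: leq_trans cardV.
  have glue := @glue_limit _ _ _ _ P X b N b_gt0' Nlim Npos Nfin u0.
  have Nsupp : N u0 (~` @orthant0 R V) = 0%E.
    rewrite mdensE integral0_eq// => x /= xO.
    (* A vector with all coordinates positive lies in the punctured orthant, so off it some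
       coordinate is nonpositive and the limit density vanishes. *)
    have [v xv] : exists v, x v <= 0.
      apply: contrapT => /forallNP H; apply: xO; apply/orthant0_gt0.
      split=> [v|]; last exists u0; have /negP := H u0; rewrite -?ltNge//.
      by move=> _; have /negP := H v; rewrite -ltNge => /ltW.
    by rewrite /lam (hlim_nonpos _ _ _ _ _ (perm_s u0) xv).
  have [m [nu [nuE mE mnu]]] := M0_limit (P := P) (X := X) b_gt0' glue Nsupp.
  exists m, nu; split=> // u h mh h0.
  rewrite nuE (@eq_measure_integral _ _ _ _ (N u)); last by move=> A mA _; exact: Nroot.
  exact: (N_formula Th_ge0 Th_root N_polar).
- move=> u u' h mh h0; rewrite unlock moment.
  exact: (Th_change alpha0 c_gt0 Th_ge0 Th_root Nroot N_polar).
Qed.
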